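(* Consider the Cauchy problem $$\frac{d}{dt}u(t)-N(t,u(t))\,u(t)=\phi(t),\qquad u(t_0)=u_0\in\mathbb R^m,\qquad t\in[t_0,+\infty),$$ and assume: 1. $N(t,u)=\sum_{p=0}^{\infty}\sum_{i_1+\dots+i_m=p}u_1^{i_1}\cdots u_m^{i_m}N_{i_1\dots i_m}(t)$ for all $(t,u)\in[t_0,+\infty)\times\mathbb R^m$, where each $N_{i_1\dots i_m}:[t_0,+\infty)\to\mathbb R^{m\times m}$ is continuous, and there is a sequence of nonnegative reals $(B_p)_{p\ge0}$ with $\sum_{i_1+\dots+i_m=p}\sup_{t\ge t_0}\|N_{i_1\dots i_m}(t)\|\le B_p$ for all $p\ge0$ and such that $\sum_{p\ge0}B_pu^p$ converges for every $u\in\mathbb R$; 2. $\phi:[t_0,+\infty)\to\mathbb R^m$ is continuous and $\sup_{t\ge t_0}\|\phi(t)\|\le\kappa<+\infty$; 3. there is $\alpha>0$ such that $\langle v,J(t,u)v\rangle\le-\alpha\langle v,v\rangle$ for all $v,u\in\mathbb R^m$ and all $t\ge t_0$. Then for every $u_0\in\mathbb R^m$ the Cauchy problem has a unique solution $u(t)$ on $[t_0,+\infty)$, the FD-method for this problem converges to $u$ (in the sense defined in the context), and there exist positive constants $C,R,\varepsilon$, depending only on the data $N,\phi,u_0$ of the problem (not on the grid), such that for every grid $\hat\omega$ with maximal step $h$ and every integer $p\ge0$: $$\sup_{t\ge t_0}\Big\|u(t)-\overset{p}{u}(t)\Big\|\le\frac{C}{(p+1)^{1+\varepsilon}}\,\frac{(h/R)^{p+1}}{1-h/R}\quad\text{if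 } h<R,$$ $$\sup_{t\ge t_0}\Big\|u(t)-\overset{p}{u}(t)\Big\|\le C\sum_{j=p+1}^{\infty}\frac{1}{(j+1)^{1+\varepsilon}}\quad\text{if } h=R.$$
   Context: $\|\cdot\|$ is the Euclidean norm on $\mathbb R^m$ (and the induced operator norm on $\mathbb R^{m\times m}$), $\langle\cdot,\cdot\rangle$ the Euclidean inner product. $J(t,u)$ is the Jacobian in $u$ of $u\mapsto N(t,u)u$: $J(t,u)=N(t,u)+\big[\tfrac{\partial N}{\partial u_1}(t,u)u,\dots,\tfrac{\partial N}{\partial u_m}(t,u)u\big]$ (the matrix whose $p$-th column is $\tfrac{\partial N}{\partial u_p}(t,u)u$). Adomian polynomials: for a smooth matrix-valued function $M$ of $u\in\mathbb R^m$ and $v_0,\dots,v_k\in\mathbb R^m$, $A_k(M;v_0,\dots,v_k)=\frac1{k!}\frac{d^k}{d\tau^k}M\big(\sum_{i=0}^k\tau^iv_i\big)\big|_{\tau=0}$ (so $A_0(M;v_0)=M(v_0)$); $A_k(N(t,\cdot);\dots)$ means this applied to $u\mapsto N(t,u)$ with $t$ fixed. Grid: $\hat\omega=\{t_0<t_1<t_2<\dots\}$, $t_n\to+\infty$, $h_i=t_i-t_{i-1}$, $h=\sup_i h_i$. FD-method: $u^{(0)}$ is the continuous function on $[t_0,\infty)$, $C^1$ on each $[t_{i-1},t_i]$, solving the base problem $\frac{d}{dt}u^{(0)}(t)-N(t,u^{(0)}(t_{i-1}))u^{(0)}(t)=\phi(t)$ for $t\in[t_{i-1},t_i)$, $i\ge1$,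 $u^{(0)}(t_0)=u_0$. For $j\ge1$, $u^{(j)}$ is the continuous function, $C^1$ on each $[t_{i-1},t_i]$, with $u^{(j)}(t_0)=0$ and, for $t\in[t_{i-1},t_i)$, $$\tfrac{d}{dt}u^{(j)}(t)-N(t,u^{(0)}(t_{i-1}))u^{(j)}(t)=\Big[\sum_{p=1}^m\tfrac{\partial N}{\partial u_p}(t,u^{(0)}(t_{i-1}))\,u^{(j)}_p(t_{i-1})\Big]u^{(0)}(t)+F^{(j)}(t),$$ where, for $t\in[t_{i-1},t_i)$, $F^{(j)}(t)=\sum_{p=1}^{j-1}A_{j-p}\big(N(t,\cdot);u^{(0)}(t_{i-1}),\dots,u^{(j-p)}(t_{i-1})\big)u^{(p)}(t)+\sum_{p=0}^{j-1}\big[A_{j-1-p}\big(N(t,\cdot);u^{(0)}(t),\dots,u^{(j-1-p)}(t)\big)-A_{j-1-p}\big(N(t,\cdot);u^{(0)}(t_{i-1}),\dots,u^{(j-1-p)}(t_{i-1})\big)\big]u^{(p)}(t)+A_j\big(N(t,\cdot);u^{(0)}(t_{i-1}),\dots,u^{(j-1)}(t_{i-1}),0\big)u^{(0)}(t)$. The $p$-th approximation is $\overset{p}{u}=\sum_{i=0}^pu^{(i)}$. The FD-method converges (to the exact solution) on $[t_0,t_0+H)$ if there is $\bar h>0$ such that for every grid with $h\le\bar h$ the series $\sum_{i\ge0}u^{(i)}(t)$ converges absolutely and uniformly on $[t_0,t_0+H)$ (to the exact solution). *)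

(* Defs.v *)
From Stdlib Require Import Reals Lra Lia List Arith ClassicalEpsilon.
Import ListNotations.
Open Scope R_scope.

(* Vectors of R^m: functions nat -> R, only components c < m matter.
   Matrices of R^{m x m}: nat -> nat -> R, only entries a,b < m matter. *)
Definition vec := nat -> R.
Definition mat := nat -> nat -> R.

Fixpoint sumn (n : nat) (f : nat -> R) : R :=
  match n with O => 0 | S k => sumn k f + f k end.

Definition lsum {A : Type} (l : list A) (f : A -> R) : R :=
  fold_right (fun x acc => f x + acc) 0 l.

Definition zerov : vec := fun _ => 0.
Definition vsub (v w : vec) : vec := fun c => v c - w c.
Definition matvec (m : nat) (A : mat) (v : vec) : vec :=
  fun a => sumn m (fun b => A a b * v b).
Definition dot (m : nat) (v w : vec) : R := sumn m (fun c => v c * w c).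
Definition vnorm (m : nat) (v : vec) : R := sqrt (dot m v v).
Definition opnorm (m : nat) (A : mat) : R :=
  epsilon (inhabits 0) (fun l =>
    is_lub (fun x => exists v : vec, vnorm m v <= 1 /\ x = vnorm m (matvec m A v)) l).

Fixpoint multi_indices (m p : nat) : list (list nat) :=
  match m with
  | O => match p with O => [[]] | S _ => [] end
  | S m' => flat_map (fun k => map (cons k) (multi_indices m' (p - k))) (seq 0 (S p))
  end.

Fixpoint mono (i : list nat) (u : vec) : R :=
  match i with
  | [] => 1
  | a :: l => u 0%nat ^ a * mono l (fun j => u (S j))
  end.

(* The derivative (value) of a real function at a point (meaningful when
   the function is differentiable there, which is the case for all uses
   below, N being analytic in u). *)
Definition Rderiv (f : R -> R) (x : R) : R :=
  epsilon (inhabits 0) (fun l => derivable_pt_lim f x l).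
Fixpoint Rderivn (k : nat) (f : R -> R) : R -> R :=
  match k with O => f | S k' => Rderiv (Rderivn k' f) end.

Definition cont_on (D : R -> Prop) (f : R -> R) : Prop :=
  forall x, D x -> limit1_in f D (f x) x.
Definition deriv_within (D : R -> Prop) (f : R -> R) (x l : R) : Prop :=
  limit1_in (fun y => (f y - f x) / (y - x)) (fun y => D y /\ y <> x) l x.

Definition pderiv (N : R -> vec -> mat) (p : nat) (t : R) (u : vec) : mat :=
  fun a b => Rderiv (fun s => N t (fun c => if Nat.eqb c p then u c + s else u c) a b) 0.

(* J(t,u) = N(t,u) + [dN/du_1 u, ..., dN/du_m u] (column p is dN/du_p u) *)
Definition Jac (m : nat) (N : R -> vec -> mat) (t : R) (u : vec) : mat :=
  fun a b => N t u a b + matvec m (pderiv N b t u) u a.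

Definition adomian (M : vec -> mat) (k : nat) (v : nat -> vec) : mat :=
  fun a b => / INR (fact k) *
    Rderivn k (fun tau => M (fun c => sum_f_R0 (fun i => tau ^ i * v i c) k) a b) 0.

Definition is_solution (m : nat) (N : R -> vec -> mat) (phi : R -> vec)
  (t0 : R) (u0 : vec) (u : R -> vec) : Prop :=
  (forall c, (c < m)%nat -> u t0 c = u0 c) /\
  exists du : R -> vec,
    forall t, t0 <= t -> forall c, (c < m)%nat ->
      deriv_within (fun s => t0 <= s) (fun s => u s c) t (du t c) /\
      du t c - matvec m (N t (u t)) (u t) c = phi t c.

Definition is_grid (t0 : R) (g : nat -> R) : Prop :=
  g 0%nat = t0 /\ (forall n, g n < g (S n)) /\ (forall M, exists n, M < g n).
Definition grid_step (g : nat -> R) (h : R) : Prop :=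
  is_lub (fun x => exists i, x = g (S i) - g i) h.

Definition FD_rhs (m : nat) (N : R -> vec -> mat) (phi : R -> vec)
  (g : nat -> R) (U : nat -> R -> vec) (j i : nat) (t : R) : vec :=
  match j with
  | O => phi t
  | S _ =>
    let w := U 0%nat (g i) in
    let nodes := fun q => U q (g i) in
    let here := fun q => U q t in
    fun c =>
      matvec m (fun a b => sumn m (fun p => pderiv N p t w a b * U j (g i) p)) (U 0%nat t) c
      + sumn (j - 1) (fun q => let p := S q in
            matvec m (adomian (N t) (j - p) nodes) (U p t) c)
      + sumn j (fun p =>
            matvec m (fun a b => adomian (N t) (j - 1 - p) here a b
                               - adomian (N t) (j - 1 - p) nodes a b) (U p t) c)
      + matvec m (adomian (N t) j (fun q => if Nat.ltb q j then U q (g i) else zerov))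
               (U 0%nat t) c
  end.

Definition FD_seq (m : nat) (N : R -> vec -> mat) (phi : R -> vec)
  (t0 : R) (u0 : vec) (g : nat -> R) (U : nat -> R -> vec) : Prop :=
  (forall j c, (c < m)%nat -> cont_on (fun s => t0 <= s) (fun s => U j s c)) /\
  (forall c, (c < m)%nat -> U 0%nat t0 c = u0 c) /\
  (forall j c, (c < m)%nat -> U (S j) t0 c = 0) /\
  (forall j i, exists dU : R -> vec,
     (forall c, (c < m)%nat ->
        (forall t, g i <= t <= g (S i) ->
           deriv_within (fun s => g i <= s <= g (S i)) (fun s => U j s c) t (dU t c)) /\
        cont_on (fun s => g i <= s <= g (S i)) (fun s => dU s c)) /\
     (forall t, g i <= t < g (S i) -> forall c, (c < m)%nat ->
        dU t c - matvec m (N t (U 0%nat (g i))) (U j t) c = FD_rhs m N phi g U j i t c)).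

Definition FD_approx (U : nat -> R -> vec) (p : nat) (t : R) : vec :=
  fun c => sum_f_R0 (fun j => U j t c) p.

(* Main.v *)
Require Import Defs.
From Coquelicot Require Import Coquelicot.
From Stdlib Require Import Reals List Lra Lia Arith ClassicalEpsilon FunctionalExtensionality.
Open Scope R_scope.

(** Insert a parameter [tau] into the scheme: if
    [U(tau,t) = sum_j tau^j u^(j)(t)], the FD equations say exactly that
    [dU/dt = N(t,U(tau,t_i)) U + tau (N(t,U) - N(t,U(tau,t_i))) U + phi] order by
    order, so at [tau = 1] the sum of the series solves the Cauchy problem.

    Convergence is obtained with the weights [w_j = q^j / (j+1)^2], [q = h/r], whose
    convolution square is at most [8 w_j]; the estimates of the theorem then hold
    with exponent [1 + 1]. The ansatz is [|u^(0)| <= rho], [|u^(j)| <= delta w_j]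
    for [j >= 1], with increments over one step at most [h D w_j]. By
    hypothesis 3 the linear equation for [u^(j)] is dissipative up to [O(h)] terms,
    so [|u^(j)|] is controlled by [sup |F^(j)| / alpha]. In [F^(j)] every term either
    contains two factors of positive order, hence is [O(delta^2 w_j)], or is a
    difference between [t] and the node, hence is [O(h w_(j-1)) = O(r w_j)]. Thus
    the ansatz reproduces itself once [delta], and then [r], are small. *)

(** * Finite sums *)

(** Existence of the exact solution is not an input: the sum of the FD series on one fine grid is a
    solution, and strong monotonicity of [u -> N(t,u) u] identifies it with the sums on all other
    fine grids. The obstacle is that hypothesis 3 concerns the Jacobian, while the scheme freezes
    [N] at a node and multiplies its derivative by the node value of u^(j). Replacing node values by
    current ones restores [J], with errors that are increments over one step. These increments are
    estimated from the equation through the very bound being proved, so both come out of a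
    continuous induction inside each interval, under a provisional bound twice as large. The square
    in the weights makes them stable under convolution and still summable at [q = 1], as the case
    [h = R] requires. Products are controlled letter by letter in each monomial of [N]; the cost is
    exponential in the degree, which the entire majorant with coefficients [B p] absorbs. The
    constants are fixed in the order [rho], [K], [beta], [D], [delta], [r], each depending only on
    earlier ones. *)

Lemma sumn_ext n f g : (forall k, (k < n)%nat -> f k = g k) -> sumn n f = sumn n g.
Proof.
  induction n as [|n IH]; intros H; simpl; [reflexivity|].
  rewrite (H n) by lia; rewrite IH; [reflexivity|]; intros; apply H; lia.
Qed.

Lemma sumn_plus n f g : sumn n (fun k => f k + g k) = sumn n f + sumn n g.
Proof. induction n as [|n IH]; simpl; [ring|]; rewrite IH; ring. Qed.

Lemma sumn_scal n c f : sumn n (fun k => c * f k) = c * sumn n f.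
Proof. induction n as [|n IH]; simpl; [ring|]; rewrite IH; ring. Qed.

Lemma sumn_minus n f g : sumn n (fun k => f k - g k) = sumn n f - sumn n g.
Proof. induction n as [|n IH]; simpl; [ring|]; rewrite IH; ring. Qed.

Lemma sumn_le n f g : (forall k, (k < n)%nat -> f k <= g k) -> sumn n f <= sumn n g.
Proof.
  induction n as [|n IH]; intros H; simpl; [lra|].
  apply Rplus_le_compat; [apply IH; intros; apply H|apply H]; lia.
Qed.

Lemma sumn_0 n f : (forall k, (k < n)%nat -> f k = 0) -> sumn n f = 0.
Proof.
  induction n as [|n IH]; intros H; simpl; [lra|].
  rewrite IH, (H n) by (intros; try apply H; lia); ring.
Qed.

Lemma sumn_ge_0 n f : (forall k, (k < n)%nat -> 0 <= f k) -> 0 <= sumn n f.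
Proof.
  induction n as [|n IH]; intros H; simpl; [lra|].
  apply Rplus_le_le_0_compat; [apply IH; intros; apply H|apply H]; lia.
Qed.

Lemma sumn_const n c : sumn n (fun _ => c) = INR n * c.
Proof. induction n as [|n IH]; [simpl; ring|]; rewrite S_INR; simpl; rewrite IH; ring. Qed.

Lemma sumn_Rabs n f : Rabs (sumn n f) <= sumn n (fun k => Rabs (f k)).
Proof.
  induction n as [|n IH]; simpl; [rewrite Rabs_R0; lra|].
  eapply Rle_trans; [apply Rabs_triang|lra].
Qed.

Lemma sumn_bound n f M : (forall k, (k < n)%nat -> Rabs (f k) <= M) -> Rabs (sumn n f) <= INR n * M.
Proof.
  intros H; rewrite <- sumn_const.
  eapply Rle_trans; [apply sumn_Rabs|]; apply sumn_le, H.
Qed.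

Lemma sumn_exchange n p (f : nat -> nat -> R) :
  sumn n (fun i => sumn p (fun j => f i j)) = sumn p (fun j => sumn n (fun i => f i j)).
Proof.
  induction n as [|n IH]; simpl.
  - symmetry; apply sumn_0; reflexivity.
  - rewrite IH, <- sumn_plus; reflexivity.
Qed.

Lemma sumn_delta n p c : (p < n)%nat -> sumn n (fun k => if Nat.eqb k p then c k else 0) = c p.
Proof.
  induction n as [|n IH]; intros H; [lia|]; simpl.
  destruct (Nat.eqb_spec n p) as [->|Hn].
  - rewrite sumn_0; [ring|]; intros k Hk; destruct (Nat.eqb_spec k p); [lia|reflexivity].
  - rewrite IH by lia; ring.
Qed.

Lemma sumn_term_le n f k : (forall i, (i < n)%nat -> 0 <= f i) -> (k < n)%nat -> f k <= sumn n f.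
Proof.
  induction n as [|n IH]; intros H Hk; [lia|]; simpl.
  assert (0 <= sumn n f) by (apply sumn_ge_0; intros; apply H; lia).
  destruct (Nat.eq_dec k n) as [->|]; [lra|].
  specialize (IH ltac:(intros; apply H; lia) ltac:(lia)); specialize (H n ltac:(lia)); lra.
Qed.

Lemma sum_f_R0_sumn f n : sum_f_R0 f n = sumn (S n) f.
Proof. induction n as [|n IH]; simpl in *; [ring|]; rewrite IH; reflexivity. Qed.

Lemma sumn_Sr n f : sumn (S n) f = sumn n f + f n.
Proof. reflexivity. Qed.

Lemma sumn_Sl n f : sumn (S n) f = f 0%nat + sumn n (fun k => f (S k)).
Proof. induction n as [|n IH]; simpl in *; [ring|]; rewrite IH; ring. Qed.

(** The first sum in [F] runs over inner orders only; its nonnegative end terms are added back to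
    reach a full convolution. *)
Lemma sumn_inner_le f n : (forall k, 0 <= f k) -> sumn n (fun k => f (S k)) <= sum_f_R0 f (S n).
Proof.
  intros H; rewrite sum_f_R0_sumn, sumn_Sl; simpl.
  pose proof (H 0%nat); pose proof (H (S n)); lra.
Qed.

(** * One-variable calculus *)

Lemma continuity_pt_ext_all f g x : (forall y, f y = g y) -> continuity_pt f x -> continuity_pt g x.
Proof. intros H Hf; replace g with f; [exact Hf|]; apply functional_extensionality, H. Qed.

Lemma continuity_pt_sumn n (f : nat -> R -> R) x :
  (forall k, (k < n)%nat -> continuity_pt (f k) x) ->
  continuity_pt (fun t => sumn n (fun k => f k t)) x.
Proof.
  induction n as [|n IH]; intros H; simpl.
  - apply continuity_pt_const; intros ? ?; reflexivity.
  - apply (continuity_pt_plus (fun t => sumn n (fun k => f k t)) (f n)); [apply IH; intros; apply H|apply H]; lia.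
Qed.

Lemma derivable_pt_lim_sumn n (f : nat -> R -> R) d x :
  (forall k, (k < n)%nat -> derivable_pt_lim (f k) x (d k)) ->
  derivable_pt_lim (fun t => sumn n (fun k => f k t)) x (sumn n d).
Proof.
  induction n as [|n IH]; intros H; simpl.
  - apply derivable_pt_lim_const.
  - apply (derivable_pt_lim_plus (fun t => sumn n (fun k => f k t)) (f n)); [apply IH; intros; apply H|apply H]; lia.
Qed.

Lemma continuity_pt_near f x eps :
  continuity_pt f x -> 0 < eps ->
  exists d, 0 < d /\ forall y, Rabs (y - x) < d -> Rabs (f y - f x) < eps.
Proof.
  intros H Heps; destruct (H eps Heps) as [d [Hd0 Hd]].
  exists d; split; [exact Hd0|]; intros y Hy.
  destruct (Req_dec x y) as [->|Hne]; [rewrite Rminus_diag, Rabs_R0; exact Heps|].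
  apply Hd; split; [split; [exact I|exact Hne]|exact Hy].
Qed.

Lemma locally_bounded (f : nat -> R -> R) n x :
  (forall k, (k < n)%nat -> continuity_pt (f k) x) ->
  exists K eta, 0 < eta /\ 1 <= K /\ forall t, Rabs (t - x) < eta -> forall k, (k < n)%nat -> Rabs (f k t) <= K.
Proof.
  induction n as [|n IH]; intros H.
  - exists 1, 1; repeat split; try lra; intros; lia.
  - destruct IH as [K [eta [He [HK Hb]]]]; [intros; apply H; lia|].
    destruct (continuity_pt_near (f n) x 1 (H n ltac:(lia)) ltac:(lra)) as [d [Hd0 Hd]].
    pose proof (Rabs_pos (f n x)).
    exists (K + Rabs (f n x) + 1), (Rmin eta d); repeat split; [apply Rmin_pos; assumption|lra|].
    intros t Ht k Hk; destruct (Nat.eq_dec k n) as [->|Hne].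
    + specialize (Hd t (Rlt_le_trans _ _ _ Ht (Rmin_r _ _))).
      replace (f n t) with (f n t - f n x + f n x) by ring.
      eapply Rle_trans; [apply Rabs_triang|lra].
    + specialize (Hb t (Rlt_le_trans _ _ _ Ht (Rmin_l _ _)) k ltac:(lia)); lra.
Qed.

Lemma derivable_pt_lim_continuity_pt f x l : derivable_pt_lim f x l -> continuity_pt f x.
Proof. intros H; apply derivable_continuous_pt; exists l; exact H. Qed.

Lemma derivable_pt_lim_local f g x l eta :
  0 < eta -> (forall y, Rabs (y - x) < eta -> f y = g y) ->
  derivable_pt_lim f x l -> derivable_pt_lim g x l.
Proof.
  intros He Heq H eps Heps; destruct (H eps Heps) as [d Hd].
  assert (Hm : 0 < Rmin d eta) by (apply Rmin_pos; [apply cond_pos|exact He]).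
  exists (mkposreal _ Hm); intros h Hh0 Hh; simpl in Hh.
  rewrite <- !Heq.
  - apply Hd; [exact Hh0|]; eapply Rlt_le_trans; [exact Hh|apply Rmin_l].
  - rewrite Rminus_diag, Rabs_R0; exact He.
  - replace (x + h - x) with h by ring; eapply Rlt_le_trans; [exact Hh|apply Rmin_r].
Qed.

Lemma derivable_deriv_within D f x l : derivable_pt_lim f x l -> deriv_within D f x l.
Proof.
  intros H eps Heps; destruct (H eps Heps) as [d Hd].
  exists d; split; [apply cond_pos|]; intros y [[_ Hy] Hyd]; simpl in *; unfold Rdist in *.
  specialize (Hd (y - x) ltac:(lra) Hyd); replace (x + (y - x)) with y in Hd by ring; exact Hd.
Qed.

Lemma deriv_within_interior (D : R -> Prop) f x l eta :
  0 < eta -> (forall y, Rabs (y - x) < eta -> D y) ->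
  deriv_within D f x l -> derivable_pt_lim f x l.
Proof.
  intros He HD H eps Heps; destruct (H eps Heps) as [d [Hd0 Hd]].
  assert (Hm : 0 < Rmin d eta) by (apply Rmin_pos; lra).
  exists (mkposreal _ Hm); intros h Hh0 Hh; simpl in *; unfold Rdist in *.
  assert (Hxh : x + h - x = h) by ring.
  specialize (Hd (x + h)); rewrite Hxh in Hd; apply Hd; repeat split.
  - apply HD; rewrite Hxh; eapply Rlt_le_trans; [exact Hh|apply Rmin_r].
  - lra.
  - eapply Rlt_le_trans; [exact Hh|apply Rmin_l].
Qed.

Lemma deriv_within_ext (D : R -> Prop) f g x l :
  D x -> (forall y, D y -> f y = g y) -> deriv_within D f x l -> deriv_within D g x l.
Proof.
  intros Hx Heq H eps Heps; destruct (H eps Heps) as [d [Hd0 Hd]].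
  exists d; split; [exact Hd0|]; intros y [[Hy Hyx] Hyd]; rewrite <- !Heq by assumption.
  apply Hd; repeat split; assumption.
Qed.

Lemma deriv_within_cont_on (D : R -> Prop) f :
  (forall x, D x -> exists l, deriv_within D f x l) -> cont_on D f.
Proof.
  intros H x Hx eps Heps; destruct (H x Hx) as [l Hl].
  destruct (Hl 1 Rlt_0_1) as [d [Hd0 Hd]].
  set (L := Rabs l + 1).
  assert (HL : 0 < L) by (unfold L; pose proof (Rabs_pos l); lra).
  exists (Rmin d (eps / L)); split.
  { apply Rmin_pos; [exact Hd0|]; apply Rdiv_lt_0_compat; lra. }
  intros y [Hy Hyd]; simpl in *; unfold Rdist in *.
  destruct (Req_dec y x) as [->|Hyx]; [rewrite Rminus_diag, Rabs_R0; exact Heps|].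
  specialize (Hd y (conj (conj Hy Hyx) (Rlt_le_trans _ _ _ Hyd (Rmin_l _ _)))).
  assert (Hq : Rabs ((f y - f x) / (y - x)) < L).
  { unfold L; replace ((f y - f x) / (y - x)) with ((f y - f x) / (y - x) - l + l) by ring.
    eapply Rle_lt_trans; [apply Rabs_triang|]; lra. }
  replace (f y - f x) with ((f y - f x) / (y - x) * (y - x)) by (field; lra).
  rewrite Rabs_mult; pose proof (Rlt_le_trans _ _ _ Hyd (Rmin_r _ _)) as Hy2.
  assert (0 < Rabs (y - x)) by (apply Rabs_pos_lt; lra).
  apply Rlt_trans with (L * Rabs (y - x)); [apply Rmult_lt_compat_r; assumption|].
  replace eps with (L * (eps / L)) by (field; lra); apply Rmult_lt_compat_l; assumption.
Qed.

Lemma continuity_cont_on D f : continuity f -> cont_on D f.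
Proof.
  intros H x _ eps Heps; destruct (H x eps Heps) as [d [Hd0 Hd]].
  exists d; split; [exact Hd0|]; intros y [_ Hyd].
  destruct (Req_dec x y) as [->|Hyx].
  - simpl; unfold Rdist; rewrite Rminus_diag, Rabs_R0; exact Heps.
  - apply Hd; split; [split; [exact I|exact Hyx]|exact Hyd].
Qed.

Lemma cont_on_ext (D : R -> Prop) f g : (forall y, D y -> f y = g y) -> cont_on D f -> cont_on D g.
Proof.
  intros Heq H x Hx eps Heps; destruct (H x Hx eps Heps) as [d [Hd0 Hd]].
  exists d; split; [exact Hd0|]; intros y [Hy Hyd]; rewrite <- !Heq by assumption.
  apply Hd; split; assumption.
Qed.

(** Reading a function of time at [Rmax t0 t] extends it to the left of [t0] by a constant, so that
    two-sided continuity and derivatives can be used throughout. It works because [Rmax t0] does not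
    increase distances. *)
Lemma cont_on_clamp t0 f : cont_on (fun s => t0 <= s) f -> continuity (fun t => f (Rmax t0 t)).
Proof.
  intros H x eps Heps; destruct (H (Rmax t0 x) (Rmax_l _ _) eps Heps) as [d [Hd0 Hd]].
  exists d; split; [exact Hd0|]; intros y [_ Hyd]; apply Hd; split; [apply Rmax_l|].
  simpl in *; unfold Rdist in *; eapply Rle_lt_trans; [|exact Hyd].
  unfold Rmax; destruct (Rle_dec t0 x), (Rle_dec t0 y); unfold Rabs;
    repeat destruct Rcase_abs; lra.
Qed.

Lemma continuity_pt_clamp t0 x : continuity_pt (Rmax t0) x.
Proof.
  apply (cont_on_clamp t0 (fun t => t)), continuity_cont_on, derivable_continuous, derivable_id.
Qed.

(** Derivatives are required on the open interval only: at grid nodes the FD functions may have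
    different one-sided derivatives. *)
Lemma MVT_open f df a b :
  a < b -> (forall x, a < x < b -> derivable_pt_lim f x (df x)) ->
  (forall x, a <= x <= b -> continuity_pt f x) ->
  exists c, a < c < b /\ f b - f a = df c * (b - a).
Proof.
  intros Hab Hd Hc.
  assert (pr1 : forall c, a < c < b -> derivable_pt f c) by (intros c Hx; exists (df c); apply Hd, Hx).
  assert (pr2 : forall c, a < c < b -> derivable_pt id c) by (intros c _; apply derivable_pt_id).
  destruct (MVT f id a b pr1 pr2 Hab Hc) as [c [P Hcc]].
  { intros c _; apply derivable_continuous_pt, derivable_pt_id. }
  exists c; split; [exact P|].
  rewrite (derive_pt_eq_0 f c (df c) (pr1 c P) (Hd c P)) in Hcc.
  rewrite (derive_pt_eq_0 id c 1 (pr2 c P) (derivable_pt_lim_id c)) in Hcc.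
  unfold id in Hcc; lra.
Qed.

Lemma increment_bound f df a b L :
  a <= b -> (forall x, a < x < b -> derivable_pt_lim f x (df x)) ->
  (forall x, a <= x <= b -> continuity_pt f x) ->
  (forall x, a < x < b -> Rabs (df x) <= L) ->
  Rabs (f b - f a) <= L * (b - a).
Proof.
  intros Hab Hd Hc HL; destruct Hab as [Hab| ->]; [|rewrite !Rminus_diag, Rabs_R0; lra].
  destruct (MVT_open f df a b Hab Hd Hc) as [c [Hcc ->]].
  rewrite Rabs_mult, (Rabs_right (b - a)) by lra.
  apply Rmult_le_compat_r; [lra|apply HL, Hcc].
Qed.

(** After the last time [s] before [t1] with [y s <= Y] the function stays above [Y], hence does not
    increase, and the mean value theorem gives [y t1 <= y s]. *)
Lemma barrier_local y dy a b Y :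
  (forall t, a <= t <= b -> continuity_pt y t) ->
  (forall t, a < t < b -> derivable_pt_lim y t (dy t)) ->
  (forall t, a < t < b -> Y < y t -> dy t <= 0) ->
  y a <= Y -> forall t, a <= t <= b -> y t <= Y.
Proof.
  intros Hc Hd Hs Ha t1 Ht1; apply Rnot_lt_le; intros Hgt.
  set (E := fun s => a <= s <= t1 /\ y s <= Y).
  destruct (completeness E) as [s [Hub Hlub]].
  { exists t1; intros s [Hs' _]; lra. }
  { exists a; split; [lra|exact Ha]. }
  assert (Has : a <= s) by (apply Hub; split; [lra|exact Ha]).
  assert (Hst : s <= t1) by (apply Hlub; intros s' [Hs' _]; lra).
  assert (Hys : y s <= Y).
  { apply Rnot_lt_le; intros Hlt.
    destruct (continuity_pt_near y s (y s - Y) ltac:(apply Hc; lra) ltac:(lra)) as [d [Hd0 Hdd]].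
    assert (s <= s - d); [|lra].
    apply Hlub; intros s' [Hs' Hys']; apply Rnot_lt_le; intros Hlt'.
    assert (Hle : s' <= s) by (apply Hub; split; assumption).
    assert (Hk := Hdd s' ltac:(apply Rabs_def1; lra)); apply Rabs_def2 in Hk; lra. }
  assert (Hlt : s < t1) by (destruct Hst as [|E0]; [assumption|rewrite E0 in Hys; lra]).
  destruct (MVT_open y dy s t1 Hlt) as [c [Hcc Heq]].
  { intros; apply Hd; lra. }
  { intros; apply Hc; lra. }
  assert (Hyc : Y < y c).
  { apply Rnot_le_lt; intros Hle; assert (c <= s); [|lra]; apply Hub; split; [lra|exact Hle]. }
  specialize (Hs c ltac:(lra) Hyc); nra.
Qed.

(* The sign condition on the derivative is only required under the a priori
   bound [Y2]; continuous induction removes it. *)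
Lemma barrier y dy a b Y Y2 :
  Y < Y2 ->
  (forall t, a <= t <= b -> continuity_pt y t) ->
  (forall t, a < t < b -> derivable_pt_lim y t (dy t)) ->
  (forall t, a < t < b -> (forall s, a <= s <= t -> y s <= Y2) -> Y < y t -> dy t <= 0) ->
  y a <= Y -> forall t, a <= t <= b -> y t <= Y.
Proof.
  intros HY Hc Hd Hs Ha t1 Ht1.
  set (E := fun s => a <= s <= t1 /\ forall r, a <= r <= s -> y r <= Y).
  destruct (completeness E) as [s [Hub Hlub]].
  { exists t1; intros s [Hs' _]; lra. }
  { exists a; split; [lra|]; intros r Hr; replace r with a by lra; exact Ha. }
  assert (Has : a <= s).
  { apply Hub; split; [lra|]; intros r Hr; replace r with a by lra; exact Ha. }
  assert (Hst : s <= t1) by (apply Hlub; intros s' [Hs' _]; lra).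
  assert (Hbelow : forall r, a <= r < s -> y r <= Y).
  { intros r Hr; apply Rnot_lt_le; intros Hlt; assert (s <= r); [|lra].
    apply Hlub; intros s' [Hs' Hy']; apply Rnot_lt_le; intros Hrs; specialize (Hy' r ltac:(lra)); lra. }
  assert (Hys : y s <= Y).
  { destruct (Req_dec a s) as [<-|Hne]; [exact Ha|].
    apply Rnot_lt_le; intros Hlt.
    destruct (continuity_pt_near y s (y s - Y) ltac:(apply Hc; lra) ltac:(lra)) as [d [Hd0 Hdd]].
    set (r := Rmax a (s - d / 2)).
    assert (Hr : a <= r < s /\ s - r < d).
    { unfold r; repeat split; [apply Rmax_l|apply Rmax_lub_lt; lra|pose proof (Rmax_r a (s - d/2)); lra]. }
    assert (Hk := Hdd r ltac:(apply Rabs_def1; lra)); apply Rabs_def2 in Hk.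
    specialize (Hbelow r ltac:(lra)); lra. }
  assert (Hall : forall r, a <= r <= s -> y r <= Y).
  { intros r Hr; destruct (Req_dec r s) as [->|]; [exact Hys|apply Hbelow; lra]. }
  destruct (Req_dec s t1) as [->|Hne]; [apply Hall; lra|exfalso].
  (* The gap between [Y] and [Y2] pays for the continuation: just after [s] the bound [Y2] still
     holds by continuity, so the sign condition becomes available there and [barrier_local] carries
     [Y] beyond [s]. *)
  destruct (continuity_pt_near y s (Y2 - Y) ltac:(apply Hc; lra) ltac:(lra)) as [d [Hd0 Hdd]].
  set (e := Rmin t1 (s + d / 2)).
  assert (He : s < e /\ e <= t1 /\ e < s + d).
  { unfold e; repeat split; [apply Rmin_glb_lt; lra|apply Rmin_l|pose proof (Rmin_r t1 (s + d/2)); lra]. }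
  assert (Hsm : forall r, s <= r <= e -> y r <= Y2).
  { intros r Hr; assert (Hk := Hdd r ltac:(apply Rabs_def1; lra)); apply Rabs_def2 in Hk; lra. }
  assert (e <= s); [|lra].
  apply Hub; split; [lra|]; intros r Hr.
  destruct (Rle_dec r s) as [Hrs|Hrs]; [apply Hall; lra|].
  apply (barrier_local y dy s e Y); try lra.
  - intros; apply Hc; lra.
  - intros; apply Hd; lra.
  - intros t Ht Hgt; apply Hs; [lra| |exact Hgt].
    intros r' Hr'; destruct (Rle_dec r' s) as [Hrs'|Hrs'].
    + specialize (Hall r' ltac:(lra)); lra.
    + apply Hsm; lra.
Qed.

(** * Vectors and matrices *)

Lemma dot_ge_0 m v : 0 <= dot m v v.
Proof. apply sumn_ge_0; intros; nra. Qed.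

Lemma vnorm_ge_0 m v : 0 <= vnorm m v.
Proof. apply sqrt_pos. Qed.

Lemma vnorm_sqr m v : vnorm m v * vnorm m v = dot m v v.
Proof. apply sqrt_sqrt, dot_ge_0. Qed.

Lemma vnorm_le_iff m v M : 0 <= M -> (vnorm m v <= M <-> dot m v v <= M * M).
Proof.
  intros HM; rewrite <- vnorm_sqr; pose proof (vnorm_ge_0 m v); split; intros H0.
  - apply Rmult_le_compat; assumption.
  - apply Rnot_lt_le; intros Hlt; nra.
Qed.

Lemma Rabs_le_vnorm m v c : (c < m)%nat -> Rabs (v c) <= vnorm m v.
Proof.
  intros Hc; rewrite <- sqrt_Rsqr_abs; apply sqrt_le_1_alt.
  apply (sumn_term_le m (fun c => v c * v c)); [intros; nra|exact Hc].
Qed.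

(** The crude factor [INR m], in place of its square root, is absorbed by the constants; all
    estimates below are componentwise. *)
Lemma vnorm_le_INR m v M : 0 <= M -> (forall c, (c < m)%nat -> Rabs (v c) <= M) -> vnorm m v <= INR m * M.
Proof.
  intros HM H; pose proof (pos_INR m); apply vnorm_le_iff; [nra|].
  apply Rle_trans with (INR m * (M * M)).
  - rewrite <- sumn_const; apply sumn_le; intros k Hk; specialize (H k Hk).
    pose proof (Rabs_pos (v k)); replace (v k * v k) with (Rabs (v k) * Rabs (v k)); [nra|].
    rewrite <- Rabs_mult; apply Rabs_right; nra.
  - destruct m as [|m]; [simpl; lra|].
    assert (1 <= INR (S m)) by (rewrite S_INR; pose proof (pos_INR m); lra).
    assert (0 <= M * M) by nra; nra.
Qed.

Lemma dot_bound m v e M :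
  (forall c, (c < m)%nat -> Rabs (e c) <= M) -> Rabs (dot m v e) <= vnorm m v * (INR m * M).
Proof.
  intros H; replace (vnorm m v * (INR m * M)) with (INR m * (vnorm m v * M)) by ring.
  apply sumn_bound; intros c Hc; rewrite Rabs_mult.
  apply Rmult_le_compat; try apply Rabs_pos; [apply Rabs_le_vnorm, Hc|apply H, Hc].
Qed.

Lemma dot_plus_r m v x y : dot m v (fun c => x c + y c) = dot m v x + dot m v y.
Proof. unfold dot; rewrite <- sumn_plus; apply sumn_ext; intros; ring. Qed.

Lemma dot_ext m v v' x y :
  (forall c, (c < m)%nat -> v c = v' c) -> (forall c, (c < m)%nat -> x c = y c) -> dot m v x = dot m v' y.
Proof. intros H H'; apply sumn_ext; intros; rewrite H, H' by assumption; reflexivity. Qed.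

Lemma matvec_ext m A A' v v' a :
  (forall b, (b < m)%nat -> A a b = A' a b) -> (forall b, (b < m)%nat -> v b = v' b) ->
  matvec m A v a = matvec m A' v' a.
Proof. intros H H'; apply sumn_ext; intros; rewrite H, H' by assumption; reflexivity. Qed.

Lemma matvec_bound m (A : mat) v a E M :
  (forall b, (b < m)%nat -> Rabs (A a b) <= E) -> (forall b, (b < m)%nat -> Rabs (v b) <= M) ->
  Rabs (matvec m A v a) <= INR m * (E * M).
Proof.
  intros HA Hv; apply sumn_bound; intros b Hb; rewrite Rabs_mult.
  apply Rmult_le_compat; try apply Rabs_pos; [apply HA, Hb|apply Hv, Hb].
Qed.

(** The [epsilon] in [opnorm] has a meaning only once a least upper bound exists: the sum of the
    absolute values of the entries gives boundedness, and the zero vector shows that the set is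
    inhabited. *)
Lemma opnorm_is_lub m (A : mat) :
  is_lub (fun x => exists v : vec, vnorm m v <= 1 /\ x = vnorm m (matvec m A v)) (opnorm m A).
Proof.
  unfold opnorm; apply epsilon_spec.
  set (T := sumn m (fun a => sumn m (fun b => Rabs (A a b)))).
  assert (HT : forall a, 0 <= sumn m (fun b => Rabs (A a b))) by (intros; apply sumn_ge_0; intros; apply Rabs_pos).
  destruct (completeness (fun x => exists v : vec, vnorm m v <= 1 /\ x = vnorm m (matvec m A v))) as [l Hl].
  - exists (INR m * T); intros x [v [Hv ->]]; apply vnorm_le_INR.
    + apply sumn_ge_0; intros; apply HT.
    + intros a Ha; eapply Rle_trans; [apply sumn_Rabs|].
      apply Rle_trans with (sumn m (fun b => Rabs (A a b))).
      * apply sumn_le; intros b Hb; rewrite Rabs_mult.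
        pose proof (Rabs_le_vnorm m v b Hb); pose proof (Rabs_pos (A a b)); nra.
      * apply (sumn_term_le m (fun a => sumn m (fun b => Rabs (A a b)))); [intros; apply HT|exact Ha].
  - exists (vnorm m (matvec m A zerov)), zerov; split; [|reflexivity].
    apply vnorm_le_iff; [lra|]; unfold dot; rewrite sumn_0; [lra|]; intros; unfold zerov; ring.
  - exists l; exact Hl.
Qed.

Lemma entry_le_opnorm m (A : mat) a b : (a < m)%nat -> (b < m)%nat -> Rabs (A a b) <= opnorm m A.
Proof.
  intros Ha Hb; set (e := fun c => if Nat.eqb c b then 1 else 0 : R).
  apply Rle_trans with (vnorm m (matvec m A e)).
  - replace (A a b) with (matvec m A e a); [apply Rabs_le_vnorm, Ha|].
    unfold matvec; rewrite <- (sumn_delta m b (fun c => A a c) Hb).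
    apply sumn_ext; intros k _; unfold e; destruct (Nat.eqb k b); ring.
  - apply (opnorm_is_lub m A); exists e; split; [|reflexivity].
    apply vnorm_le_iff; [lra|]; unfold dot.
    rewrite (sumn_ext m _ (fun k => if Nat.eqb k b then (fun _ => 1) k else 0)).
    + rewrite sumn_delta by exact Hb; lra.
    + intros k _; unfold e; destruct (Nat.eqb k b); ring.
Qed.

(** * Series *)

Lemma ex_series_abs_dominated (a b : nat -> R) :
  (forall n, Rabs (a n) <= b n) -> ex_series b -> ex_series (fun n => Rabs (a n)).
Proof.
  intros H Hb; apply (@ex_series_le R_AbsRing R_CompleteNormedModule _ b); [|exact Hb].
  intros n; change (Rabs (Rabs (a n)) <= b n); rewrite Rabs_Rabsolu; apply H.
Qed.

Lemma series_dominated (a b : nat -> R) :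
  (forall n, Rabs (a n) <= b n) -> ex_series b -> ex_series a /\ Rabs (Series a) <= Series b.
Proof.
  intros H Hb.
  pose proof (ex_series_abs_dominated a b H Hb) as Habs.
  split; [apply ex_series_Rabs, Habs|].
  eapply Rle_trans; [apply Series_Rabs, Habs|].
  apply Series_le; [intros n; split; [apply Rabs_pos|apply H]|exact Hb].
Qed.

Lemma ex_series_scal_R (c : R) (a : nat -> R) : ex_series a -> ex_series (fun n => c * a n).
Proof. intros [l H]; exists (c * l); exact (is_series_scal c a l H). Qed.

Lemma ex_series_plus_R (a b : nat -> R) : ex_series a -> ex_series b -> ex_series (fun n => a n + b n).
Proof. intros [l H] [l' H']; exists (l + l'); exact (is_series_plus a b l l' H H'). Qed.

Lemma series_tail_small (b : nat -> R) eps :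
  ex_series b -> 0 < eps -> exists n0, forall n, (n0 <= n)%nat -> Rabs (Series b - sum_f_R0 b n) < eps.
Proof.
  intros Hb Heps; apply Series_correct, is_series_Reals in Hb.
  destruct (Hb eps Heps) as [n0 H]; exists n0; intros n Hn.
  rewrite Rabs_minus_sym; apply H; exact Hn.
Qed.

Lemma series_tail_dominated (a b : nat -> R) n :
  (forall k, Rabs (a k) <= b k) -> ex_series b ->
  Rabs (Series a - sum_f_R0 a n) <= Series b - sum_f_R0 b n.
Proof.
  intros H Hb; destruct (series_dominated a b H Hb) as [Ha _].
  rewrite (Series_incr_n a (S n)), (Series_incr_n b (S n)) by (lia || assumption); simpl pred.
  replace (sum_f_R0 a n + _ - sum_f_R0 a n) with (Series (fun k => a (S n + k)%nat)) by ring.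
  replace (sum_f_R0 b n + _ - sum_f_R0 b n) with (Series (fun k => b (S n + k)%nat)) by ring.
  apply series_dominated; [intros; apply H|].
  apply (ex_series_incr_n b (S n)), Hb.
Qed.

Lemma series_sum_finite (a : nat -> nat -> R) n :
  (forall k, (k <= n)%nat -> ex_series (fun p => a p k)) ->
  ex_series (fun p => sum_f_R0 (a p) n) /\
  sum_f_R0 (fun k => Series (fun p => a p k)) n = Series (fun p => sum_f_R0 (a p) n).
Proof.
  induction n as [|n IH]; intros H; simpl; [split; [apply H; lia|reflexivity]|].
  destruct IH as [He Heq]; [intros; apply H; lia|]; split.
  - apply ex_series_plus_R; [exact He|apply H; lia].
  - rewrite Heq, Series_plus; [reflexivity|exact He|apply H; lia].
Qed.

(** A product majorant bounds the remainder after [n] columns by [Series X] times the tail of [w].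
    Later [p] is the degree in [u] and [n] the order in the parameter. *)
Lemma double_series_exchange (a : nat -> nat -> R) (X w : nat -> R) :
  (forall p n, Rabs (a p n) <= X p * w n) -> (forall p, 0 <= X p) -> (forall n, 0 <= w n) ->
  ex_series X -> ex_series w ->
  is_series (fun n => Series (fun p => a p n)) (Series (fun p => Series (a p))).
Proof.
  intros H HX Hw HeX Hew.
  assert (Hrow : forall p, ex_series (a p) /\ Rabs (Series (a p)) <= Series (fun n => X p * w n)).
  { intros p; apply series_dominated; [apply H|apply ex_series_scal_R, Hew]. }
  assert (Hcol : forall n, ex_series (fun p => a p n)).
  { intros n; apply (series_dominated _ (fun p => w n * X p)); [|apply ex_series_scal_R, HeX].
    intros p; rewrite Rmult_comm; apply H. }
  assert (Htot : ex_series (fun p => Series (a p))).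
  { apply (series_dominated _ (fun p => Series w * X p)); [|apply ex_series_scal_R, HeX].
    intros p; rewrite Rmult_comm, <- Series_scal_l; apply Hrow. }
  apply is_series_Reals; intros eps Heps.
  assert (HSX : 0 <= Series X).
  { rewrite <- (Rmult_0_l (Series (fun _ => 0))), <- Series_scal_l.
    apply Series_le; [|exact HeX]; intros n; specialize (HX n); lra. }
  destruct (series_tail_small w (eps / (Series X + 1)) Hew) as [n0 Hn0].
  { apply Rdiv_lt_0_compat; lra. }
  exists n0; intros n Hn; specialize (Hn0 n Hn); unfold Rdist.
  destruct (series_sum_finite a n) as [Hfin ->]; [intros; apply Hcol|].
  rewrite <- Series_minus by assumption.
  set (T := Rabs (Series w - sum_f_R0 w n)) in *.
  assert (Hb : Rabs (Series (fun p => sum_f_R0 (a p) n - Series (a p))) <= T * Series X).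
  { rewrite <- Series_scal_l.
    apply series_dominated; [|apply ex_series_scal_R, HeX].
    intros p; rewrite Rabs_minus_sym.
    eapply Rle_trans; [apply (series_tail_dominated _ (fun n => X p * w n)); [apply H|apply ex_series_scal_R, Hew]|].
    rewrite Series_scal_l, (sum_eq (fun n => X p * w n) (fun n => w n * X p) n) by (intros; ring).
    rewrite <- scal_sum, (Rmult_comm T), <- Rmult_minus_distr_l.
    apply Rmult_le_compat_l; [apply HX|apply Rle_abs]. }
  eapply Rle_lt_trans; [exact Hb|].
  assert (0 <= T) by apply Rabs_pos.
  apply Rle_lt_trans with (T * (Series X + 1)); [nra|].
  replace eps with (eps / (Series X + 1) * (Series X + 1)) by (field; lra).
  apply Rmult_lt_compat_r; lra.
Qed.

Lemma continuity_pt_Series (f : nat -> R -> R) (b : nat -> R) x eta :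
  0 < eta -> (forall n, continuity_pt (f n) x) ->
  (forall n t, Rabs (t - x) < eta -> Rabs (f n t) <= b n) -> ex_series b ->
  continuity_pt (fun t => Series (fun n => f n t)) x.
Proof.
  intros Heta Hc Hb Heb eps Heps.
  destruct (series_tail_small b (eps / 3) Heb ltac:(lra)) as [n Hn].
  specialize (Hn n ltac:(lia)).
  assert (Hcs : continuity_pt (fun t => sumn (S n) (fun k => f k t)) x) by (apply continuity_pt_sumn; intros; apply Hc).
  destruct (continuity_pt_near _ _ (eps / 3) Hcs ltac:(lra)) as [d [Hd0 Hd]].
  exists (Rmin d eta); split; [apply Rmin_pos; lra|]; intros y [_ Hy]; simpl in *; unfold Rdist in *.
  assert (Ht : forall t, Rabs (t - x) < eta ->
            Rabs (Series (fun k => f k t) - sumn (S n) (fun k => f k t)) < eps / 3).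
  { intros t Ht; rewrite <- sum_f_R0_sumn.
    eapply Rle_lt_trans; [apply (series_tail_dominated _ b); [intros; apply Hb, Ht|exact Heb]|].
    eapply Rle_lt_trans; [apply Rle_abs|exact Hn]. }
  pose proof (Ht y (Rlt_le_trans _ _ _ Hy (Rmin_r _ _))) as H1.
  pose proof (Ht x ltac:(rewrite Rminus_diag, Rabs_R0; exact Heta)) as H2.
  pose proof (Hd y (Rlt_le_trans _ _ _ Hy (Rmin_l _ _))) as H3.
  simpl in H1, H2, H3.
  apply Rabs_def2 in H1; apply Rabs_def2 in H2; apply Rabs_def2 in H3; apply Rabs_def1; lra.
Qed.

(** * The weights [q ^ n / (n + 1) ^ 2] *)

Definition wt (q : R) (n : nat) : R := q ^ n * / (INR n + 1) ^ 2.

Lemma inv_sqr_pos n : 0 < / (INR n + 1) ^ 2.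
Proof. pose proof (pos_INR n); apply Rinv_0_lt_compat, pow_lt; lra. Qed.

Lemma wt_0 q : wt q 0 = 1.
Proof. unfold wt; simpl; field. Qed.

Lemma wt_ge_0 q n : 0 <= q -> 0 <= wt q n.
Proof. intros; apply Rmult_le_pos; [apply pow_le; assumption|apply Rlt_le, inv_sqr_pos]. Qed.

Lemma wt_gt_0 q n : 0 < q -> 0 < wt q n.
Proof. intros; apply Rmult_lt_0_compat; [apply pow_lt; assumption|apply inv_sqr_pos]. Qed.

(** The factor 4 bounds ((n+2)/(n+1))^2, with equality at [n = 0]. This shift turns [h * wt q n],
    that is [r * q * wt q n], into a multiple of [r] at the next order. *)
Lemma wt_S q n : 0 <= q -> q * wt q n <= 4 * wt q (S n).
Proof.
  intros Hq; unfold wt; rewrite S_INR; pose proof (pos_INR n); pose proof (pow_le q n Hq).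
  replace (q * (q ^ n * / (INR n + 1) ^ 2)) with (q ^ S n * / (INR n + 1) ^ 2) by (simpl; ring).
  replace (4 * (q ^ S n * / (INR n + 1 + 1) ^ 2)) with (q ^ S n * (4 * / (INR n + 1 + 1) ^ 2)) by ring.
  apply Rmult_le_compat_l; [apply pow_le, Hq|].
  replace (4 * / (INR n + 1 + 1) ^ 2) with (/ ((INR n + 2) / 2) ^ 2) by (field; lra).
  apply Rinv_le_contravar; [apply pow_lt; lra|]; apply pow_incr; lra.
Qed.

Lemma sum_inv_sqr_le n : sum_f_R0 (fun k => / (INR k + 1) ^ 2) n <= 2 - / (INR n + 1).
Proof.
  induction n as [|n IH]; [simpl; lra|].
  rewrite tech5, S_INR; pose proof (pos_INR n).
  assert (/ (INR n + 1 + 1) ^ 2 <= / (INR n + 1) - / (INR n + 1 + 1)).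
  { replace (/ (INR n + 1) - / (INR n + 1 + 1)) with (/ ((INR n + 1) * (INR n + 1 + 1))) by (field; lra).
    apply Rinv_le_contravar; nra. }
  lra.
Qed.

Lemma sum_inv_sqr_le_2 n : sum_f_R0 (fun k => / (INR k + 1) ^ 2) n <= 2.
Proof.
  pose proof (sum_inv_sqr_le n); pose proof (pos_INR n).
  assert (0 < / (INR n + 1)) by (apply Rinv_0_lt_compat; lra); lra.
Qed.

Lemma ex_series_wt q : 0 <= q <= 1 -> ex_series (wt q).
Proof.
  intros Hq.
  assert (H1 : ex_series (fun k => / (INR k + 1) ^ 2)).
  { destruct (growing_cv (sum_f_R0 (fun k => / (INR k + 1) ^ 2))) as [l Hl].
    - intros n; rewrite tech5; pose proof (inv_sqr_pos (S n)); lra.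
    - exists 2; intros x [n ->]; apply sum_inv_sqr_le_2.
    - exists l; apply is_series_Reals; exact Hl. }
  apply (series_dominated _ (fun k => / (INR k + 1) ^ 2)); [|exact H1].
  intros n; rewrite Rabs_right by (apply Rle_ge, wt_ge_0; lra); unfold wt.
  pose proof (inv_sqr_pos n); pose proof (pow_le q n ltac:(lra)).
  assert (q ^ n <= 1) by (rewrite <- (pow1 n); apply pow_incr; lra); nra.
Qed.

Lemma sum_f_R0_rev f n : sum_f_R0 (fun k => f (n - k)%nat) n = sum_f_R0 f n.
Proof.
  revert f; induction n as [|n IH]; intros f; [reflexivity|].
  rewrite (sum_f_R0_sumn _ (S n)), sumn_Sl, <- sum_f_R0_sumn, tech5; simpl.
  rewrite IH; simpl; ring.
Qed.

(** With [a = k + 1] and [b = n - k + 1], the inequality (a+b)^2 <= 2 (a^2 + b^2) gives 1/(a^2 b^2)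
    <= 2/(n+2)^2 (1/a^2 + 1/b^2). Each of the two sums of inverse squares is at most 2, whence 2 *
    (2 + 2) = 8. *)
Lemma conv_wt_le q n : 0 <= q -> sum_f_R0 (fun k => wt q k * wt q (n - k)) n <= 8 * wt q n.
Proof.
  intros Hq.
  set (s := fun k : nat => / (INR k + 1) ^ 2).
  set (c := q ^ n * (2 * s (S n))).
  apply Rle_trans with (sum_f_R0 (fun k => c * (s k + s (n - k)%nat)) n).
  - apply sum_Rle; intros k Hk; unfold wt; fold (s k) (s (n - k)%nat).
    replace (q ^ k * s k * (q ^ (n - k) * s (n - k)%nat)) with (q ^ n * (s k * s (n - k)%nat)).
    2: { replace (q ^ n) with (q ^ k * q ^ (n - k)); [ring|]; rewrite <- pow_add; f_equal; lia. }
    unfold c; rewrite Rmult_assoc; apply Rmult_le_compat_l; [apply pow_le, Hq|].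
    unfold s; rewrite S_INR, minus_INR by lia.
    assert (Hk' : INR k <= INR n) by (apply le_INR; lia); pose proof (pos_INR k).
    set (a := INR k + 1); set (b := INR n - INR k + 1).
    assert (Ha : 0 < a) by (unfold a; lra); assert (Hb : 0 < b) by (unfold b; lra).
    replace (INR n + 1 + 1) with (a + b) by (unfold a, b; ring).
    apply Rmult_le_reg_r with (a ^ 2 * b ^ 2 * (a + b) ^ 2).
    { apply Rmult_lt_0_compat; [apply Rmult_lt_0_compat|]; apply pow_lt; lra. }
    replace (/ a ^ 2 * / b ^ 2 * (a ^ 2 * b ^ 2 * (a + b) ^ 2)) with ((a + b) ^ 2) by (field; lra).
    replace (2 * / (a + b) ^ 2 * (/ a ^ 2 + / b ^ 2) * (a ^ 2 * b ^ 2 * (a + b) ^ 2))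
      with (2 * (a ^ 2 + b ^ 2)) by (field; lra).
    pose proof (pow2_ge_0 (a - b)); nra.
  - rewrite (sum_eq _ (fun k => (s k + s (n - k)%nat) * c) n) by (intros; ring).
    rewrite <- scal_sum, sum_plus, sum_f_R0_rev.
    assert (sum_f_R0 s n <= 2) by apply sum_inv_sqr_le_2.
    assert (Hs : s (S n) <= s n).
    { unfold s; rewrite S_INR; pose proof (pos_INR n).
      apply Rinv_le_contravar; [apply pow_lt; lra|apply pow_incr; lra]. }
    assert (0 <= c).
    { unfold c; apply Rmult_le_pos; [apply pow_le, Hq|]; pose proof (inv_sqr_pos (S n)); unfold s; lra. }
    assert (c <= 2 * wt q n).
    { unfold c, wt; fold (s n); pose proof (pow_le q n Hq); nra. }
    nra.
Qed.

Lemma conv_bound q (a b : nat -> R) n Ca Cb :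
  0 <= q -> 0 <= Ca -> 0 <= Cb ->
  (forall k, (k <= n)%nat -> Rabs (a k) <= Ca * wt q k) ->
  (forall k, (k <= n)%nat -> Rabs (b k) <= Cb * wt q k) ->
  Rabs (sum_f_R0 (fun k => a k * b (n - k)%nat) n) <= 8 * (Ca * Cb) * wt q n.
Proof.
  intros Hq HCa HCb Ha Hb.
  eapply Rle_trans; [apply Rabs_triang_gen|].
  apply Rle_trans with (sum_f_R0 (fun k => wt q k * wt q (n - k)%nat * (Ca * Cb)) n).
  - apply sum_Rle; intros k Hk; rewrite Rabs_mult.
    replace (wt q k * wt q (n - k) * (Ca * Cb)) with (Ca * wt q k * (Cb * wt q (n - k))) by ring.
    apply Rmult_le_compat; try apply Rabs_pos; [apply Ha|apply Hb]; lia.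
  - rewrite <- scal_sum; pose proof (conv_wt_le q n Hq).
    assert (0 <= Ca * Cb) by (apply Rmult_le_pos; assumption); nra.
Qed.

(** * Primitives and linear differential equations *)

Definition prim (a : R) (G : R -> R) (t : R) : R := RInt G a t.

Lemma prim_start a G : prim a G a = 0.
Proof. unfold prim; rewrite RInt_point; reflexivity. Qed.

Lemma derivable_prim a G t : continuity G -> derivable_pt_lim (prim a G) t (G t).
Proof.
  intros HG; apply is_derive_Reals, (is_derive_RInt G (prim a G) a t).
  - apply filter_forall; intros y; apply (@RInt_correct R_CompleteNormedModule).
    apply (@ex_RInt_continuous R_CompleteNormedModule); intros z _; apply continuity_pt_filterlim, HG.
  - apply continuity_pt_filterlim, HG.
Qed.

(** Uniform convergence of derivatives, stated for increments because the partial sums are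
    differentiable only inside the interval. It serves both the Picard series and the FD series. *)
Lemma limit_of_antiderivatives (S dS : nat -> R -> R) (x G Ga : R -> R) a b :
  (forall n t, a < t < b -> derivable_pt_lim (S n) t (dS n t)) ->
  (forall n t, a <= t <= b -> continuity_pt (S n) t) ->
  (forall t, a <= t <= b -> derivable_pt_lim Ga t (G t)) ->
  (forall eps, 0 < eps -> exists n0, forall n, (n0 <= n)%nat -> forall t, a < t < b -> Rabs (dS n t - G t) <= eps) ->
  (forall t, a <= t <= b -> Un_cv (fun n => S n t) (x t)) ->
  forall s t, a <= s -> s <= t -> t <= b -> x t - x s = Ga t - Ga s.
Proof.
  intros HS HSc HG Hunif Hcv s t Has Hst Htb.
  apply cond_eq; intros eps Heps.
  set (e := eps / (3 * (t - s + 1))).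
  assert (He : 0 < e) by (apply Rdiv_lt_0_compat; lra).
  destruct (Hunif e He) as [n1 Hn1].
  destruct (Hcv t ltac:(lra) (eps / 4) ltac:(lra)) as [n2 Hn2].
  destruct (Hcv s ltac:(lra) (eps / 4) ltac:(lra)) as [n3 Hn3].
  set (n := Nat.max n1 (Nat.max n2 n3)).
  specialize (Hn1 n ltac:(lia)); specialize (Hn2 n ltac:(lia)); specialize (Hn3 n ltac:(lia)).
  unfold Rdist in *.
  assert (Hi : Rabs ((S n t - Ga t) - (S n s - Ga s)) <= e * (t - s)).
  { apply (increment_bound (fun r => S n r - Ga r) (fun r => dS n r - G r) s t e Hst).
    - intros r Hr; apply (derivable_pt_lim_minus (S n) Ga); [apply HS|apply HG]; lra.
    - intros r Hr; apply (continuity_pt_minus (S n) Ga); [apply HSc; lra|].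
      eapply derivable_pt_lim_continuity_pt, HG; lra.
    - intros r Hr; apply Hn1; lra. }
  assert (e * (t - s) <= eps / 3).
  { unfold e; apply Rmult_le_reg_r with (3 * (t - s + 1)); [lra|].
    replace (eps / (3 * (t - s + 1)) * (t - s) * (3 * (t - s + 1))) with (eps * (t - s)) by (field; lra).
    nra. }
  apply Rabs_def2 in Hn2; apply Rabs_def2 in Hn3; apply Rabs_le_between in Hi.
  apply Rabs_def1; lra.
Qed.

Lemma nondecreasing_of_derivative g dg s t :
  (forall r, derivable_pt_lim g r (dg r)) -> (forall r, 0 <= dg r) -> s <= t -> g s <= g t.
Proof.
  intros Hd Hp [Hst| ->]; [|lra].
  destruct (MVT_open g dg s t Hst) as [c [_ Heq]]; [intros; apply Hd| |specialize (Hp c); nra].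
  intros; eapply derivable_pt_lim_continuity_pt, Hd.
Qed.

(** Both [g - f] and [g + f] are nondecreasing. The absolute values in the conclusion cover times
    before [a] as well, so the Picard series can be treated on the whole line. *)
Lemma increment_comparison f df g dg a t :
  (forall r, derivable_pt_lim f r (df r)) -> (forall r, derivable_pt_lim g r (dg r)) ->
  (forall r, Rabs (df r) <= dg r) -> f a = 0 -> g a = 0 -> Rabs (f t) <= Rabs (g t).
Proof.
  intros Hf Hg Hle Hfa Hga.
  assert (H1 : forall r, derivable_pt_lim (fun r => g r - f r) r (dg r - df r))
    by (intros r; apply (derivable_pt_lim_minus g f); [apply Hg|apply Hf]).
  assert (H2 : forall r, derivable_pt_lim (fun r => g r + f r) r (dg r + df r))
    by (intros r; apply (derivable_pt_lim_plus g f); [apply Hg|apply Hf]).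
  assert (P1 : forall r, 0 <= dg r - df r) by (intros r; specialize (Hle r); apply Rabs_le_between in Hle; lra).
  assert (P2 : forall r, 0 <= dg r + df r) by (intros r; specialize (Hle r); apply Rabs_le_between in Hle; lra).
  destruct (Rle_or_lt a t) as [Hat|Hat].
  - pose proof (nondecreasing_of_derivative _ _ a t H1 P1 Hat) as Q1.
    pose proof (nondecreasing_of_derivative _ _ a t H2 P2 Hat) as Q2; simpl in *.
    rewrite (Rabs_right (g t)) by lra; apply Rabs_le; lra.
  - pose proof (nondecreasing_of_derivative _ _ t a H1 P1 ltac:(lra)) as Q1.
    pose proof (nondecreasing_of_derivative _ _ t a H2 P2 ltac:(lra)) as Q2; simpl in *.
    rewrite (Rabs_left1 (g t)) by lra; apply Rabs_le; lra.
Qed.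

(** * Picard iteration for linear systems with bounded coefficients *)

Section BoundedLinearODE.

Context (m : nat) (A : R -> mat) (f : R -> vec) (a : R) (x0 : vec) (L Fb : R).
Context (HA : forall c b, (c < m)%nat -> (b < m)%nat -> continuity (fun t => A t c b)).
Context (Hf : forall c, (c < m)%nat -> continuity (fun t => f t c)).
Context (HL : 0 <= L) (HAL : forall t c b, (c < m)%nat -> (b < m)%nat -> Rabs (A t c b) <= L).
Context (HF : 0 <= Fb) (HfF : forall t c, (c < m)%nat -> Rabs (f t c) <= Fb).

(** The differences of successive Picard iterates, that is, the terms of the Neumann series; the
    solution is their sum. *)
Fixpoint picard_term (n : nat) (t : R) (c : nat) : R :=
  match n with
  | O => x0 c + prim a (fun s => f s c) t
  | S n' => prim a (fun s => sumn m (fun b => A s c b * picard_term n' s b)) t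
  end.

Definition picard_dterm (n : nat) (t : R) (c : nat) : R :=
  match n with O => f t c | S n' => sumn m (fun b => A t c b * picard_term n' t b) end.

Lemma picard_term_derivable n : forall c t, (c < m)%nat ->
  derivable_pt_lim (fun t => picard_term n t c) t (picard_dterm n t c).
Proof.
  induction n as [|n IH]; intros c t Hc; simpl.
  - rewrite <- (Rplus_0_l (f t c)).
    apply (derivable_pt_lim_plus (fun _ => x0 c) (prim a (fun s => f s c))); [apply derivable_pt_lim_const|].
    apply (derivable_prim a (fun s => f s c)), Hf, Hc.
  - apply (derivable_prim a (fun s => sumn m (fun b => A s c b * picard_term n s b))).
    intros s; apply (continuity_pt_sumn m (fun b s => A s c b * picard_term n s b)); intros b Hb.
    apply (continuity_pt_mult (fun s => A s c b)); [apply HA; assumption|].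
    eapply derivable_pt_lim_continuity_pt, IH, Hb.
Qed.

(** Against a weight growing like exp(lam |t - a|) an integration gains the factor 1/lam, so
    [lam > 2 m L] makes every Picard step a contraction by 1/2 on the whole line. [Ch] is a smooth
    substitute for this weight, twice a hyperbolic cosine, and [Sh] has derivative [lam * Ch]. *)
Let lam := 2 * (INR m * L) + 1.
Let Ch (t : R) := exp (lam * (t - a)) + exp (- (lam * (t - a))).
Let Sh (t : R) := exp (lam * (t - a)) - exp (- (lam * (t - a))).
Let C0 := sumn m (fun c => Rabs (x0 c)) + Fb.

Lemma picard_lam_ge_1 : 1 <= lam.
Proof. unfold lam; pose proof (pos_INR m); nra. Qed.

Lemma picard_C0_ge_0 : 0 <= C0.
Proof.
  unfold C0; assert (0 <= sumn m (fun c => Rabs (x0 c))) by (apply sumn_ge_0; intros; apply Rabs_pos); lra.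
Qed.

Lemma picard_Ch_ge t : 1 + Rabs (t - a) <= Ch t.
Proof.
  pose proof picard_lam_ge_1; unfold Ch.
  pose proof (exp_pos (lam * (t - a))); pose proof (exp_pos (- (lam * (t - a)))).
  pose proof (exp_ineq1_le (lam * (t - a))); pose proof (exp_ineq1_le (- (lam * (t - a)))).
  unfold Rabs; destruct (Rcase_abs (t - a)); nra.
Qed.

Lemma picard_Sh_derivable t : derivable_pt_lim Sh t (lam * Ch t).
Proof. unfold Sh, Ch; apply is_derive_Reals; auto_derive; [exact I|unfold Rminus; ring]. Qed.

Lemma picard_Sh_le_Ch t : Rabs (Sh t) <= Ch t.
Proof.
  unfold Sh, Ch; pose proof (exp_pos (lam * (t - a))); pose proof (exp_pos (- (lam * (t - a)))).
  apply Rabs_le; lra.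
Qed.

Lemma picard_term_bound n : forall c t, (c < m)%nat -> Rabs (picard_term n t c) <= C0 * Ch t * (/ 2) ^ n.
Proof.
  pose proof picard_lam_ge_1 as Hlam; pose proof picard_C0_ge_0 as HC0.
  induction n as [|n IH]; intros c t Hc; simpl.
  - eapply Rle_trans; [apply Rabs_triang|].
    assert (Hx : Rabs (x0 c) <= sumn m (fun c => Rabs (x0 c)))
      by (apply (sumn_term_le m (fun c => Rabs (x0 c))); [intros; apply Rabs_pos|exact Hc]).
    assert (Hp : Rabs (prim a (fun s => f s c) t) <= Rabs (Fb * (t - a))).
    { apply (increment_comparison (prim a (fun s => f s c)) (fun s => f s c) (fun t => Fb * (t - a)) (fun _ => Fb) a).
      - intros r; apply (derivable_prim a (fun s => f s c)), Hf, Hc.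
      - intros r; apply is_derive_Reals; auto_derive; [exact I|ring].
      - intros r; apply HfF, Hc.
      - apply prim_start.
      - ring. }
    rewrite Rabs_mult, (Rabs_right Fb) in Hp by lra.
    pose proof (picard_Ch_ge t); pose proof (Rabs_pos (t - a)); pose proof (Rabs_pos (x0 c)).
    set (s0 := sumn m (fun c => Rabs (x0 c))) in *; unfold C0; fold s0.
    assert ((s0 + Fb) * (1 + Rabs (t - a)) <= (s0 + Fb) * Ch t) by (apply Rmult_le_compat_l; lra).
    nra.
  - set (k := C0 * (/ 2) ^ n * / 2).
    assert (Hk : 0 <= k) by (unfold k; pose proof (pow_le (/ 2) n ltac:(lra)); nra).
    eapply Rle_trans; [apply (increment_comparison _
      (fun s => sumn m (fun b => A s c b * picard_term n s b)) (fun t => k * Sh t) (fun t => k * (lam * Ch t)) a)|].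
    + intros r; apply (picard_term_derivable (S n) c r Hc).
    + intros r; apply (derivable_pt_lim_scal Sh), picard_Sh_derivable.
    + intros r; pose proof (picard_Ch_ge r); pose proof (Rabs_pos (r - a)).
      apply Rle_trans with (INR m * (L * (C0 * Ch r * (/ 2) ^ n))).
      * apply sumn_bound; intros b Hb; rewrite Rabs_mult.
        apply Rmult_le_compat; try apply Rabs_pos; [apply HAL; assumption|apply IH, Hb].
      * unfold k, lam.
        replace (INR m * (L * (C0 * Ch r * (/ 2) ^ n))) with (C0 * (/ 2) ^ n * Ch r * (INR m * L)) by ring.
        replace (C0 * (/ 2) ^ n * / 2 * ((2 * (INR m * L) + 1) * Ch r))
          with (C0 * (/ 2) ^ n * Ch r * (INR m * L + / 2)) by field.
        apply Rmult_le_compat_l; [|lra].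
        apply Rmult_le_pos; [apply Rmult_le_pos; [exact HC0|apply pow_le; lra]|lra].
    + apply prim_start.
    + unfold Sh; rewrite Rminus_diag, Rmult_0_r, Ropp_0; ring.
    + rewrite Rabs_mult, (Rabs_right k) by lra; pose proof (picard_Sh_le_Ch t).
      unfold k in *; nra.
Qed.

Lemma ex_series_half (K : R) : ex_series (fun n => K * (/ 2) ^ n).
Proof. apply ex_series_scal_R, ex_series_geom; rewrite Rabs_right; lra. Qed.

Lemma picard_Ch_bound T t : Rabs (t - a) <= T -> Ch t <= 2 * exp (lam * T).
Proof.
  intros HT; apply Rabs_le_between in HT; pose proof picard_lam_ge_1; unfold Ch.
  assert (He : forall x y, x <= y -> exp x <= exp y).
  { intros x y [Hxy| ->]; [left; apply exp_increasing, Hxy|lra]. }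
  assert (exp (lam * (t - a)) <= exp (lam * T)) by (apply He; nra).
  assert (exp (- (lam * (t - a))) <= exp (lam * T)) by (apply He; nra).
  lra.
Qed.

Lemma picard_term_bound_local T n c t :
  (c < m)%nat -> Rabs (t - a) <= T -> Rabs (picard_term n t c) <= C0 * (2 * exp (lam * T)) * (/ 2) ^ n.
Proof.
  intros Hc HT; eapply Rle_trans; [apply picard_term_bound, Hc|].
  apply Rmult_le_compat_r; [apply pow_le; lra|].
  apply Rmult_le_compat_l; [apply picard_C0_ge_0|apply picard_Ch_bound, HT].
Qed.

Lemma bounded_linear_ode_exists :
  exists x : R -> vec, (forall c, (c < m)%nat -> x a c = x0 c) /\
    forall t c, (c < m)%nat ->
      derivable_pt_lim (fun t => x t c) t (matvec m (A t) (x t) c + f t c).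
Proof.
  set (x := fun t c => Series (fun n => picard_term n t c)).
  assert (Hcont : forall c, (c < m)%nat -> continuity (fun t => x t c)).
  { intros c Hc t.
    apply (continuity_pt_Series (fun n t => picard_term n t c)
             (fun n => C0 * (2 * exp (lam * (Rabs (t - a) + 1))) * (/ 2) ^ n) t 1 Rlt_0_1).
    - intros n; eapply derivable_pt_lim_continuity_pt, picard_term_derivable, Hc.
    - intros n r Hr; apply picard_term_bound_local; [exact Hc|].
      replace (r - a) with (r - t + (t - a)) by ring; eapply Rle_trans; [apply Rabs_triang|lra].
    - apply ex_series_half. }
  set (G := fun c t => matvec m (A t) (x t) c + f t c).
  assert (HG : forall c, (c < m)%nat -> continuity (G c)).
  { intros c Hc t; unfold G, matvec.
    apply (continuity_pt_plus (fun t => sumn m (fun b => A t c b * x t b))); [|apply Hf, Hc].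
    apply (continuity_pt_sumn m (fun b t => A t c b * x t b)); intros b Hb.
    apply (continuity_pt_mult (fun t => A t c b)); [apply HA; assumption|apply Hcont, Hb]. }
  (* The derivative of the partial sum with [n + 2] terms is [f] plus [A] applied to the partial sum
     with [n + 1] terms; it converges to [G c] uniformly on bounded intervals. *)
  assert (Hkey : forall c T, (c < m)%nat -> 0 <= T -> forall s t, a - T <= s -> s <= t -> t <= a + T ->
            x t c - x s c = prim a (G c) t - prim a (G c) s).
  { intros c T Hc HT.
    set (M := C0 * (2 * exp (lam * T))).
    assert (Hex : forall b t, (b < m)%nat -> Rabs (t - a) <= T -> ex_series (fun n => picard_term n t b)).
    { intros b t Hb Ht; apply (series_dominated _ (fun n => M * (/ 2) ^ n)); [|apply ex_series_half].
      intros n; apply picard_term_bound_local; assumption. }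
    apply (limit_of_antiderivatives (fun n t => sumn (S (S n)) (fun k => picard_term k t c))
             (fun n t => sumn (S (S n)) (fun k => picard_dterm k t c)) (fun t => x t c) (G c)).
    - intros n t _; apply (derivable_pt_lim_sumn (S (S n)) (fun k t => picard_term k t c)).
      intros; apply picard_term_derivable, Hc.
    - intros n t _; apply (continuity_pt_sumn (S (S n)) (fun k t => picard_term k t c)).
      intros; eapply derivable_pt_lim_continuity_pt, picard_term_derivable, Hc.
    - intros t _; apply derivable_prim, HG, Hc.
    - intros eps Heps.
      set (e := eps / (INR m * L + 1)); pose proof (pos_INR m).
      assert (He : 0 < e) by (apply Rdiv_lt_0_compat; nra).
      destruct (series_tail_small (fun n => M * (/ 2) ^ n) e (ex_series_half M) He) as [n0 Hn0].
      exists n0; intros n Hn t Ht; specialize (Hn0 n Hn).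
      assert (HtT : Rabs (t - a) <= T) by (apply Rabs_le; lra).
      rewrite sumn_Sl; simpl picard_dterm.
      rewrite (sumn_exchange (S n) m (fun k b => A t c b * picard_term k t b)).
      unfold G, matvec.
      replace (_ - _) with (sumn m (fun b => A t c b * (sum_f_R0 (fun k => picard_term k t b) n - x t b))).
      2: { rewrite (sumn_ext m (fun b => sumn (S n) _)
             (fun b => A t c b * sum_f_R0 (fun k => picard_term k t b) n)).
           - rewrite (sumn_ext m (fun b => A t c b * (_ - _))
               (fun b => A t c b * sum_f_R0 (fun k => picard_term k t b) n - A t c b * x t b)) by (intros; ring).
             rewrite sumn_minus; ring.
           - intros b Hb; rewrite sumn_scal, sum_f_R0_sumn; reflexivity. }
      apply Rle_trans with (INR m * (L * e)).
      + apply sumn_bound; intros b Hb; rewrite Rabs_mult.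
        apply Rmult_le_compat; try apply Rabs_pos; [apply HAL; assumption|].
        rewrite Rabs_minus_sym; unfold x.
        eapply Rle_trans; [apply (series_tail_dominated _ (fun n => M * (/ 2) ^ n)); [|apply ex_series_half]|].
        * intros k; apply picard_term_bound_local; assumption.
        * eapply Rle_trans; [apply Rle_abs|lra].
      + apply Rle_trans with ((INR m * L + 1) * e); [nra|].
        unfold e; right; field; nra.
    - intros t Ht eps Heps.
      destruct (series_tail_small (fun n => picard_term n t c) eps) as [n0 Hn0]; try assumption.
      { apply Hex; [exact Hc|apply Rabs_le; lra]. }
      exists n0; intros n Hn; unfold Rdist; rewrite <- sum_f_R0_sumn, Rabs_minus_sym; apply Hn0; lia. }
  assert (Hx : forall c t, (c < m)%nat -> x t c = x a c + prim a (G c) t).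
  { intros c t Hc; pose proof (prim_start a (G c)) as H0.
    destruct (Rle_or_lt a t) as [Hat|Hat].
    - pose proof (Hkey c (t - a) Hc ltac:(lra) a t ltac:(lra) Hat ltac:(lra)); lra.
    - pose proof (Hkey c (a - t) Hc ltac:(lra) t a ltac:(lra) ltac:(lra) ltac:(lra)); lra. }
  exists x; split.
  - intros c Hc; unfold x; apply is_series_unique.
    replace (x0 c) with (sum_f_R0 (fun n => picard_term n a c) 0).
    + apply (is_series_decr_1 (fun n => picard_term n a c)); simpl.
      apply (is_series_ext (fun _ => 0)); [intros n; symmetry; apply prim_start|].
      apply is_series_Reals; intros eps Heps; exists 0%nat; intros n _.
      rewrite sum_f_R0_sumn, sumn_const, Rmult_0_r, prim_start; unfold Rdist.
      change (Rabs (0 - (x0 c + 0 + - (x0 c + 0))) < eps); rewrite Rabs_right; lra.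
    + simpl; rewrite prim_start; ring.
  - intros t c Hc; apply (derivable_pt_lim_local (fun t => x a c + prim a (G c) t) _ t _ 1 Rlt_0_1).
    + intros y _; symmetry; apply Hx, Hc.
    + change (matvec m (A t) (x t) c + f t c) with (G c t); rewrite <- (Rplus_0_l (G c t)).
      apply (derivable_pt_lim_plus (fun _ => x a c)); [apply derivable_pt_lim_const|apply derivable_prim, HG, Hc].
Qed.

End BoundedLinearODE.

Lemma continuous_family_bounded n (f : nat -> R -> R) a b :
  a <= b -> (forall k, (k < n)%nat -> continuity (f k)) ->
  exists L, 0 <= L /\ forall k t, (k < n)%nat -> a <= t <= b -> Rabs (f k t) <= L.
Proof.
  intros Hab; induction n as [|n IH]; intros H; [exists 0; split; [lra|]; intros; lia|].
  destruct IH as [L [HL Hb]]; [intros; apply H; lia|].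
  destruct (continuity_ab_maj (fun t => Rabs (f n t)) a b Hab) as [M [HM _]].
  { intros c _; apply (continuity_pt_comp (f n) Rabs); [apply H; lia|apply Rcontinuity_abs]. }
  exists (L + Rabs (f n M)); pose proof (Rabs_pos (f n M)); split; [lra|].
  intros k t Hk Ht; destruct (Nat.eq_dec k n) as [->|Hne].
  - specialize (HM t Ht); lra.
  - specialize (Hb k t ltac:(lia) Ht); lra.
Qed.

Lemma linear_ode_exists m (A : R -> mat) (f : R -> vec) a b (x0 : vec) :
  a <= b ->
  (forall c d, (c < m)%nat -> (d < m)%nat -> continuity (fun t => A t c d)) ->
  (forall c, (c < m)%nat -> continuity (fun t => f t c)) ->
  exists x : R -> vec, (forall c, (c < m)%nat -> x a c = x0 c) /\
    (forall c, (c < m)%nat -> continuity (fun t => x t c)) /\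
    forall t c, (c < m)%nat -> a <= t <= b ->
      derivable_pt_lim (fun t => x t c) t (matvec m (A t) (x t) c + f t c).
Proof.
  intros Hab HA Hf.
  (* Stopping time at the ends of [[a,b]] makes the coefficients bounded on the whole line without
     changing them on the interval. *)
  set (cl := fun t => Rmin b (Rmax a t)).
  assert (Hcl : forall t, a <= cl t <= b).
  { intros t; unfold cl; split; [apply Rmin_glb; [exact Hab|apply Rmax_l]|apply Rmin_l]. }
  assert (Hclc : continuity cl).
  { intros t; unfold cl.
    apply (continuity_pt_ext_all (fun t => - Rmax (- b) (- Rmax a t))).
    - intros y; rewrite <- Ropp_Rmin, Ropp_involutive; reflexivity.
    - apply continuity_pt_opp.
      apply (continuity_pt_comp (fun t => - Rmax a t) (Rmax (- b))); [|apply continuity_pt_clamp].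
      apply continuity_pt_opp, continuity_pt_clamp. }
  assert (Hclid : forall t, a <= t <= b -> cl t = t).
  { intros t Ht; unfold cl; rewrite Rmax_right, Rmin_right; lra. }
  destruct (continuous_family_bounded m (fun c t => f t c) a b Hab Hf) as [Fb [HF0 HF]].
  (* The index [k] encodes the entry [(k / m, k mod m)], so that one family contains all entries of
     the matrix. *)
  destruct (continuous_family_bounded (m * m) (fun k t => A t (k / m)%nat (k mod m)%nat) a b Hab) as [L [HL0 HL]].
  { intros k Hk; assert (m <> 0%nat) by lia.
    apply HA; [apply Nat.Div0.div_lt_upper_bound; lia|apply Nat.mod_upper_bound; assumption]. }
  destruct (bounded_linear_ode_exists m (fun t => A (cl t)) (fun t => f (cl t)) a x0 L Fb) as [x [Hx0 Hx]].
  - intros c d Hc Hd t; apply (continuity_pt_comp cl (fun t => A t c d)); [apply Hclc|apply HA; assumption].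
  - intros c Hc t; apply (continuity_pt_comp cl (fun t => f t c)); [apply Hclc|apply Hf; assumption].
  - exact HL0.
  - intros t c d Hc Hd.
    assert (E1 : ((c * m + d) / m)%nat = c) by (rewrite Nat.div_add_l, Nat.div_small by lia; lia).
    assert (E2 : ((c * m + d) mod m)%nat = d) by (rewrite Nat.add_comm, Nat.Div0.mod_add; apply Nat.mod_small, Hd).
    specialize (HL (c * m + d)%nat (cl t) ltac:(nia) (Hcl t)); simpl in HL; rewrite E1, E2 in HL; exact HL.
  - exact HF0.
  - intros t c Hc; apply HF; [exact Hc|apply Hcl].
  - exists x; split; [exact Hx0|split].
    + intros c Hc t; eapply derivable_pt_lim_continuity_pt, Hx, Hc.
    + intros t c Hc Ht; specialize (Hx t c Hc); simpl in Hx; rewrite (Hclid t Ht) in Hx; exact Hx.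
Qed.

(** * Monomials as words *)

(* A multi-index [i] is unfolded into the word in which letter [s + c] occurs
   [i_c] times, so that products over it are handled by list induction. *)
Fixpoint word (s : nat) (i : list nat) : list nat :=
  match i with nil => nil | a :: l => repeat s a ++ word (S s) l end.

Fixpoint wprod (w : list nat) (u : vec) : R :=
  match w with nil => 1 | c :: w' => u c * wprod w' u end.

Fixpoint dwprod (p : nat) (w : list nat) (u : vec) : R :=
  match w with
  | nil => 0
  | c :: w' => (if Nat.eqb c p then wprod w' u else 0) + u c * dwprod p w' u
  end.

(* The coefficient of [tau ^ k] in [wprod w (sum_l tau ^ l * v l)]. *)
Fixpoint wser (w : list nat) (v : nat -> vec) (k : nat) : R :=
  match w with
  | nil => match k with O => 1 | S _ => 0 end
  | c :: w' => sum_f_R0 (fun l => v l c * wser w' v (k - l)) k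
  end.

Notation letters m w := (Forall (fun c => (c < m)%nat) w).

Lemma length_word i : forall s, length (word s i) = list_sum i.
Proof.
  induction i as [|a l IH]; intros s; simpl; [reflexivity|].
  rewrite length_app, repeat_length, IH; reflexivity.
Qed.

Lemma letters_word i : forall s, letters (s + length i)%nat (word s i).
Proof.
  induction i as [|a l IH]; intros s; simpl; [constructor|].
  apply Forall_app; split.
  - apply Forall_forall; intros x Hx; apply repeat_spec in Hx; lia.
  - replace (s + S (length l))%nat with (S s + length l)%nat by lia; apply IH.
Qed.

Lemma multi_indices_spec m : forall p i, In i (multi_indices m p) -> length i = m /\ list_sum i = p.
Proof.
  induction m as [|m IH]; intros p i H; simpl in H.
  - destruct p; [|destruct H]; destruct H as [<-|[]]; split; reflexivity.
  - change (In i (flat_map (fun k => map (cons k) (multi_indices m (p - k))) (seq 0 (S p)))) in H.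
    apply in_flat_map in H; destruct H as [k [Hk H]].
    apply in_seq in Hk; apply in_map_iff in H; destruct H as [l [<- Hl]].
    destruct (IH _ _ Hl) as [H1 H2]; simpl; split; lia.
Qed.

Lemma word_spec m p i : In i (multi_indices m p) -> letters m (word 0 i) /\ length (word 0 i) = p.
Proof.
  intros H; destruct (multi_indices_spec m p i H) as [<- <-].
  split; [apply (letters_word i 0)|apply length_word].
Qed.

Lemma wprod_app w1 w2 u : wprod (w1 ++ w2) u = wprod w1 u * wprod w2 u.
Proof. induction w1 as [|c w IH]; simpl; [ring|]; rewrite IH; ring. Qed.

Lemma wprod_repeat s a u : wprod (repeat s a) u = u s ^ a.
Proof. induction a as [|a IH]; simpl; [reflexivity|]; rewrite IH; reflexivity. Qed.

Lemma mono_shift_wprod i : forall s u, mono i (fun j => u (s + j)%nat) = wprod (word s i) u.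
Proof.
  induction i as [|a l IH]; intros s u; simpl; [reflexivity|].
  rewrite wprod_app, wprod_repeat, <- IH, Nat.add_0_r; f_equal; f_equal.
  apply functional_extensionality; intros j; f_equal; lia.
Qed.

Lemma mono_wprod i u : mono i u = wprod (word 0 i) u.
Proof. rewrite <- mono_shift_wprod; reflexivity. Qed.

Lemma wprod_ext m w u u' : letters m w -> (forall c, (c < m)%nat -> u c = u' c) -> wprod w u = wprod w u'.
Proof.
  intros Hw H; induction Hw as [|c w Hc Hw IH]; simpl; [reflexivity|].
  rewrite H, IH by assumption; reflexivity.
Qed.

Lemma wprod_bound m w u K :
  letters m w -> 0 <= K -> (forall c, (c < m)%nat -> Rabs (u c) <= K) -> Rabs (wprod w u) <= K ^ length w.
Proof.
  intros Hw HK H; induction Hw as [|c w Hc Hw IH]; simpl; [rewrite Rabs_R1; lra|].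
  rewrite Rabs_mult; apply Rmult_le_compat; try apply Rabs_pos; [apply H, Hc|exact IH].
Qed.

Lemma dwprod_bound m p w u K :
  letters m w -> 1 <= K -> (forall c, (c < m)%nat -> Rabs (u c) <= K) ->
  Rabs (dwprod p w u) <= INR (length w) * K ^ length w.
Proof.
  intros Hw HK H; induction Hw as [|c w Hc Hw IH]; simpl dwprod; [simpl; rewrite Rabs_R0; lra|].
  simpl length; rewrite S_INR; simpl pow.
  pose proof (wprod_bound m w u K Hw ltac:(lra) H) as Hb.
  pose proof (pow_le K (length w) ltac:(lra)).
  eapply Rle_trans; [apply Rabs_triang|].
  assert (Rabs (if Nat.eqb c p then wprod w u else 0) <= K ^ length w).
  { destruct (Nat.eqb c p); [exact Hb|rewrite Rabs_R0; lra]. }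
  assert (Rabs (u c * dwprod p w u) <= K * (INR (length w) * K ^ length w)).
  { rewrite Rabs_mult; apply Rmult_le_compat; try apply Rabs_pos; [apply H, Hc|exact IH]. }
  nra.
Qed.

Lemma wprod_diff_bound m w u u' K d :
  letters m w -> 1 <= K -> 0 <= d ->
  (forall c, (c < m)%nat -> Rabs (u c) <= K) -> (forall c, (c < m)%nat -> Rabs (u' c) <= K) ->
  (forall c, (c < m)%nat -> Rabs (u c - u' c) <= d) ->
  Rabs (wprod w u - wprod w u') <= INR (length w) * K ^ length w * d.
Proof.
  intros Hw HK Hd H H' Hdiff; induction Hw as [|c w Hc Hw IH].
  - simpl; rewrite Rminus_diag, Rabs_R0; lra.
  - simpl length; rewrite S_INR; simpl.
    pose proof (wprod_bound m w u K Hw ltac:(lra) H) as Hb.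
    pose proof (pow_le K (length w) ltac:(lra)).
    replace (u c * wprod w u - u' c * wprod w u')
      with ((u c - u' c) * wprod w u + u' c * (wprod w u - wprod w u')) by ring.
    eapply Rle_trans; [apply Rabs_triang|]; rewrite !Rabs_mult.
    assert (Rabs (u c - u' c) * Rabs (wprod w u) <= d * K ^ length w).
    { apply Rmult_le_compat; try apply Rabs_pos; [apply Hdiff, Hc|exact Hb]. }
    assert (Rabs (u' c) * Rabs (wprod w u - wprod w u') <= K * (INR (length w) * K ^ length w * d)).
    { apply Rmult_le_compat; try apply Rabs_pos; [apply H', Hc|exact IH]. }
    assert (0 <= d * K ^ length w) by nra; nra.
Qed.

Lemma wprod_taylor_bound m w u z K d :
  letters m w -> 1 <= K -> 0 <= d ->
  (forall c, (c < m)%nat -> Rabs (u c) <= K) -> (forall c, (c < m)%nat -> Rabs (u c + z c) <= K) ->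
  (forall c, (c < m)%nat -> Rabs (z c) <= d) ->
  Rabs (wprod w (fun c => u c + z c) - wprod w u - sumn m (fun p => dwprod p w u * z p))
    <= INR (length w) ^ 2 * K ^ length w * (d * d).
Proof.
  intros Hw HK Hd H H' Hz; induction Hw as [|c w Hc Hw IH].
  - simpl; rewrite sumn_0 by (intros; ring); rewrite Rminus_diag, Rminus_0_r, Rabs_R0; lra.
  - simpl length; rewrite S_INR; simpl wprod; simpl dwprod.
    rewrite (sumn_ext m _ (fun p => (if Nat.eqb p c then wprod w u * z p else 0) + u c * (dwprod p w u * z p))).
    2: { intros p _; rewrite (Nat.eqb_sym c p); destruct (Nat.eqb p c); ring. }
    rewrite sumn_plus, sumn_scal, (sumn_delta m c (fun p => wprod w u * z p) Hc).
    set (D := sumn m _) in *.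
    replace ((u c + z c) * wprod w (fun c => u c + z c) - u c * wprod w u - (wprod w u * z c + u c * D))
      with (u c * (wprod w (fun c => u c + z c) - wprod w u - D)
            + z c * (wprod w (fun c => u c + z c) - wprod w u)) by ring.
    assert (Hdiff : Rabs (wprod w (fun c => u c + z c) - wprod w u) <= INR (length w) * K ^ length w * d).
    { apply (wprod_diff_bound m); try assumption.
      intros c' Hc'; replace (u c' + z c' - u c') with (z c') by ring; apply Hz, Hc'. }
    eapply Rle_trans; [apply Rabs_triang|]; rewrite !Rabs_mult.
    assert (H1 : Rabs (u c) * Rabs (wprod w (fun c => u c + z c) - wprod w u - D)
            <= K * (INR (length w) ^ 2 * K ^ length w * (d * d))).
    { apply Rmult_le_compat; try apply Rabs_pos; [apply H, Hc|exact IH]. }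
    assert (H2 : Rabs (z c) * Rabs (wprod w (fun c => u c + z c) - wprod w u)
            <= d * (INR (length w) * K ^ length w * d)).
    { apply Rmult_le_compat; try apply Rabs_pos; [apply Hz, Hc|exact Hdiff]. }
    assert (0 <= K ^ length w * (d * d)) by (apply Rmult_le_pos; [apply pow_le; lra|nra]).
    set (Q := K ^ length w * (d * d)) in *; set (n := INR (length w)) in *.
    assert (0 <= n) by apply pos_INR.
    replace (K * (n ^ 2 * K ^ length w * (d * d))) with (K * n ^ 2 * Q) in H1 by (unfold Q; ring).
    replace (d * (n * K ^ length w * d)) with (n * Q) in H2 by (unfold Q; ring).
    replace ((n + 1) ^ 2 * K ^ S (length w) * (d * d)) with ((n + 1) ^ 2 * K * Q) by (unfold Q; simpl; ring).
    assert (K * n ^ 2 * Q + n * Q <= (n + 1) ^ 2 * K * Q); [|lra].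
    replace (K * n ^ 2 * Q + n * Q) with ((K * n ^ 2 + n) * Q) by ring.
    apply Rmult_le_compat_r; [assumption|nra].
Qed.

(** * Monomials of a power series in the parameter *)

Lemma wser_0 w v : wser w v 0 = wprod w (v 0%nat).
Proof. induction w as [|c w IH]; simpl; [reflexivity|]; rewrite IH; reflexivity. Qed.

Lemma wser_ext m w v v' k :
  letters m w -> (forall l c, (l <= k)%nat -> (c < m)%nat -> v l c = v' l c) -> wser w v k = wser w v' k.
Proof.
  intros Hw; revert k; induction Hw as [|c w Hc Hw IH]; intros k H; simpl; [reflexivity|].
  apply sum_eq; intros l Hl; rewrite H by assumption; f_equal.
  apply IH; intros; apply H; [lia|assumption].
Qed.

Lemma wser_scale w v tau k : wser w (fun l c => tau ^ l * v l c) k = tau ^ k * wser w v k.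
Proof.
  revert k; induction w as [|c w IH]; intros k; simpl.
  - destruct k; simpl; ring.
  - rewrite scal_sum; apply sum_eq; intros l Hl; rewrite IH.
    replace (tau ^ k) with (tau ^ l * tau ^ (k - l)) by (rewrite <- pow_add; f_equal; lia); ring.
Qed.

(** Separates the order zero, which is of size [K], from the positive orders, which carry the small
    factor [delta]. *)
Definition drop0 (a : nat -> R) (l : nat) : R := match l with O => 0 | S _ => a l end.

Lemma conv_split_first (a b : nat -> R) k :
  sum_f_R0 (fun l => a l * b (k - l)%nat) k
  = a 0%nat * b k + sum_f_R0 (fun l => drop0 a l * b (k - l)%nat) k.
Proof.
  rewrite !sum_f_R0_sumn, !sumn_Sl; simpl; rewrite Nat.sub_0_r; ring.
Qed.

Section WordSeriesBounds.

Context (m : nat) (q K : R) (Hq : 0 <= q) (HK : 1 <= K).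

(** Each letter is one more convolution, hence costs one factor 8 beside [K]. *)
Lemma wser_bound w v n :
  letters m w -> (forall l c, (l <= n)%nat -> (c < m)%nat -> Rabs (v l c) <= K * wt q l) ->
  forall k, (k <= n)%nat -> Rabs (wser w v k) <= (8 * K) ^ length w * wt q k.
Proof.
  intros Hw Hv; induction Hw as [|c w Hc Hw IH]; intros k Hk.
  - destruct k as [|k]; simpl wser.
    + rewrite wt_0, Rabs_R1; simpl; lra.
    + rewrite Rabs_R0; simpl; rewrite Rmult_1_l; apply wt_ge_0, Hq.
  - simpl wser; simpl length; simpl pow.
    replace (8 * K * (8 * K) ^ length w) with (8 * (K * (8 * K) ^ length w)) by ring.
    apply conv_bound; try lra; [apply pow_le; lra| |].
    + intros l Hl; apply Hv; [lia|exact Hc].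
    + intros l Hl; apply IH; lia.
Qed.

(** A product of positive order has at least one factor of positive order, and there are [length w]
    places where it can stand. *)
Lemma wser_bound_pos w v n delta :
  letters m w -> 0 <= delta ->
  (forall l c, (l <= n)%nat -> (c < m)%nat -> Rabs (v l c) <= K * wt q l) ->
  (forall l c, (1 <= l <= n)%nat -> (c < m)%nat -> Rabs (v l c) <= delta * wt q l) ->
  forall k, (1 <= k <= n)%nat ->
  Rabs (wser w v k) <= INR (length w) * (8 * K) ^ length w * delta * wt q k.
Proof.
  intros Hw Hdelta Hv Hv1; induction Hw as [|c w Hc Hw IH]; intros k Hk.
  - destruct k; [lia|]; simpl; rewrite Rabs_R0; lra.
  - simpl wser; simpl length; rewrite S_INR; simpl pow.
    rewrite (conv_split_first (fun l => v l c) (wser w v)).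
    eapply Rle_trans; [apply Rabs_triang|].
    assert (HX : 0 <= (8 * K) ^ length w) by (apply pow_le; lra).
    assert (Hwt : 0 <= wt q k) by (apply wt_ge_0, Hq).
    assert (H1 : Rabs (v 0%nat c * wser w v k) <= K * (INR (length w) * (8 * K) ^ length w * delta * wt q k)).
    { rewrite Rabs_mult; apply Rmult_le_compat; try apply Rabs_pos; [|apply IH; lia].
      specialize (Hv 0%nat c ltac:(lia) Hc); rewrite wt_0 in Hv; lra. }
    assert (H2 : Rabs (sum_f_R0 (fun l => drop0 (fun l => v l c) l * wser w v (k - l)) k)
              <= 8 * (delta * (8 * K) ^ length w) * wt q k).
    { apply conv_bound; try assumption.
      - intros [|l] Hl; simpl; [rewrite Rabs_R0; pose proof (wt_ge_0 q 0 Hq); nra|].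
        apply Hv1; [lia|exact Hc].
      - intros l Hl; apply (wser_bound w v n Hw Hv); lia. }
    set (n0 := INR (length w)) in *; set (Q := (8 * K) ^ length w * delta * wt q k).
    assert (0 <= Q) by (unfold Q; apply Rmult_le_pos; [nra|assumption]).
    assert (0 <= n0) by apply pos_INR.
    replace (K * (n0 * (8 * K) ^ length w * delta * wt q k)) with (K * n0 * Q) in H1 by (unfold Q; ring).
    replace (8 * (delta * (8 * K) ^ length w) * wt q k) with (8 * Q) in H2 by (unfold Q; ring).
    replace ((n0 + 1) * (8 * K * (8 * K) ^ length w) * delta * wt q k) with ((n0 + 1) * (8 * K) * Q)
      by (unfold Q; ring).
    assert (K * n0 * Q + 8 * Q <= (n0 + 1) * (8 * K) * Q); [|lra].
    replace (K * n0 * Q + 8 * Q) with ((K * n0 + 8) * Q) by ring.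
    apply Rmult_le_compat_r; [assumption|nra].
Qed.

(* With [v k = 0] every surviving term contains two factors of positive order. *)
Lemma wser_bound_quadratic w v k delta :
  letters m w -> 0 <= delta -> (1 <= k)%nat ->
  (forall l c, (l <= k)%nat -> (c < m)%nat -> Rabs (v l c) <= K * wt q l) ->
  (forall l c, (1 <= l <= k)%nat -> (c < m)%nat -> Rabs (v l c) <= delta * wt q l) ->
  (forall c, (c < m)%nat -> v k c = 0) ->
  Rabs (wser w v k) <= INR (length w) ^ 2 * (8 * K) ^ length w * (delta * delta) * wt q k.
Proof.
  intros Hw Hdelta Hk Hv Hv1 Hvk; induction Hw as [|c w Hc Hw IH].
  - destruct k; [lia|]; simpl; rewrite Rabs_R0; lra.
  - simpl wser; simpl length; rewrite S_INR; simpl pow.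
    rewrite (conv_split_first (fun l => v l c) (wser w v)).
    eapply Rle_trans; [apply Rabs_triang|].
    assert (HX : 0 <= (8 * K) ^ length w) by (apply pow_le; lra).
    assert (Hwt : 0 <= wt q k) by (apply wt_ge_0, Hq).
    assert (Hn0 : 0 <= INR (length w)) by apply pos_INR.
    assert (H1 : Rabs (v 0%nat c * wser w v k)
              <= K * (INR (length w) ^ 2 * (8 * K) ^ length w * (delta * delta) * wt q k)).
    { rewrite Rabs_mult; apply Rmult_le_compat; try apply Rabs_pos; [|apply IH].
      specialize (Hv 0%nat c ltac:(lia) Hc); rewrite wt_0 in Hv; lra. }
    assert (H2 : Rabs (sum_f_R0 (fun l => drop0 (fun l => v l c) l * wser w v (k - l)) k)
              <= 8 * (delta * (INR (length w) * (8 * K) ^ length w * delta)) * wt q k).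
    { rewrite (sum_eq _ (fun l => drop0 (fun l => v l c) l * drop0 (wser w v) (k - l))).
      - apply conv_bound; try assumption.
        + repeat apply Rmult_le_pos; assumption.
        + intros [|l] Hl; simpl; [rewrite Rabs_R0; pose proof (wt_ge_0 q 0 Hq); nra|].
          apply Hv1; [lia|exact Hc].
        + intros [|l] Hl; simpl drop0.
          * rewrite Rabs_R0; apply Rmult_le_pos; [|apply wt_ge_0, Hq].
            repeat apply Rmult_le_pos; assumption.
          * apply (wser_bound_pos w v k delta Hw Hdelta Hv Hv1); lia.
      - intros l Hl; destruct (k - l)%nat as [|j] eqn:Ej; [|reflexivity].
        replace l with k by lia; destruct k; [lia|]; simpl drop0; rewrite Hvk by exact Hc; ring. }
    set (n0 := INR (length w)) in *; set (Q := (8 * K) ^ length w * (delta * delta) * wt q k).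
    assert (0 <= Q) by (unfold Q; apply Rmult_le_pos; [apply Rmult_le_pos; [assumption|nra]|assumption]).
    replace (K * (n0 ^ 2 * (8 * K) ^ length w * (delta * delta) * wt q k)) with (K * n0 ^ 2 * Q) in H1 by (unfold Q; ring).
    replace (8 * (delta * (n0 * (8 * K) ^ length w * delta)) * wt q k) with (8 * n0 * Q) in H2 by (unfold Q; ring).
    replace ((n0 + 1) * ((n0 + 1) * 1) * (8 * K * (8 * K) ^ length w) * (delta * delta) * wt q k)
      with ((n0 + 1) ^ 2 * (8 * K) * Q) by (unfold Q; ring).
    assert (K * n0 ^ 2 * Q + 8 * n0 * Q <= (n0 + 1) ^ 2 * (8 * K) * Q); [|lra].
    replace (K * n0 ^ 2 * Q + 8 * n0 * Q) with ((K * n0 ^ 2 + 8 * n0) * Q) by ring.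
    apply Rmult_le_compat_r; [assumption|nra].
Qed.

Lemma wser_diff_bound w v v' n d :
  letters m w -> 0 <= d ->
  (forall l c, (l <= n)%nat -> (c < m)%nat -> Rabs (v l c) <= K * wt q l) ->
  (forall l c, (l <= n)%nat -> (c < m)%nat -> Rabs (v' l c) <= K * wt q l) ->
  (forall l c, (l <= n)%nat -> (c < m)%nat -> Rabs (v l c - v' l c) <= d * wt q l) ->
  forall k, (k <= n)%nat ->
  Rabs (wser w v k - wser w v' k) <= INR (length w) * (8 * K) ^ length w * d * wt q k.
Proof.
  intros Hw Hd Hv Hv' Hdiff; induction Hw as [|c w Hc Hw IH]; intros k Hk.
  - simpl; rewrite Rminus_diag, Rabs_R0; lra.
  - simpl wser; simpl length; rewrite S_INR; simpl pow.
    assert (HX : 0 <= (8 * K) ^ length w) by (apply pow_le; lra).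
    assert (Hwt : 0 <= wt q k) by (apply wt_ge_0, Hq).
    assert (Hn0 : 0 <= INR (length w)) by apply pos_INR.
    replace (sum_f_R0 (fun l => v l c * wser w v (k - l)) k - sum_f_R0 (fun l => v' l c * wser w v' (k - l)) k)
      with (sum_f_R0 (fun l => (v l c - v' l c) * wser w v (k - l)) k
            + sum_f_R0 (fun l => v' l c * (fun j => wser w v j - wser w v' j) (k - l)%nat) k).
    2: { rewrite <- sum_plus, <- minus_sum; apply sum_eq; intros; ring. }
    eapply Rle_trans; [apply Rabs_triang|].
    assert (H1 : Rabs (sum_f_R0 (fun l => (v l c - v' l c) * wser w v (k - l)) k)
              <= 8 * (d * (8 * K) ^ length w) * wt q k).
    { apply (conv_bound q (fun l => v l c - v' l c)); try assumption.
      - intros l Hl; apply Hdiff; [lia|exact Hc].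
      - intros l Hl; apply (wser_bound w v n Hw Hv); lia. }
    assert (H2 : Rabs (sum_f_R0 (fun l => v' l c * (fun j => wser w v j - wser w v' j) (k - l)%nat) k)
              <= 8 * (K * (INR (length w) * (8 * K) ^ length w * d)) * wt q k).
    { apply (conv_bound q (fun l => v' l c) (fun j => wser w v j - wser w v' j)); try assumption; try lra.
      - repeat apply Rmult_le_pos; assumption.
      - intros l Hl; apply Hv'; [lia|exact Hc].
      - intros l Hl; apply IH; lia. }
    set (n0 := INR (length w)) in *; set (Q := (8 * K) ^ length w * d * wt q k).
    assert (0 <= Q) by (unfold Q; apply Rmult_le_pos; [apply Rmult_le_pos|]; assumption).
    replace (8 * (d * (8 * K) ^ length w) * wt q k) with (8 * Q) in H1 by (unfold Q; ring).
    replace (8 * (K * (n0 * (8 * K) ^ length w * d)) * wt q k) with (8 * K * n0 * Q) in H2 by (unfold Q; ring).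
    replace ((n0 + 1) * (8 * K * (8 * K) ^ length w) * d * wt q k) with ((n0 + 1) * (8 * K) * Q)
      by (unfold Q; ring).
    assert (8 * Q + 8 * K * n0 * Q <= (n0 + 1) * (8 * K) * Q); [|lra].
    replace (8 * Q + 8 * K * n0 * Q) with ((8 + 8 * K * n0) * Q) by ring.
    apply Rmult_le_compat_r; [assumption|nra].
Qed.

(** One Cauchy product of absolutely convergent series per letter. The parameter is fixed at 1;
    other values enter through [wser_scale]. *)
Lemma is_series_wser w v :
  q <= 1 -> letters m w -> (forall l c, (c < m)%nat -> Rabs (v l c) <= K * wt q l) ->
  is_series (wser w v) (wprod w (fun c => Series (fun l => v l c))).
Proof.
  intros Hq1 Hw Hv; induction Hw as [|c w Hc Hw IH].
  - apply is_series_Reals; intros eps Heps; exists 0%nat; intros n _.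
    replace (sum_f_R0 (wser nil v) n) with 1; [rewrite Rdist_eq; exact Heps|].
    induction n as [|n IHn]; simpl in *; [reflexivity|]; rewrite <- IHn; ring.
  - simpl wprod.
    assert (Hex : ex_series (wt q)) by (apply ex_series_wt; lra).
    apply (is_series_mult (fun l => v l c) (wser w v)); [| exact IH | |].
    + apply Series_correct, (series_dominated _ (fun l => K * wt q l)); [intros; apply Hv, Hc|].
      apply ex_series_scal_R, Hex.
    + apply (ex_series_abs_dominated _ (fun l => K * wt q l)); [intros; apply Hv, Hc|].
      apply ex_series_scal_R, Hex.
    + apply (ex_series_abs_dominated _ (fun l => (8 * K) ^ length w * wt q l)).
      * intros n; apply (wser_bound w v n Hw); [intros; apply Hv; assumption|lia].
      * apply ex_series_scal_R, Hex.
Qed.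

End WordSeriesBounds.

(** In order [k] the vector [v k] can occur only once, and then every other factor has order zero.
    Hence its coefficient is the partial derivative at [v 0]. *)
Lemma wser_linear_part m w (v v' : nat -> vec) k :
  letters m w -> (1 <= k)%nat ->
  (forall l c, (l < k)%nat -> v' l c = v l c) -> (forall c, v' k c = 0) ->
  wser w v k = wser w v' k + sumn m (fun c => dwprod c w (v 0%nat) * v k c).
Proof.
  intros Hw Hk Hlt Hkk; induction Hw as [|c w Hc Hw IH].
  - simpl; rewrite sumn_0 by (intros; ring); destruct k; ring.
  - simpl wser; simpl dwprod.
    rewrite (sumn_ext m _ (fun p => (if Nat.eqb p c then wprod w (v 0%nat) * v k p else 0)
                                 + v 0%nat c * (dwprod p w (v 0%nat) * v k p))).
    2: { intros p _; rewrite (Nat.eqb_sym c p); destruct (Nat.eqb p c); ring. }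
    rewrite sumn_plus, sumn_scal, (sumn_delta m c (fun p => wprod w (v 0%nat) * v k p) Hc).
    destruct k as [|k]; [lia|]; rewrite !tech5, !Nat.sub_diag, !wser_0, Hkk.
    rewrite !(sum_f_R0_sumn _ k), !sumn_Sl, !Nat.sub_0_r, IH, (Hlt 0%nat c) by lia.
    rewrite (sumn_ext k (fun j => v' (S j) c * wser w v' (S k - S j)) (fun j => v (S j) c * wser w v (S k - S j))).
    + ring.
    + intros j Hj; rewrite Hlt by lia; f_equal.
      apply (wser_ext m); [exact Hw|]; intros l c' Hl _; apply Hlt; lia.
Qed.

Lemma continuity_pt_wser m w (v : R -> nat -> vec) k x :
  letters m w -> (forall l c, (l <= k)%nat -> (c < m)%nat -> continuity_pt (fun t => v t l c) x) ->
  continuity_pt (fun t => wser w (v t) k) x.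
Proof.
  intros Hw; revert k; induction Hw as [|c w Hc Hw IH]; intros k H; simpl.
  - apply continuity_pt_const; intros ? ?; reflexivity.
  - apply (continuity_pt_ext_all (fun t => sumn (S k) (fun l => v t l c * wser w (v t) (k - l)))).
    + intros t; symmetry; apply sum_f_R0_sumn.
    + apply continuity_pt_sumn; intros l Hl.
      apply (continuity_pt_mult (fun t => v t l c)); [apply H; [lia|exact Hc]|].
      apply IH; intros; apply H; [lia|assumption].
Qed.

Lemma INR_sqr_le_pow4 n : INR n ^ 2 <= 4 ^ n.
Proof.
  assert (H : INR n + 1 <= 2 ^ n).
  { induction n as [|n IH]; [simpl; lra|]; rewrite S_INR; simpl; pose proof (pos_INR n); lra. }
  replace (4 ^ n) with ((2 ^ n) ^ 2) by (rewrite <- pow_mult, Nat.mul_comm, pow_mult; f_equal; ring).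
  pose proof (pos_INR n); apply pow_incr; lra.
Qed.

(** Polynomial factors in the degree are absorbed by a larger ratio; this is the origin of the
    factor 4 in the arguments of [Bsum]. *)
Lemma INR_sqr_pow_le X n : 0 <= X -> INR n ^ 2 * X ^ n <= (4 * X) ^ n.
Proof.
  intros HX; rewrite Rpow_mult_distr; apply Rmult_le_compat_r; [apply pow_le, HX|apply INR_sqr_le_pow4].
Qed.

Lemma INR_pow_le X n : 0 <= X -> INR n * X ^ n <= (4 * X) ^ n.
Proof.
  intros HX; eapply Rle_trans; [|apply INR_sqr_pow_le, HX].
  apply Rmult_le_compat_r; [apply pow_le, HX|].
  destruct n as [|n]; [simpl; lra|]; rewrite S_INR; pose proof (pos_INR n); nra.
Qed.

Lemma Rderiv_unique f x l : derivable_pt_lim f x l -> Rderiv f x = l.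
Proof.
  intros H; apply (uniqueness_limite f x); [|exact H].
  unfold Rderiv; apply epsilon_spec; exists l; exact H.
Qed.

(** [N] is differentiated through its Taylor estimate, which avoids termwise differentiation of
    series in several variables. *)
Lemma derivable_pt_lim_quadratic f x l C :
  (forall h, Rabs h < 1 -> Rabs (f (x + h) - f x - h * l) <= C * (h * h)) -> derivable_pt_lim f x l.
Proof.
  intros H eps Heps.
  assert (HC : 0 <= C).
  { specialize (H (1 / 2) ltac:(rewrite Rabs_right; lra)).
    pose proof (Rabs_pos (f (x + 1 / 2) - f x - 1 / 2 * l)); nra. }
  assert (Hd : 0 < Rmin 1 (eps / (C + 1))) by (apply Rmin_pos; [lra|apply Rdiv_lt_0_compat; lra]).
  exists (mkposreal _ Hd); intros h Hh0 Hh; simpl in Hh.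
  assert (H1 := Rlt_le_trans _ _ _ Hh (Rmin_l _ _)); assert (H2 := Rlt_le_trans _ _ _ Hh (Rmin_r _ _)).
  specialize (H h H1).
  assert (Hp : 0 < Rabs h) by (apply Rabs_pos_lt, Hh0).
  replace ((f (x + h) - f x) / h - l) with ((f (x + h) - f x - h * l) / h) by (field; exact Hh0).
  unfold Rdiv; rewrite Rabs_mult, Rabs_inv.
  apply Rmult_lt_reg_r with (Rabs h); [exact Hp|].
  rewrite Rmult_assoc, Rinv_l, Rmult_1_r by lra.
  replace (h * h) with (Rabs h * Rabs h) in H by (rewrite <- Rabs_mult; apply Rabs_right; nra).
  assert (C * Rabs h <= (C + 1) * Rabs h) by nra.
  assert ((C + 1) * Rabs h < eps).
  { replace eps with ((C + 1) * (eps / (C + 1))) by (field; lra); apply Rmult_lt_compat_l; lra. }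
  nra.
Qed.

(** * Finite sums over lists of multi-indices *)

Lemma lsum_ext {A} (l : list A) f g : (forall x, In x l -> f x = g x) -> lsum l f = lsum l g.
Proof.
  induction l as [|x l IH]; intros H; simpl; [reflexivity|].
  rewrite (H x (or_introl eq_refl)); f_equal; apply IH; intros; apply H; right; assumption.
Qed.

Lemma lsum_plus {A} (l : list A) f g : lsum l (fun x => f x + g x) = lsum l f + lsum l g.
Proof. induction l as [|x l IH]; simpl in *; [ring|]; unfold lsum in *; rewrite IH; ring. Qed.

Lemma lsum_scal {A} (l : list A) c f : lsum l (fun x => c * f x) = c * lsum l f.
Proof. induction l as [|x l IH]; simpl in *; [ring|]; unfold lsum in *; rewrite IH; ring. Qed.

Lemma lsum_dominated {A} (l : list A) f g :
  (forall x, In x l -> Rabs (f x) <= g x) -> Rabs (lsum l f) <= lsum l g.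
Proof.
  induction l as [|x l IH]; intros H; simpl; [rewrite Rabs_R0; lra|].
  eapply Rle_trans; [apply Rabs_triang|]; apply Rplus_le_compat.
  - apply H; left; reflexivity.
  - apply IH; intros; apply H; right; assumption.
Qed.

Lemma continuity_pt_lsum {A} (l : list A) (f : A -> R -> R) x :
  (forall i, In i l -> continuity_pt (f i) x) -> continuity_pt (fun t => lsum l (fun i => f i t)) x.
Proof.
  induction l as [|i l IH]; intros H; simpl.
  - apply continuity_pt_const; intros ? ?; reflexivity.
  - apply (continuity_pt_plus (f i) (fun t => lsum l (fun i => f i t))).
    + apply H; left; reflexivity.
    + apply IH; intros; apply H; right; assumption.
Qed.

Lemma is_series_lsum {A} (l : list A) (f : A -> nat -> R) (s : A -> R) :
  (forall i, In i l -> is_series (f i) (s i)) -> is_series (fun n => lsum l (fun i => f i n)) (lsum l s).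
Proof.
  induction l as [|i l IH]; intros H; simpl.
  - apply is_series_Reals; intros eps Heps; exists 0%nat; intros n _.
    rewrite sum_f_R0_sumn, sumn_const, Rmult_0_r.
    rewrite Rdist_eq; exact Heps.
  - apply (is_series_plus (f i) (fun n => lsum l (fun i => f i n))).
    + apply H; left; reflexivity.
    + apply IH; intros; apply H; right; assumption.
Qed.

Lemma is_series_finite (a : nat -> R) k : (forall n, (k < n)%nat -> a n = 0) -> is_series a (sum_f_R0 a k).
Proof.
  intros H; apply is_series_Reals; intros eps Heps; exists k; intros n Hn.
  replace (sum_f_R0 a n) with (sum_f_R0 a k); [rewrite Rdist_eq; exact Heps|].
  induction Hn as [|n Hn IH]; [reflexivity|]; simpl; rewrite <- IH, H by lia; ring.
Qed.

(** * Linear functionals of the coefficients of [N] *)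

Section CoefficientFunctional.

Context (m : nat) (t0 : R) (N : R -> vec -> mat) (Ncoef : list nat -> R -> mat) (B : nat -> R).
Context (HNser : forall t, t0 <= t -> forall (u : vec) a b, (a < m)%nat -> (b < m)%nat ->
     infinite_sum
       (fun p => lsum (multi_indices m p) (fun i => mono i u * Ncoef i t a b))
       (N t u a b)).
Context (HNcont : forall p i, In i (multi_indices m p) -> forall a b, (a < m)%nat -> (b < m)%nat ->
     cont_on (fun s => t0 <= s) (fun s => Ncoef i s a b)).
Context (HB0 : forall p, 0 <= B p).
Context (HBS : forall p, exists S : list nat -> R,
        (forall i, In i (multi_indices m p) ->
           forall t, t0 <= t -> opnorm m (Ncoef i t) <= S i) /\
        lsum (multi_indices m p) S <= B p).
Context (HBx : forall x : R, exists l, infinite_sum (fun p => B p * x ^ p) l).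

(* [NS t a b F] replaces every monomial [u ^ i] in the expansion of the entry
   [N t u a b] by the number [F i]: the values, the partial derivatives and the
   Adomian polynomials of [N] are all of this form. *)
Definition NS (t : R) (a b : nat) (F : list nat -> R) : R :=
  Series (fun p => lsum (multi_indices m p) (fun i => F i * Ncoef i t a b)).

(** The majorant of [N] is entire, so enlarging the argument by a fixed factor leaves a finite
    constant. *)
Definition Bsum (X : R) : R := Series (fun p => B p * X ^ p).

(** Geometric growth in the degree is what an entire majorant can sum: [Q] carries the smallness (a
    weight, [delta], an increment) and comes out as a factor, while [X] only changes the argument of
    [Bsum]. *)
Definition geom_bounded (F : list nat -> R) (Q X : R) : Prop :=
  0 <= Q /\ 0 <= X /\ forall p i, In i (multi_indices m p) -> Rabs (F i) <= Q * X ^ p.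

Lemma ex_series_B X : ex_series (fun p => B p * X ^ p).
Proof. destruct (HBx X) as [l Hl]; exists l; apply is_series_Reals, Hl. Qed.

Lemma Bsum_ge_0 X : 0 <= X -> 0 <= Bsum X.
Proof.
  intros HX.
  assert (H0 : forall p, 0 <= B p * X ^ p) by (intros; apply Rmult_le_pos; [apply HB0|apply pow_le, HX]).
  unfold Bsum; destruct (series_dominated (fun p => B p * X ^ p) (fun p => B p * X ^ p)) as [_ H].
  - intros p; rewrite Rabs_right; [lra|apply Rle_ge, H0].
  - apply ex_series_B.
  - pose proof (Rabs_pos (Series (fun p => B p * X ^ p))); lra.
Qed.

Lemma NS_term_bound t a b F p c :
  t0 <= t -> (a < m)%nat -> (b < m)%nat -> 0 <= c ->
  (forall i, In i (multi_indices m p) -> Rabs (F i) <= c) ->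
  Rabs (lsum (multi_indices m p) (fun i => F i * Ncoef i t a b)) <= c * B p.
Proof.
  intros Ht Ha Hb Hc HF; destruct (HBS p) as [S [HS1 HS2]].
  apply Rle_trans with (lsum (multi_indices m p) (fun i => c * S i)).
  - apply lsum_dominated; intros i Hi; rewrite Rabs_mult.
    apply Rmult_le_compat; try apply Rabs_pos; [apply HF, Hi|].
    eapply Rle_trans; [apply (entry_le_opnorm m (Ncoef i t)); assumption|apply HS1; assumption].
  - rewrite lsum_scal; apply Rmult_le_compat_l; assumption.
Qed.

Lemma NS_bound t a b F Q X :
  t0 <= t -> (a < m)%nat -> (b < m)%nat -> geom_bounded F Q X ->
  ex_series (fun p => lsum (multi_indices m p) (fun i => F i * Ncoef i t a b)) /\
  Rabs (NS t a b F) <= Q * Bsum X.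
Proof.
  intros Ht Ha Hb [HQ [HX HF]]; unfold NS, Bsum; rewrite <- Series_scal_l.
  apply series_dominated.
  - intros p; replace (Q * (B p * X ^ p)) with (Q * X ^ p * B p) by ring.
    apply NS_term_bound; try assumption; [apply Rmult_le_pos; [exact HQ|apply pow_le, HX]|].
    intros i Hi; apply HF, Hi.
  - apply ex_series_scal_R, ex_series_B.
Qed.

Lemma geom_bounded_plus F G Q X Q' X' :
  geom_bounded F Q X -> geom_bounded G Q' X' -> geom_bounded (fun i => F i + G i) (Q + Q') (Rmax X X').
Proof.
  intros [HQ [HX HF]] [HQ' [HX' HG]]; repeat split.
  - lra.
  - eapply Rle_trans; [exact HX|apply Rmax_l].
  - intros p i Hi; eapply Rle_trans; [apply Rabs_triang|].
    assert (X ^ p <= Rmax X X' ^ p) by (apply pow_incr; split; [exact HX|apply Rmax_l]).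
    assert (X' ^ p <= Rmax X X' ^ p) by (apply pow_incr; split; [exact HX'|apply Rmax_r]).
    specialize (HF p i Hi); specialize (HG p i Hi); nra.
Qed.

Lemma geom_bounded_scal c F Q X : geom_bounded F Q X -> geom_bounded (fun i => c * F i) (Rabs c * Q) X.
Proof.
  intros [HQ [HX HF]]; repeat split; [apply Rmult_le_pos; [apply Rabs_pos|exact HQ]|exact HX|].
  intros p i Hi; rewrite Rabs_mult, Rmult_assoc; apply Rmult_le_compat_l; [apply Rabs_pos|apply HF, Hi].
Qed.

Lemma NS_ext t a b F G :
  (forall p i, In i (multi_indices m p) -> F i = G i) -> NS t a b F = NS t a b G.
Proof.
  intros H; apply Series_ext; intros p; apply lsum_ext; intros i Hi; rewrite (H p i Hi); reflexivity.
Qed.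

Lemma NS_scal t a b c F : NS t a b (fun i => c * F i) = c * NS t a b F.
Proof.
  unfold NS; rewrite <- Series_scal_l; apply Series_ext; intros p.
  rewrite <- lsum_scal; apply lsum_ext; intros; ring.
Qed.

Lemma NS_plus t a b F G Q X Q' X' :
  t0 <= t -> (a < m)%nat -> (b < m)%nat -> geom_bounded F Q X -> geom_bounded G Q' X' ->
  NS t a b (fun i => F i + G i) = NS t a b F + NS t a b G.
Proof.
  intros Ht Ha Hb HF HG; unfold NS; rewrite <- Series_plus.
  - apply Series_ext; intros p; rewrite <- lsum_plus; apply lsum_ext; intros; ring.
  - apply (NS_bound t a b F Q X); assumption.
  - apply (NS_bound t a b G Q' X'); assumption.
Qed.

Lemma NS_sumn t a b n (F : nat -> list nat -> R) (z : nat -> R) Q X :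
  t0 <= t -> (a < m)%nat -> (b < m)%nat -> (forall k, (k < n)%nat -> geom_bounded (F k) Q X) ->
  (exists Q' X', geom_bounded (fun i => sumn n (fun k => F k i * z k)) Q' X') /\
  NS t a b (fun i => sumn n (fun k => F k i * z k)) = sumn n (fun k => NS t a b (F k) * z k).
Proof.
  intros Ht Ha Hb; induction n as [|n IH]; intros HF; simpl.
  - split; [exists 0, 0; repeat split; try lra; intros; rewrite Rabs_R0; lra|].
    rewrite (NS_ext t a b _ (fun i => 0 * 0)) by (intros; ring); rewrite NS_scal; ring.
  - destruct IH as [[Q' [X' Hg]] Heq]; [intros; apply HF; lia|].
    pose proof (geom_bounded_scal (z n) (F n) Q X (HF n ltac:(lia))) as Hz.
    assert (Hz' : geom_bounded (fun i => F n i * z n) (Rabs (z n) * Q) X).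
    { destruct Hz as [H1 [H2 H3]]; repeat split; try assumption.
      intros p i Hi; rewrite Rmult_comm; apply (H3 p i Hi). }
    split; [eexists; eexists; apply geom_bounded_plus; eassumption|].
    erewrite NS_plus by eassumption; rewrite Heq; f_equal.
    rewrite Rmult_comm, <- NS_scal; apply NS_ext; intros; ring.
Qed.

Lemma NS_minus t a b F G Q X Q' X' :
  t0 <= t -> (a < m)%nat -> (b < m)%nat -> geom_bounded F Q X -> geom_bounded G Q' X' ->
  NS t a b (fun i => F i - G i) = NS t a b F - NS t a b G.
Proof.
  intros Ht Ha Hb HF HG.
  rewrite (NS_ext t a b _ (fun i => F i + (-1) * G i)) by (intros; ring).
  rewrite (NS_plus t a b F (fun i => (-1) * G i) Q X (Rabs (-1) * Q') X'); try assumption.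
  - rewrite NS_scal; ring.
  - apply geom_bounded_scal, HG.
Qed.

Lemma continuity_pt_NS (F : R -> list nat -> R) a b x eta Q X :
  (a < m)%nat -> (b < m)%nat -> 0 < eta ->
  (forall p i, In i (multi_indices m p) -> continuity_pt (fun t => F t i) x) ->
  (forall t, Rabs (t - x) < eta -> geom_bounded (F t) Q X) ->
  continuity_pt (fun t => NS (Rmax t0 t) a b (F t)) x.
Proof.
  intros Ha Hb Heta Hc HF; unfold NS.
  apply (continuity_pt_Series
           (fun p t => lsum (multi_indices m p) (fun i => F t i * Ncoef i (Rmax t0 t) a b))
           (fun p => Q * (B p * X ^ p)) x eta Heta).
  - intros p; apply (continuity_pt_lsum _ (fun i t => F t i * Ncoef i (Rmax t0 t) a b)).
    intros i Hi; apply (continuity_pt_mult (fun t => F t i)); [apply (Hc p i Hi)|].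
    apply (cont_on_clamp t0 (fun t => Ncoef i t a b)), (HNcont p i Hi a b Ha Hb).
  - intros p t Ht; destruct (HF t Ht) as [HQ [HX H]].
    replace (Q * (B p * X ^ p)) with (Q * X ^ p * B p) by ring.
    apply NS_term_bound; try assumption; [apply Rmax_l| |].
    + apply Rmult_le_pos; [exact HQ|apply pow_le, HX].
    + intros i Hi; apply H, Hi.
  - apply ex_series_scal_R, ex_series_B.
Qed.

Lemma geom_bounded_wprod u K :
  0 <= K -> (forall c, (c < m)%nat -> Rabs (u c) <= K) -> geom_bounded (fun i => wprod (word 0 i) u) 1 K.
Proof.
  intros HK Hu; repeat split; [lra|exact HK|]; intros p i Hi; destruct (word_spec m p i Hi) as [Hw <-].
  rewrite Rmult_1_l; apply (wprod_bound m); assumption.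
Qed.

Lemma geom_bounded_dwprod k u K :
  1 <= K -> (forall c, (c < m)%nat -> Rabs (u c) <= K) -> geom_bounded (fun i => dwprod k (word 0 i) u) 1 (4 * K).
Proof.
  intros HK Hu; repeat split; try lra; intros p i Hi; destruct (word_spec m p i Hi) as [Hw <-].
  rewrite Rmult_1_l; eapply Rle_trans; [apply (dwprod_bound m); eassumption|apply INR_pow_le; lra].
Qed.

Lemma geom_bounded_wser v k K q :
  0 <= q -> 1 <= K -> (forall l c, (l <= k)%nat -> (c < m)%nat -> Rabs (v l c) <= K * wt q l) ->
  geom_bounded (fun i => wser (word 0 i) v k) (wt q k) (8 * K).
Proof.
  intros Hq HK Hv; repeat split; [apply wt_ge_0, Hq|lra|].
  intros p i Hi; destruct (word_spec m p i Hi) as [Hw <-].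
  rewrite Rmult_comm; apply (wser_bound m q K Hq HK _ v k); try assumption; lia.
Qed.

Lemma vec_bound_exists (u : vec) : exists K, 1 <= K /\ forall c, (c < m)%nat -> Rabs (u c) <= K.
Proof.
  exists (1 + sumn m (fun c => Rabs (u c))); split.
  - assert (0 <= sumn m (fun c => Rabs (u c))) by (apply sumn_ge_0; intros; apply Rabs_pos); lra.
  - intros c Hc.
    pose proof (sumn_term_le m (fun c => Rabs (u c)) c (fun i _ => Rabs_pos (u i)) Hc); simpl in *; lra.
Qed.

(** * Values and partial derivatives of [N] *)

Lemma N_NS t u a b :
  t0 <= t -> (a < m)%nat -> (b < m)%nat -> N t u a b = NS t a b (fun i => wprod (word 0 i) u).
Proof.
  intros Ht Ha Hb; symmetry; apply is_series_unique, is_series_Reals.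
  replace (fun p => lsum (multi_indices m p) (fun i => wprod (word 0 i) u * Ncoef i t a b))
    with (fun p => lsum (multi_indices m p) (fun i => mono i u * Ncoef i t a b)); [apply HNser; assumption|].
  apply functional_extensionality; intros p; apply lsum_ext; intros; rewrite mono_wprod; reflexivity.
Qed.

Lemma N_ext t u u' a b :
  t0 <= t -> (a < m)%nat -> (b < m)%nat -> (forall c, (c < m)%nat -> u c = u' c) -> N t u a b = N t u' a b.
Proof.
  intros Ht Ha Hb H; rewrite !N_NS by assumption; apply NS_ext; intros p i Hi.
  apply (wprod_ext m); [apply (word_spec m p i Hi)|exact H].
Qed.

Lemma N_bound t u a b K :
  t0 <= t -> (a < m)%nat -> (b < m)%nat -> 0 <= K -> (forall c, (c < m)%nat -> Rabs (u c) <= K) ->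
  Rabs (N t u a b) <= Bsum K.
Proof.
  intros Ht Ha Hb HK Hu; rewrite N_NS, <- (Rmult_1_l (Bsum K)) by assumption.
  apply NS_bound; try assumption; apply geom_bounded_wprod; assumption.
Qed.

(** The termwise partial derivative, to which the estimates for [NS] apply directly; [pderiv_dN]
    identifies it with the derivative chosen by [epsilon]. *)
Definition dN (p : nat) (t : R) (u : vec) : mat :=
  fun a b => NS t a b (fun i => dwprod p (word 0 i) u).

Lemma dN_bound p t u a b K :
  t0 <= t -> (a < m)%nat -> (b < m)%nat -> 1 <= K -> (forall c, (c < m)%nat -> Rabs (u c) <= K) ->
  Rabs (dN p t u a b) <= Bsum (4 * K).
Proof.
  intros Ht Ha Hb HK Hu; rewrite <- (Rmult_1_l (Bsum _)).
  apply NS_bound; try assumption; apply geom_bounded_dwprod; assumption.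
Qed.

Lemma N_diff_bound t u u' a b K d :
  t0 <= t -> (a < m)%nat -> (b < m)%nat -> 1 <= K -> 0 <= d ->
  (forall c, (c < m)%nat -> Rabs (u c) <= K) -> (forall c, (c < m)%nat -> Rabs (u' c) <= K) ->
  (forall c, (c < m)%nat -> Rabs (u c - u' c) <= d) ->
  Rabs (N t u a b - N t u' a b) <= d * Bsum (4 * K).
Proof.
  intros Ht Ha Hb HK Hd Hu Hu' Hdiff; rewrite !N_NS by assumption.
  rewrite <- (NS_minus t a b _ _ 1 K 1 K) by (try apply geom_bounded_wprod; try assumption; lra).
  apply NS_bound; try assumption; repeat split; try lra.
  intros p i Hi; destruct (word_spec m p i Hi) as [Hw <-].
  eapply Rle_trans; [apply (wprod_diff_bound m _ u u' K d); assumption|].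
  rewrite Rmult_comm; apply Rmult_le_compat_l; [exact Hd|apply INR_pow_le; lra].
Qed.

Lemma N_taylor_bound t u z a b K d :
  t0 <= t -> (a < m)%nat -> (b < m)%nat -> 1 <= K -> 0 <= d ->
  (forall c, (c < m)%nat -> Rabs (u c) <= K) -> (forall c, (c < m)%nat -> Rabs (u c + z c) <= K) ->
  (forall c, (c < m)%nat -> Rabs (z c) <= d) ->
  Rabs (N t (fun c => u c + z c) a b - N t u a b - sumn m (fun p => dN p t u a b * z p))
    <= d * d * Bsum (4 * K).
Proof.
  intros Ht Ha Hb HK Hd Hu Hu' Hz; rewrite !N_NS by assumption.
  destruct (NS_sumn t a b m (fun p i => dwprod p (word 0 i) u) z 1 (4 * K)) as [[Q' [X' Hg]] Heq]; try assumption.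
  { intros p _; apply geom_bounded_dwprod; assumption. }
  unfold dN; rewrite <- Heq.
  pose proof (geom_bounded_wprod (fun c => u c + z c) K ltac:(lra) Hu') as G1.
  pose proof (geom_bounded_wprod u K ltac:(lra) Hu) as G2.
  rewrite <- (NS_minus t a b _ _ _ _ _ _ Ht Ha Hb G1 G2).
  assert (G3 : exists Q X, geom_bounded (fun i => wprod (word 0 i) (fun c => u c + z c) - wprod (word 0 i) u) Q X).
  { pose proof (geom_bounded_plus _ _ _ _ _ _ G1 (geom_bounded_scal (-1) _ _ _ G2)) as [H1 [H2 H3]].
    exists (1 + Rabs (-1) * 1), (Rmax K K); repeat split; try assumption.
    intros p i Hi; unfold Rminus; replace (- wprod (word 0 i) u) with ((-1) * wprod (word 0 i) u) by ring.
    apply (H3 p i Hi). }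
  destruct G3 as [Q3 [X3 G3]].
  rewrite <- (NS_minus t a b _ _ _ _ _ _ Ht Ha Hb G3 Hg).
  apply NS_bound; try assumption; repeat split; try nra.
  intros p i Hi; destruct (word_spec m p i Hi) as [Hw <-].
  eapply Rle_trans; [apply (wprod_taylor_bound m _ u z K d); assumption|].
  rewrite Rmult_comm; apply Rmult_le_compat_l; [nra|apply INR_sqr_pow_le; lra].
Qed.

(** Derivatives along lines serve two purposes: a coordinate direction yields [pderiv], and the
    segment between two states yields monotonicity. *)
Lemma derivable_N_line t u z a b s :
  t0 <= t -> (a < m)%nat -> (b < m)%nat ->
  derivable_pt_lim (fun s => N t (fun c => u c + s * z c) a b) s
    (sumn m (fun p => dN p t (fun c => u c + s * z c) a b * z p)).
Proof.
  intros Ht Ha Hb.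
  destruct (vec_bound_exists z) as [Z [HZ1 HZ]].
  destruct (vec_bound_exists (fun c => u c + s * z c)) as [K [HK1 HK]].
  apply (derivable_pt_lim_quadratic _ _ _ (Z * Z * Bsum (4 * (K + Z)))).
  intros h Hh.
  replace (N t (fun c => u c + (s + h) * z c) a b)
    with (N t (fun c => (fun c => u c + s * z c) c + (fun c => h * z c) c) a b).
  2: { apply N_ext; try assumption; intros; ring. }
  rewrite <- sumn_scal.
  rewrite (sumn_ext m _ (fun p => dN p t (fun c => u c + s * z c) a b * (fun c => h * z c) p)) by (intros; ring).
  replace (Z * Z * Bsum (4 * (K + Z)) * (h * h)) with (Rabs h * Z * (Rabs h * Z) * Bsum (4 * (K + Z))).
  2: { replace (h * h) with (Rabs h * Rabs h); [ring|]; rewrite <- Rabs_mult; apply Rabs_right; nra. }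
  pose proof (Rabs_pos h).
  apply N_taylor_bound; try assumption; try lra; try nra.
  - intros c Hc; specialize (HK c Hc); simpl in *; lra.
  - intros c Hc; eapply Rle_trans; [apply Rabs_triang|]; rewrite (Rabs_mult h).
    specialize (HK c Hc); specialize (HZ c Hc); pose proof (Rabs_pos (z c)); simpl in *; nra.
  - intros c Hc; rewrite Rabs_mult; apply Rmult_le_compat_l; [assumption|apply HZ, Hc].
Qed.

Lemma pderiv_dN p t u a b :
  t0 <= t -> (a < m)%nat -> (b < m)%nat -> (p < m)%nat -> pderiv N p t u a b = dN p t u a b.
Proof.
  intros Ht Ha Hb Hp; unfold pderiv; apply Rderiv_unique.
  set (e := fun c => if Nat.eqb c p then 1 else 0 : R).
  pose proof (derivable_N_line t u e a b 0 Ht Ha Hb) as H.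
  replace (fun c => u c + 0 * e c) with u in H by (apply functional_extensionality; intros; ring).
  rewrite (sumn_ext m _ (fun k => if Nat.eqb k p then dN k t u a b else 0)) in H.
  2: { intros k _; unfold e; destruct (Nat.eqb k p); ring. }
  rewrite (sumn_delta m p (fun k => dN k t u a b) Hp) in H.
  replace (fun s => N t (fun c => if Nat.eqb c p then u c + s else u c) a b)
    with (fun s => N t (fun c => u c + s * e c) a b); [exact H|].
  apply functional_extensionality; intros s; f_equal; apply functional_extensionality; intros c.
  unfold e; destruct (Nat.eqb c p); ring.
Qed.

(** * Adomian polynomials *)

(** The sums over the degree [p] and the order [n] are exchanged, with the product majorant
    [B p * (8 * K) ^ p * wt q n]. *)
Lemma is_series_NS_wser t a b v q K :
  t0 <= t -> (a < m)%nat -> (b < m)%nat -> 0 <= q <= 1 -> 1 <= K ->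
  (forall l c, (c < m)%nat -> Rabs (v l c) <= K * wt q l) ->
  is_series (fun n => NS t a b (fun i => wser (word 0 i) v n)) (N t (fun c => Series (fun l => v l c)) a b).
Proof.
  intros Ht Ha Hb Hq HK Hv; rewrite N_NS by assumption; unfold NS.
  set (F := fun p n => lsum (multi_indices m p) (fun i => wser (word 0 i) v n * Ncoef i t a b)).
  replace (Series (fun p => lsum (multi_indices m p)
             (fun i => wprod (word 0 i) (fun c => Series (fun l => v l c)) * Ncoef i t a b)))
    with (Series (fun p => Series (F p))).
  - apply (double_series_exchange F (fun p => B p * (8 * K) ^ p) (wt q)).
    + intros p n; unfold F.
      replace (B p * (8 * K) ^ p * wt q n) with ((8 * K) ^ p * wt q n * B p) by ring.
      apply NS_term_bound; try assumption.
      * apply Rmult_le_pos; [apply pow_le; lra|apply wt_ge_0; lra].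
      * intros i Hi; destruct (word_spec m p i Hi) as [Hw <-].
        apply (wser_bound m q K ltac:(lra) HK _ v n Hw); [intros; apply Hv; assumption|lia].
    + intros p; apply Rmult_le_pos; [apply HB0|apply pow_le; lra].
    + intros n; apply wt_ge_0; lra.
    + apply ex_series_B.
    + apply ex_series_wt, Hq.
  - apply Series_ext; intros p; apply is_series_unique; unfold F.
    apply (is_series_lsum _ (fun i n => wser (word 0 i) v n * Ncoef i t a b)).
    intros i Hi; apply is_series_scal_r.
    apply (is_series_wser m q K); try assumption; try lra; apply (word_spec m p i Hi).
Qed.

(** [Rderivn] differentiates a function again and again, so each derivative must be known at every
    point before the next [epsilon] is determined; an infinite radius of convergence ensures
    this. *)
Lemma Rderivn_PSeries (al : nat -> R) k :
  (forall x : R, Rbar_lt (Rabs x) (CV_radius al)) -> Rderivn k (PSeries al) = Derive_n (PSeries al) k.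
Proof.
  intros H; induction k as [|k IH]; simpl; [reflexivity|].
  rewrite IH; apply functional_extensionality; intros x.
  apply Rderiv_unique, is_derive_Reals, Derive_correct.
  exact (ex_derive_n_PSeries (S k) al x (H x)).
Qed.

Lemma truncated_bound_exists (v : nat -> vec) k :
  exists K, 1 <= K /\ forall l c, (l <= k)%nat -> (c < m)%nat -> Rabs (v l c) <= K.
Proof.
  induction k as [|k [K [HK1 HK]]].
  - destruct (vec_bound_exists (v 0%nat)) as [K [HK1 HK]]; exists K; split; [exact HK1|].
    intros l c Hl Hc; replace l with 0%nat by lia; apply HK, Hc.
  - destruct (vec_bound_exists (v (S k))) as [K' [HK1' HK']]; exists (K + K'); split; [lra|].
    intros l c Hl Hc; destruct (Nat.eq_dec l (S k)) as [->|Hne].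
    + specialize (HK' c Hc); lra.
    + specialize (HK l c ltac:(lia) Hc); lra.
Qed.

(** Lets any bound on finitely many orders be written in the weighted form, at the price of the
    constant (k+1)^2. *)
Lemma wt1_ge l k : (l <= k)%nat -> 1 <= (INR k + 1) ^ 2 * wt 1 l.
Proof.
  intros Hl; unfold wt; rewrite pow1, Rmult_1_l; apply le_INR in Hl; pose proof (pos_INR l).
  apply Rmult_le_reg_r with ((INR l + 1) ^ 2); [apply pow_lt; lra|].
  rewrite Rmult_1_l, Rmult_assoc, Rinv_l by (apply pow_nonzero; lra); rewrite Rmult_1_r.
  apply pow_incr; lra.
Qed.

(** The function of [tau] that is differentiated equals an everywhere convergent power series, and
    [adomian] extracts its Taylor coefficient of order [k]. *)
Lemma adomian_NS t v k a b :
  t0 <= t -> (a < m)%nat -> (b < m)%nat ->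
  adomian (N t) k v a b = NS t a b (fun i => wser (word 0 i) v k).
Proof.
  intros Ht Ha Hb.
  (* The polynomial in [tau] stops at order [k]; cutting [v] off there lets it be read as an
     infinite series without changing the coefficient of order [k]. *)
  set (v' := fun l c => if Nat.leb l k then v l c else 0 : R).
  set (al := fun n => NS t a b (fun i => wser (word 0 i) v' n)).
  destruct (truncated_bound_exists v k) as [K0 [HK01 HK0]].
  set (Kt := fun tau : R => K0 * (1 + Rabs tau) ^ k * (INR k + 1) ^ 2).
  assert (HKt : forall tau, 1 <= Kt tau).
  { intros tau; unfold Kt; pose proof (pos_INR k); pose proof (Rabs_pos tau).
    assert (1 <= (1 + Rabs tau) ^ k) by (apply pow_R1_Rle; lra).
    assert (1 <= (INR k + 1) ^ 2) by (apply pow_R1_Rle; lra).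
    assert (1 <= K0 * (1 + Rabs tau) ^ k) by nra; nra. }
  assert (Hb' : forall tau l c, (c < m)%nat -> Rabs (tau ^ l * v' l c) <= Kt tau * wt 1 l).
  { intros tau l c Hc; unfold v'; destruct (Nat.leb_spec l k) as [Hl|Hl].
    - rewrite Rabs_mult, <- RPow_abs; pose proof (Rabs_pos tau); unfold Kt.
      assert (Rabs tau ^ l <= (1 + Rabs tau) ^ k).
      { apply Rle_trans with ((1 + Rabs tau) ^ l); [apply pow_incr; lra|apply Rle_pow; [lra|exact Hl]]. }
      assert (Rabs tau ^ l * Rabs (v l c) <= (1 + Rabs tau) ^ k * K0).
      { apply Rmult_le_compat; try apply Rabs_pos; [apply pow_le, Rabs_pos|assumption|apply HK0; assumption]. }
      pose proof (wt1_ge l k Hl).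
      assert (0 <= (1 + Rabs tau) ^ k * K0) by (apply Rmult_le_pos; [apply pow_le; lra|lra]).
      replace (K0 * (1 + Rabs tau) ^ k * (INR k + 1) ^ 2 * wt 1 l)
        with ((1 + Rabs tau) ^ k * K0 * ((INR k + 1) ^ 2 * wt 1 l)) by ring.
      nra.
    - rewrite Rmult_0_r, Rabs_R0; apply Rmult_le_pos; [|apply wt_ge_0; lra].
      specialize (HKt tau); lra. }
  assert (Hal : forall tau n, NS t a b (fun i => wser (word 0 i) (fun l c => tau ^ l * v' l c) n) = tau ^ n * al n).
  { intros tau n; unfold al; rewrite <- NS_scal; apply NS_ext; intros; apply wser_scale. }
  assert (Hf : (fun tau => N t (fun c => sum_f_R0 (fun i => tau ^ i * v i c) k) a b) = PSeries al).
  { apply functional_extensionality; intros tau; symmetry; apply is_pseries_unique, is_pseries_R.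
    pose proof (is_series_NS_wser t a b _ 1 (Kt tau) Ht Ha Hb ltac:(lra) (HKt tau) (Hb' tau)) as Hs.
    replace (fun n => al n * tau ^ n)
      with (fun n => NS t a b (fun i => wser (word 0 i) (fun l c => tau ^ l * v' l c) n)).
    2: { apply functional_extensionality; intros n; rewrite Hal; ring. }
    replace (fun c => sum_f_R0 (fun i => tau ^ i * v i c) k)
      with (fun c => Series (fun l => tau ^ l * v' l c)); [exact Hs|].
    apply functional_extensionality; intros c; apply is_series_unique.
    replace (sum_f_R0 (fun i => tau ^ i * v i c) k) with (sum_f_R0 (fun i => tau ^ i * v' i c) k).
    - apply is_series_finite; intros n Hn; unfold v'; destruct (Nat.leb_spec n k); [lia|ring].
    - apply sum_eq; intros n Hn; unfold v'; destruct (Nat.leb_spec n k); [reflexivity|lia]. }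
  (* The terms of the series are bounded at the point [Rabs x + 1], so the radius of convergence
     exceeds [Rabs x]. *)
  assert (Hcv : forall x : R, Rbar_lt (Rabs x) (CV_radius al)).
  { intros x; apply Rbar_lt_le_trans with (Finite (Rabs x + 1)); [simpl; lra|].
    apply CV_radius_bounded; exists (Bsum (8 * Kt (Rabs x + 1))); intros n.
    rewrite Rmult_comm, <- Hal.
    eapply Rle_trans; [apply (NS_bound t a b _ (wt 1 n) (8 * Kt (Rabs x + 1)) Ht Ha Hb)|].
    - apply geom_bounded_wser; [lra|apply HKt|]; intros; apply Hb'; assumption.
    - assert (wt 1 n <= 1).
      { unfold wt; rewrite pow1, Rmult_1_l, <- Rinv_1; apply Rinv_le_contravar; [lra|].
        apply pow_R1_Rle; pose proof (pos_INR n); lra. }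
      assert (0 <= Bsum (8 * Kt (Rabs x + 1))) by (apply Bsum_ge_0; specialize (HKt (Rabs x + 1)); lra).
      nra. }
  unfold adomian; rewrite Hf, Rderivn_PSeries, Derive_n_coef by (try exact Hcv; pose proof (Hcv 0) as H0; rewrite Rabs_R0 in H0; exact H0).
  replace (/ INR (fact k) * (al k * INR (fact k))) with (al k) by (field; apply INR_fact_neq_0).
  unfold al; apply NS_ext; intros p i Hi; apply (wser_ext m); [apply (word_spec m p i Hi)|].
  intros l c Hl _; unfold v'; destruct (Nat.leb_spec l k); [reflexivity|lia].
Qed.

Lemma adomian_bound t v k a b q K :
  t0 <= t -> (a < m)%nat -> (b < m)%nat -> 0 <= q -> 1 <= K ->
  (forall l c, (l <= k)%nat -> (c < m)%nat -> Rabs (v l c) <= K * wt q l) ->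
  Rabs (adomian (N t) k v a b) <= wt q k * Bsum (8 * K).
Proof.
  intros Ht Ha Hb Hq HK Hv; rewrite adomian_NS by assumption.
  apply NS_bound; try assumption; apply geom_bounded_wser; assumption.
Qed.

Lemma adomian_bound_pos t v k a b q K delta :
  t0 <= t -> (a < m)%nat -> (b < m)%nat -> 0 <= q -> 1 <= K -> 0 <= delta -> (1 <= k)%nat ->
  (forall l c, (l <= k)%nat -> (c < m)%nat -> Rabs (v l c) <= K * wt q l) ->
  (forall l c, (1 <= l <= k)%nat -> (c < m)%nat -> Rabs (v l c) <= delta * wt q l) ->
  Rabs (adomian (N t) k v a b) <= delta * wt q k * Bsum (4 * (8 * K)).
Proof.
  intros Ht Ha Hb Hq HK Hdelta Hk Hv Hv1; rewrite adomian_NS by assumption.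
  pose proof (wt_ge_0 q k Hq).
  apply NS_bound; try assumption; repeat split; [nra|lra|].
  intros p i Hi; destruct (word_spec m p i Hi) as [Hw <-].
  eapply Rle_trans; [apply (wser_bound_pos m q K Hq HK _ v k delta); try assumption; lia|].
  pose proof (INR_pow_le (8 * K) (length (word 0 i)) ltac:(lra)).
  replace (_ * _ * delta * wt q k) with (delta * wt q k * (INR (length (word 0 i)) * (8 * K) ^ length (word 0 i))) by ring.
  apply Rmult_le_compat_l; [nra|assumption].
Qed.

Lemma adomian_bound_quadratic t v k a b q K delta :
  t0 <= t -> (a < m)%nat -> (b < m)%nat -> 0 <= q -> 1 <= K -> 0 <= delta -> (1 <= k)%nat ->
  (forall l c, (l <= k)%nat -> (c < m)%nat -> Rabs (v l c) <= K * wt q l) ->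
  (forall l c, (1 <= l <= k)%nat -> (c < m)%nat -> Rabs (v l c) <= delta * wt q l) ->
  (forall c, (c < m)%nat -> v k c = 0) ->
  Rabs (adomian (N t) k v a b) <= delta * delta * wt q k * Bsum (4 * (8 * K)).
Proof.
  intros Ht Ha Hb Hq HK Hdelta Hk Hv Hv1 Hvk; rewrite adomian_NS by assumption.
  pose proof (wt_ge_0 q k Hq).
  assert (0 <= delta * delta * wt q k) by (apply Rmult_le_pos; [nra|assumption]).
  apply NS_bound; try assumption; repeat split; [assumption|lra|].
  intros p i Hi; destruct (word_spec m p i Hi) as [Hw <-].
  eapply Rle_trans; [apply (wser_bound_quadratic m q K Hq HK _ v k delta); assumption|].
  pose proof (INR_sqr_pow_le (8 * K) (length (word 0 i)) ltac:(lra)).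
  replace (_ * _ * (delta * delta) * wt q k)
    with (delta * delta * wt q k * (INR (length (word 0 i)) ^ 2 * (8 * K) ^ length (word 0 i))) by ring.
  apply Rmult_le_compat_l; assumption.
Qed.

Lemma adomian_diff_bound t v v' k a b q K d :
  t0 <= t -> (a < m)%nat -> (b < m)%nat -> 0 <= q -> 1 <= K -> 0 <= d ->
  (forall l c, (l <= k)%nat -> (c < m)%nat -> Rabs (v l c) <= K * wt q l) ->
  (forall l c, (l <= k)%nat -> (c < m)%nat -> Rabs (v' l c) <= K * wt q l) ->
  (forall l c, (l <= k)%nat -> (c < m)%nat -> Rabs (v l c - v' l c) <= d * wt q l) ->
  Rabs (adomian (N t) k v a b - adomian (N t) k v' a b) <= d * wt q k * Bsum (4 * (8 * K)).
Proof.
  intros Ht Ha Hb Hq HK Hd Hv Hv' Hdiff; rewrite !adomian_NS by assumption.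
  pose proof (wt_ge_0 q k Hq).
  rewrite <- (NS_minus t a b _ _ (wt q k) (8 * K) (wt q k) (8 * K))
    by (try apply geom_bounded_wser; assumption).
  apply NS_bound; try assumption; repeat split; [nra|lra|].
  intros p i Hi; destruct (word_spec m p i Hi) as [Hw <-].
  eapply Rle_trans; [apply (wser_diff_bound m q K Hq HK _ v v' k d); try assumption; lia|].
  pose proof (INR_pow_le (8 * K) (length (word 0 i)) ltac:(lra)).
  replace (_ * _ * d * wt q k) with (d * wt q k * (INR (length (word 0 i)) * (8 * K) ^ length (word 0 i))) by ring.
  apply Rmult_le_compat_l; [nra|assumption].
Qed.

Lemma adomian_ext t v v' k a b :
  t0 <= t -> (a < m)%nat -> (b < m)%nat ->
  (forall l c, (l <= k)%nat -> (c < m)%nat -> v l c = v' l c) ->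
  adomian (N t) k v a b = adomian (N t) k v' a b.
Proof.
  intros Ht Ha Hb H; rewrite !adomian_NS by assumption; apply NS_ext; intros p i Hi.
  apply (wser_ext m); [apply (word_spec m p i Hi)|exact H].
Qed.

Lemma adomian_0 t v a b :
  t0 <= t -> (a < m)%nat -> (b < m)%nat -> adomian (N t) 0 v a b = N t (v 0%nat) a b.
Proof.
  intros Ht Ha Hb; rewrite adomian_NS, N_NS by assumption; apply NS_ext; intros; apply wser_0.
Qed.

Lemma weighted_bound_exists (v : nat -> vec) k :
  exists K, 1 <= K /\ forall l c, (l <= k)%nat -> (c < m)%nat -> Rabs (v l c) <= K * wt 1 l.
Proof.
  destruct (truncated_bound_exists v k) as [K0 [HK1 HK]].
  exists (K0 * (INR k + 1) ^ 2); pose proof (pos_INR k); split.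
  - assert (1 <= (INR k + 1) ^ 2) by (apply pow_R1_Rle; lra); nra.
  - intros l c Hl Hc; specialize (HK l c Hl Hc); pose proof (wt1_ge l k Hl).
    rewrite Rmult_assoc; nra.
Qed.

(** Applied to node values, this reunites the bracket in the equation of u^(j) with the last term of
    [F]: together they form the full Adomian polynomial of order [j]. *)
Lemma adomian_linear_part t (v v' : nat -> vec) k a b :
  t0 <= t -> (a < m)%nat -> (b < m)%nat -> (1 <= k)%nat ->
  (forall l c, (l < k)%nat -> v' l c = v l c) -> (forall c, v' k c = 0) ->
  adomian (N t) k v a b
  = adomian (N t) k v' a b + sumn m (fun c => pderiv N c t (v 0%nat) a b * v k c).
Proof.
  intros Ht Ha Hb Hk Hlt Hkk; rewrite !adomian_NS by assumption.
  destruct (weighted_bound_exists v' k) as [K [HK1 HK]].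
  destruct (vec_bound_exists (v 0%nat)) as [K0 [HK01 HK0]].
  destruct (NS_sumn t a b m (fun p i => dwprod p (word 0 i) (v 0%nat)) (v k) 1 (4 * K0)) as [[Q' [X' Hg]] Heq];
    try assumption.
  { intros p _; apply geom_bounded_dwprod; assumption. }
  rewrite (sumn_ext m (fun c => pderiv N c t (v 0%nat) a b * v k c) (fun c => dN c t (v 0%nat) a b * v k c)).
  2: { intros c Hc; rewrite pderiv_dN by assumption; reflexivity. }
  unfold dN; rewrite <- Heq.
  rewrite <- (NS_plus t a b _ _ (wt 1 k) (8 * K) Q' X'); try assumption.
  - apply NS_ext; intros p i Hi; apply (wser_linear_part m); try assumption; apply (word_spec m p i Hi).
  - apply geom_bounded_wser; try assumption; lra.
Qed.

Lemma is_series_adomian t a b v q K :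
  t0 <= t -> (a < m)%nat -> (b < m)%nat -> 0 <= q <= 1 -> 1 <= K ->
  (forall l c, (c < m)%nat -> Rabs (v l c) <= K * wt q l) ->
  is_series (fun n => adomian (N t) n v a b) (N t (fun c => Series (fun l => v l c)) a b).
Proof.
  intros Ht Ha Hb Hq HK Hv.
  replace (fun n => adomian (N t) n v a b) with (fun n => NS t a b (fun i => wser (word 0 i) v n)).
  - apply (is_series_NS_wser t a b v q K); assumption.
  - apply functional_extensionality; intros n; rewrite adomian_NS by assumption; reflexivity.
Qed.

(** * Continuity in time *)

Lemma locally_weighted_bounded (v : R -> nat -> vec) k x :
  (forall l c, (l <= k)%nat -> (c < m)%nat -> continuity_pt (fun t => v t l c) x) ->
  exists K eta, 0 < eta /\ 1 <= K /\ forall t, Rabs (t - x) < eta ->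
    forall l c, (l <= k)%nat -> (c < m)%nat -> Rabs (v t l c) <= K * wt 1 l.
Proof.
  intros H.
  assert (Hk : exists K eta, 0 < eta /\ 1 <= K /\ forall t, Rabs (t - x) < eta ->
    forall l c, (l <= k)%nat -> (c < m)%nat -> Rabs (v t l c) <= K).
  { induction k as [|k IH].
    - destruct (locally_bounded (fun c t => v t 0%nat c) m x) as [K [eta [He [HK Hb]]]]; [intros; apply H; lia|].
      exists K, eta; repeat split; try assumption.
      intros t Ht l c Hl Hc; replace l with 0%nat by lia; apply (Hb t Ht c Hc).
    - destruct IH as [K [eta [He [HK Hb]]]]; [intros; apply H; lia|].
      destruct (locally_bounded (fun c t => v t (S k) c) m x) as [K' [eta' [He' [HK' Hb']]]]; [intros; apply H; lia|].
      exists (K + K'), (Rmin eta eta'); repeat split; [apply Rmin_pos; assumption|lra|].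
      intros t Ht l c Hl Hc; destruct (Nat.eq_dec l (S k)) as [->|Hne].
      + specialize (Hb' t (Rlt_le_trans _ _ _ Ht (Rmin_r _ _)) c Hc); simpl in Hb'; lra.
      + specialize (Hb t (Rlt_le_trans _ _ _ Ht (Rmin_l _ _)) l c ltac:(lia) Hc); lra. }
  destruct Hk as [K [eta [He [HK Hb]]]].
  exists (K * (INR k + 1) ^ 2), eta; pose proof (pos_INR k); repeat split; [assumption| |].
  - assert (1 <= (INR k + 1) ^ 2) by (apply pow_R1_Rle; lra); nra.
  - intros t Ht l c Hl Hc; specialize (Hb t Ht l c Hl Hc); pose proof (wt1_ge l k Hl).
    rewrite Rmult_assoc; nra.
Qed.

Lemma continuity_pt_adomian (v : R -> nat -> vec) k a b x :
  (a < m)%nat -> (b < m)%nat ->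
  (forall l c, (l <= k)%nat -> (c < m)%nat -> continuity_pt (fun t => v t l c) x) ->
  continuity_pt (fun t => adomian (N (Rmax t0 t)) k (v t) a b) x.
Proof.
  intros Ha Hb H.
  apply (continuity_pt_ext_all (fun t => NS (Rmax t0 t) a b (fun i => wser (word 0 i) (v t) k))).
  { intros t; rewrite adomian_NS; [reflexivity|apply Rmax_l|assumption|assumption]. }
  destruct (locally_weighted_bounded v k x H) as [K [eta [He [HK Hbd]]]].
  apply (continuity_pt_NS (fun t i => wser (word 0 i) (v t) k) a b x eta (wt 1 k) (8 * K)); try assumption.
  - intros p i Hi; apply (continuity_pt_wser m); [apply (word_spec m p i Hi)|exact H].
  - intros t Ht; apply geom_bounded_wser; [lra|exact HK|apply Hbd, Ht].
Qed.

Lemma continuity_pt_N (u : R -> vec) a b x :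
  (a < m)%nat -> (b < m)%nat -> (forall c, (c < m)%nat -> continuity_pt (fun t => u t c) x) ->
  continuity_pt (fun t => N (Rmax t0 t) (u t) a b) x.
Proof.
  intros Ha Hb H.
  apply (continuity_pt_ext_all (fun t => adomian (N (Rmax t0 t)) 0 (fun _ => u t) a b)).
  - intros t; apply adomian_0; [apply Rmax_l|assumption|assumption].
  - apply (continuity_pt_adomian (fun t _ => u t)); try assumption; intros; apply H; assumption.
Qed.

Lemma continuity_pt_pderiv p w a b x :
  (a < m)%nat -> (b < m)%nat -> (p < m)%nat -> continuity_pt (fun t => pderiv N p (Rmax t0 t) w a b) x.
Proof.
  intros Ha Hb Hp; destruct (vec_bound_exists w) as [K [HK1 HK]].
  apply (continuity_pt_ext_all (fun t => dN p (Rmax t0 t) w a b)).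
  { intros t; symmetry; apply pderiv_dN; try assumption; apply Rmax_l. }
  apply (continuity_pt_NS (fun _ i => dwprod p (word 0 i) w) a b x 1 1 (4 * K)); try assumption; try lra.
  - intros; apply continuity_pt_const; intros ? ?; reflexivity.
  - intros; apply geom_bounded_dwprod; assumption.
Qed.

(** * Strong monotonicity *)

Context (alpha : R) (HJ : forall t, t0 <= t -> forall u v : vec,
     dot m v (matvec m (Jac m N t u) v) <= - alpha * dot m v v).

(** [Jac] is the Jacobian of [u -> N(t,u) u]. The mean value theorem for the scalar function [g] on
    the segment from [w] to [w + v] reduces the claim to hypothesis 3 at one intermediate point. *)
Lemma N_monotone t w v :
  t0 <= t ->
  dot m v (fun a => matvec m (N t (fun c => w c + v c)) (fun c => w c + v c) a - matvec m (N t w) w a)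
    <= - alpha * dot m v v.
Proof.
  intros Ht.
  set (u := fun s c => w c + s * v c).
  set (g := fun s => sumn m (fun a => v a * sumn m (fun b => N t (u s) a b * u s b))).
  set (dg := fun s => sumn m (fun a => v a * sumn m (fun b =>
     sumn m (fun p => dN p t (u s) a b * v p) * u s b + N t (u s) a b * v b))).
  assert (Hd : forall s, derivable_pt_lim g s (dg s)).
  { intros s; apply (derivable_pt_lim_sumn m (fun a s => v a * sumn m (fun b => N t (u s) a b * u s b))).
    intros a Ha; apply (derivable_pt_lim_scal (fun s => sumn m (fun b => N t (u s) a b * u s b))).
    apply (derivable_pt_lim_sumn m (fun b s => N t (u s) a b * u s b)); intros b Hb.
    apply (derivable_pt_lim_mult (fun s => N t (u s) a b) (fun s => u s b)).
    - apply derivable_N_line; assumption.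
    - unfold u; apply is_derive_Reals; auto_derive; [exact I|ring]. }
  destruct (MVT_open g dg 0 1 ltac:(lra)) as [s [Hs Heq]].
  { intros; apply Hd. }
  { intros; eapply derivable_pt_lim_continuity_pt, Hd. }
  assert (Hdg : dg s = dot m v (matvec m (Jac m N t (u s)) v)).
  { apply sumn_ext; intros a Ha; f_equal; unfold matvec, Jac.
    rewrite (sumn_ext m (fun b => _ * v b)
      (fun b => N t (u s) a b * v b + sumn m (fun c => dN b t (u s) a c * u s c * v b))).
    2: { intros b Hb; unfold matvec; rewrite Rmult_plus_distr_r; f_equal.
         rewrite Rmult_comm, <- sumn_scal; apply sumn_ext; intros c Hc.
         rewrite pderiv_dN by assumption; ring. }
    rewrite !sumn_plus, (sumn_exchange m m (fun b c => dN b t (u s) a c * u s c * v b)), Rplus_comm; f_equal.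
    apply sumn_ext; intros b Hb; rewrite Rmult_comm, <- sumn_scal; apply sumn_ext; intros; ring. }
  specialize (HJ t Ht (u s) v); rewrite <- Hdg in HJ.
  replace (dot m v _) with (g 1 - g 0); [rewrite Heq; lra|].
  unfold g, dot; rewrite <- sumn_minus; apply sumn_ext; intros a Ha; unfold matvec.
  rewrite <- Rmult_minus_distr_l; f_equal; f_equal; apply sumn_ext; intros b Hb; unfold u; f_equal;
    try ring; apply N_ext; try assumption; intros; ring.
Qed.

(** The field [N(t,u) u] vanishes at [u = 0], so this is monotonicity relative to the origin. *)
Lemma N_dissipative t v : t0 <= t -> dot m v (matvec m (N t v) v) <= - alpha * dot m v v.
Proof.
  intros Ht; eapply Rle_trans; [|apply (N_monotone t zerov v Ht)].
  apply Req_le, sumn_ext; intros a Ha; f_equal.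
  replace (matvec m (N t zerov) zerov a) with 0.
  2: { symmetry; apply sumn_0; intros; unfold zerov; ring. }
  rewrite Rminus_0_r; apply sumn_ext; intros b Hb; unfold zerov; f_equal; [|ring].
  apply N_ext; try assumption; intros; ring.
Qed.

(** * Existence of the FD sequence *)

Lemma grid_le t1 g i k : is_grid t1 g -> (i <= k)%nat -> g i <= g k.
Proof.
  intros [_ [Hg _]] H; induction H as [|k H IH]; [lra|]; specialize (Hg k); lra.
Qed.

Lemma grid_ge t1 g i : is_grid t1 g -> t1 <= g i.
Proof. intros Hg; rewrite <- (proj1 Hg); apply (grid_le t1); [exact Hg|lia]. Qed.

Lemma grid_locate t1 g t : is_grid t1 g -> t1 <= t -> exists i, g i <= t < g (S i).
Proof.
  intros [H0 [Hg Hinf]] Ht; destruct (Hinf t) as [n Hn].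
  induction n as [|n IH]; [rewrite H0 in Hn; lra|].
  destruct (Rlt_or_le t (g n)) as [Hlt|Hle]; [apply IH, Hlt|exists n; split; assumption].
Qed.

Lemma grid_locate_unique t1 g t i k : is_grid t1 g -> g i <= t < g (S i) -> g k <= t < g (S k) -> i = k.
Proof.
  intros Hg Hi Hk; destruct (Nat.lt_trichotomy i k) as [H|[H|H]]; [exfalso|exact H|exfalso].
  - pose proof (grid_le t1 g (S i) k Hg H); lra.
  - pose proof (grid_le t1 g (S k) i Hg H); lra.
Qed.

Lemma cont_on_glue t1 g f :
  is_grid t1 g -> (forall i, cont_on (fun s => g i <= s <= g (S i)) f) -> cont_on (fun s => t1 <= s) f.
Proof.
  intros Hg H x Hx eps Heps.
  destruct (grid_locate t1 g x Hg Hx) as [i Hi].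
  destruct (H i x ltac:(lra) eps Heps) as [d [Hd0 Hd]]; simpl in *; unfold Rdist in *.
  assert (Hleft : exists d', 0 < d' /\ forall y, t1 <= y -> y < g i -> Rabs (y - x) < d' -> Rabs (f y - f x) < eps).
  { destruct i as [|k].
    - exists 1; split; [lra|]; intros y Hy Hyg; destruct Hg as [Hg _]; rewrite Hg in Hyg; lra.
    - destruct (Req_dec x (g (S k))) as [Hxg|Hxg].
      + assert (Hk : g k < g (S k)) by apply Hg.
        destruct (H k x ltac:(lra) eps Heps) as [d' [Hd0' Hd']]; simpl in *; unfold Rdist in *.
        exists (Rmin d' (x - g k)); split; [apply Rmin_pos; lra|].
        intros y Hy Hyg Hyd; apply Hd'.
        pose proof (Rlt_le_trans _ _ _ Hyd (Rmin_l _ _)); pose proof (Rlt_le_trans _ _ _ Hyd (Rmin_r _ _)) as H2.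
        apply Rabs_def2 in H2; repeat split; lra.
      + exists (x - g (S k)); split; [lra|]; intros y Hy Hyg Hyd; apply Rabs_def2 in Hyd; lra. }
  destruct Hleft as [d' [Hd0' Hd']].
  exists (Rmin d (Rmin d' (g (S i) - x))); split; [repeat apply Rmin_pos; lra|].
  intros y [Hy Hyd].
  pose proof (Rlt_le_trans _ _ _ Hyd (Rmin_l _ _)) as H1.
  pose proof (Rlt_le_trans _ _ _ Hyd (Rmin_r _ _)) as H23.
  pose proof (Rlt_le_trans _ _ _ H23 (Rmin_l _ _)) as H2.
  pose proof (Rlt_le_trans _ _ _ H23 (Rmin_r _ _)) as H3.
  destruct (Rlt_or_le y (g i)) as [Hyg|Hyg]; [apply Hd'; assumption|].
  apply Hd; apply Rabs_def2 in H3; repeat split; try lra.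
Qed.

Context (phi : R -> vec) (u0 : vec).
Context (Hphic : forall c, (c < m)%nat -> cont_on (fun s => t0 <= s) (fun s => phi s c)).

(** Order [j] enters its own right-hand side only through the node value. On each interval the
    equation is therefore linear with a known source, and it can be solved interval by interval. *)
Lemma FD_rhs_ext g V V' j i t c :
  t0 <= t -> (c < m)%nat -> (forall q, (q < j)%nat -> V q = V' q) ->
  (forall p, (p < m)%nat -> V j (g i) p = V' j (g i) p) ->
  FD_rhs m N phi g V j i t c = FD_rhs m N phi g V' j i t c.
Proof.
  intros Ht Hc Hq Hj; destruct j as [|j]; [reflexivity|]; unfold FD_rhs.
  rewrite (Hq 0%nat) by lia.
  f_equal; [f_equal; [f_equal|]|].
  - apply matvec_ext; [|reflexivity]; intros b Hb; apply sumn_ext; intros p Hp; rewrite Hj by exact Hp; reflexivity.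
  - apply sumn_ext; intros q Hqj; rewrite (Hq (S q)) by lia.
    apply matvec_ext; [|reflexivity]; intros b Hb.
    apply adomian_ext; try assumption; intros l c' Hl _; rewrite Hq by lia; reflexivity.
  - apply sumn_ext; intros p Hp; rewrite (Hq p) by lia.
    apply matvec_ext; [|reflexivity]; intros b Hb; f_equal;
      apply adomian_ext; try assumption; intros l c' Hl _; rewrite Hq by lia; reflexivity.
  - apply matvec_ext; [|reflexivity]; intros b Hb.
    apply adomian_ext; try assumption; intros l c' Hl _.
    destruct (Nat.ltb_spec l (S j)); [rewrite Hq by lia; reflexivity|reflexivity].
Qed.

Lemma continuity_pt_matvec (M : R -> mat) (v : R -> vec) c x :
  (forall b, (b < m)%nat -> continuity_pt (fun t => M t c b) x) ->
  (forall b, (b < m)%nat -> continuity_pt (fun t => v t b) x) ->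
  continuity_pt (fun t => matvec m (M t) (v t) c) x.
Proof.
  intros HM Hv; apply (continuity_pt_sumn m (fun b t => M t c b * v t b)); intros b Hb.
  apply (continuity_pt_mult (fun t => M t c b)); [apply HM, Hb|apply Hv, Hb].
Qed.

Lemma continuity_pt_cst (r x : R) : continuity_pt (fun _ => r) x.
Proof. apply continuity_pt_const; intros ? ?; reflexivity. Qed.

Lemma FD_rhs_continuity g V j i c :
  (c < m)%nat ->
  (forall q b, (q <= j)%nat -> (b < m)%nat -> cont_on (fun s => t0 <= s) (fun s => V q s b)) ->
  continuity (fun t => FD_rhs m N phi g V j i (Rmax t0 t) c).
Proof.
  intros Hc HV0 t.
  assert (HV : forall q b, (q <= j)%nat -> (b < m)%nat -> continuity_pt (fun s => V q (Rmax t0 s) b) t).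
  { intros q b Hq Hb; apply (cont_on_clamp t0 (fun s => V q s b)), HV0; assumption. }
  destruct j as [|j]; [apply (cont_on_clamp t0 (fun s => phi s c)), Hphic, Hc|]; unfold FD_rhs.
  apply (continuity_pt_plus
    (fun t => matvec m _ _ c + sumn _ _ + sumn _ _) (fun t => matvec m _ _ c)).
  apply (continuity_pt_plus (fun t => matvec m _ _ c + sumn _ _) (fun t => sumn _ _)).
  apply (continuity_pt_plus (fun t => matvec m _ _ c) (fun t => sumn _ _)).
  - apply (continuity_pt_matvec (fun t a b => sumn m (fun p => pderiv N p (Rmax t0 t) (V 0%nat (g i)) a b * V (S j) (g i) p))
             (fun t => V 0%nat (Rmax t0 t))); [|intros; apply HV; [lia|assumption]].
    intros b Hb; apply (continuity_pt_sumn m (fun p t => pderiv N p (Rmax t0 t) (V 0%nat (g i)) c b * V (S j) (g i) p)).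
    intros p Hp; apply (continuity_pt_mult (fun t => pderiv N p (Rmax t0 t) (V 0%nat (g i)) c b));
      [apply continuity_pt_pderiv; assumption|apply continuity_pt_cst].
  - apply (continuity_pt_sumn _ (fun q t => matvec m (adomian (N (Rmax t0 t)) (S j - S q) (fun q => V q (g i))) (V (S q) (Rmax t0 t)) c)).
    intros q Hq; apply continuity_pt_matvec; [|intros; apply HV; [lia|assumption]].
    intros b Hb; apply (continuity_pt_adomian (fun _ q => V q (g i))); try assumption; intros; apply continuity_pt_cst.
  - apply (continuity_pt_sumn _ (fun p t => matvec m (fun a b =>
        adomian (N (Rmax t0 t)) (S j - 1 - p) (fun q => V q (Rmax t0 t)) a b
        - adomian (N (Rmax t0 t)) (S j - 1 - p) (fun q => V q (g i)) a b) (V p (Rmax t0 t)) c)).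
    intros p Hp; apply (continuity_pt_matvec (fun t a b =>
        adomian (N (Rmax t0 t)) (S j - 1 - p) (fun q => V q (Rmax t0 t)) a b
        - adomian (N (Rmax t0 t)) (S j - 1 - p) (fun q => V q (g i)) a b)); [|intros; apply HV; [lia|assumption]].
    intros b Hb; apply (continuity_pt_minus
        (fun t => adomian (N (Rmax t0 t)) (S j - 1 - p) (fun q => V q (Rmax t0 t)) c b)).
    + apply (continuity_pt_adomian (fun t q => V q (Rmax t0 t))); try assumption; intros; apply HV; [lia|assumption].
    + apply (continuity_pt_adomian (fun _ q => V q (g i))); try assumption; intros; apply continuity_pt_cst.
  - apply (continuity_pt_matvec (fun t => adomian (N (Rmax t0 t)) (S j) (fun q => if Nat.ltb q (S j) then V q (g i) else zerov))
             (fun t => V 0%nat (Rmax t0 t))); [|intros; apply HV; [lia|assumption]].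
    intros b Hb; apply (continuity_pt_adomian (fun _ q => if Nat.ltb q (S j) then V q (g i) else zerov)); try assumption.
    intros; apply continuity_pt_cst.
Qed.

Definition insert (V : nat -> R -> vec) (j : nat) (X : R -> vec) : nat -> R -> vec :=
  fun q => if Nat.eqb q j then X else V q.

Definition FD_init (j : nat) : vec := match j with O => u0 | S _ => zerov end.

(** The clauses of [FD_seq] for a single order over given lower orders, so that the sequence can be
    chosen recursively. *)
Definition FD_step_spec (g : nat -> R) (j : nat) (V : nat -> R -> vec) (X : R -> vec) : Prop :=
  (forall c, (c < m)%nat -> cont_on (fun s => t0 <= s) (fun s => X s c)) /\
  (forall c, (c < m)%nat -> X t0 c = FD_init j c) /\
  (forall i, exists dU : R -> vec,
     (forall c, (c < m)%nat ->
        (forall t, g i <= t <= g (S i) ->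
           deriv_within (fun s => g i <= s <= g (S i)) (fun s => X s c) t (dU t c)) /\
        cont_on (fun s => g i <= s <= g (S i)) (fun s => dU s c)) /\
     (forall t, g i <= t < g (S i) -> forall c, (c < m)%nat ->
        dU t c - matvec m (N t (insert V j X 0%nat (g i))) (X t) c = FD_rhs m N phi g (insert V j X) j i t c)).

Lemma FD_step_exists g j V :
  is_grid t0 g ->
  (forall q c, (q < j)%nat -> (c < m)%nat -> cont_on (fun s => t0 <= s) (fun s => V q s c)) ->
  exists X, FD_step_spec g j V X.
Proof.
  intros Hg HV.
  (* The unknown order is represented by the constant function [y], since only its node value is
     read. For [j = 0] this value also freezes the matrix; for [j > 0] the matrix comes from
     [V 0]. *)
  set (A := fun i (y : vec) t => N (Rmax t0 t) (insert V j (fun _ => y) 0%nat (g i))).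
  set (f := fun i (y : vec) t => FD_rhs m N phi g (insert V j (fun _ => y)) j i (Rmax t0 t)).
  assert (HA : forall i y c d, (c < m)%nat -> (d < m)%nat -> continuity (fun t => A i y t c d)).
  { intros i y c d Hc Hd t; apply (continuity_pt_N (fun _ => insert V j (fun _ => y) 0%nat (g i))); try assumption.
    intros; apply continuity_pt_cst. }
  assert (Hf : forall i y c, (c < m)%nat -> continuity (fun t => f i y t c)).
  { intros i y c Hc; apply FD_rhs_continuity; [exact Hc|]; intros q b Hq Hb; unfold insert.
    destruct (Nat.eqb_spec q j) as [->|Hne]; [|apply HV; [lia|exact Hb]].
    apply continuity_cont_on; intros s; apply continuity_pt_cst. }
  assert (Hsol : forall i (y : vec), exists x : R -> vec, (forall c, (c < m)%nat -> x (g i) c = y c) /\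
    (forall c, (c < m)%nat -> continuity (fun t => x t c)) /\
    forall t c, (c < m)%nat -> g i <= t <= g (S i) ->
      derivable_pt_lim (fun t => x t c) t (matvec m (A i y t) (x t) c + f i y t c)).
  { intros i y; apply linear_ode_exists; [|apply HA|apply Hf].
    destruct Hg as [_ [Hg _]]; specialize (Hg i); lra. }
  set (sol := fun i y => proj1_sig (constructive_indefinite_description _ (Hsol i y))).
  assert (Hsp : forall i y,
    (forall c, (c < m)%nat -> sol i y (g i) c = y c) /\
    (forall c, (c < m)%nat -> continuity (fun t => sol i y t c)) /\
    forall t c, (c < m)%nat -> g i <= t <= g (S i) ->
      derivable_pt_lim (fun t => sol i y t c) t (matvec m (A i y t) (sol i y t) c + f i y t c)).
  { intros i y; exact (proj2_sig (constructive_indefinite_description _ (Hsol i y))). }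
  set (y := fix y i := match i with O => FD_init j | S i' => sol i' (y i') (g (S i')) end).
  set (idx := fun t => epsilon (inhabits 0%nat) (fun i => g i <= t < g (S i))).
  set (X := fun t => sol (idx t) (y (idx t)) t).
  assert (Hidx : forall t i, g i <= t < g (S i) -> idx t = i).
  { intros t i Hi; apply (grid_locate_unique t0 g t); [exact Hg| |exact Hi].
    unfold idx; apply epsilon_spec; exists i; exact Hi. }
  (* At the right end [idx] already points to the next interval; the two values agree because that
     interval starts from [y (S i)], the end value of the preceding solution. *)
  assert (HX : forall i t c, (c < m)%nat -> g i <= t <= g (S i) -> X t c = sol i (y i) t c).
  { intros i t c Hc Ht; unfold X; destruct (Req_dec t (g (S i))) as [->|Hne].
    - rewrite (Hidx (g (S i)) (S i)) by (split; [lra|apply Hg]).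
      destruct (Hsp (S i) (y (S i))) as [H0 _]; rewrite H0 by exact Hc; reflexivity.
    - rewrite (Hidx t i) by lra; reflexivity. }
  assert (HXnode : forall i c, (c < m)%nat -> X (g i) c = y i c).
  { intros i c Hc; rewrite (HX i) by first [exact Hc|split; [lra|apply Rlt_le, Hg]].
    apply Hsp, Hc. }
  exists X; split; [|split].
  - intros c Hc; apply (cont_on_glue t0 g); [exact Hg|]; intros i.
    apply (cont_on_ext _ (fun t => sol i (y i) t c)); [intros t Ht; symmetry; apply HX; assumption|].
    apply continuity_cont_on, (Hsp i (y i)), Hc.
  - intros c Hc; rewrite <- (proj1 Hg), HXnode by exact Hc; reflexivity.
  - intros i; exists (fun t c => matvec m (A i (y i) t) (sol i (y i) t) c + f i (y i) t c); split.
    + intros c Hc; split.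
      * intros t Ht; apply (deriv_within_ext _ (fun t => sol i (y i) t c)); [exact Ht| |].
        -- intros s Hs; symmetry; apply HX; assumption.
        -- apply derivable_deriv_within, (Hsp i (y i)); assumption.
      * apply continuity_cont_on; intros t.
        apply (continuity_pt_plus (fun t => matvec m (A i (y i) t) (sol i (y i) t) c)); [|apply Hf, Hc].
        apply continuity_pt_matvec; intros b Hb; [apply HA; assumption|apply (Hsp i (y i)), Hb].
    + intros t Ht c Hc; pose proof (grid_ge t0 g i Hg).
      unfold A, f; rewrite Rmax_right by lra.
      rewrite (matvec_ext m (N t (insert V j X 0%nat (g i))) (N t (insert V j (fun _ => y i) 0%nat (g i)))
                 (X t) (sol i (y i) t)).
      * rewrite (FD_rhs_ext g (insert V j X) (insert V j (fun _ => y i))); try assumption; try lra.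
        -- intros q Hq; unfold insert; destruct (Nat.eqb_spec q j); [lia|reflexivity].
        -- intros p Hp; unfold insert; rewrite Nat.eqb_refl; apply HXnode, Hp.
      * intros b Hb; apply N_ext; try assumption; try lra.
        intros c' Hc'; unfold insert; destruct (Nat.eqb 0 j); [apply HXnode, Hc'|reflexivity].
      * intros b Hb; apply HX; [exact Hb|lra].
Qed.

Lemma FD_seq_exists g : is_grid t0 g -> exists U, FD_seq m N phi t0 u0 g U.
Proof.
  intros Hg.
  set (step := fun j V => epsilon (inhabits (fun _ : R => zerov)) (FD_step_spec g j V)).
  (* [H n] stores the orders below [n] and is zero elsewhere, which turns a recursion over all lower
     orders into a structural one. *)
  set (H := fix H n := match n with O => fun (_ : nat) (_ : R) => zerov | S j => insert (H j) j (step j (H j)) end).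
  set (U := fun j => step j (H j)).
  assert (HH : forall n q, (q < n)%nat -> H n q = U q).
  { induction n as [|n IH]; intros q Hq; [lia|]; simpl; unfold insert.
    destruct (Nat.eqb_spec q n) as [->|Hne]; [reflexivity|apply IH; lia]. }
  assert (HU : forall j, FD_step_spec g j (H j) (U j)).
  { intros j; induction j as [j IH] using (well_founded_induction lt_wf).
    unfold U, step; apply epsilon_spec, FD_step_exists; [exact Hg|].
    intros q c Hq Hc; rewrite (HH j q Hq); apply (IH q Hq), Hc. }
  assert (Hins : forall j q, (q <= j)%nat -> insert (H j) j (U j) q = U q).
  { intros j q Hq; unfold insert; destruct (Nat.eqb_spec q j) as [->|Hne]; [reflexivity|apply HH; lia]. }
  exists U; split; [|split; [|split]].
  - intros j c Hc; apply (HU j), Hc.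
  - intros c Hc; apply (HU 0%nat), Hc.
  - intros j c Hc; apply (HU (S j)), Hc.
  - intros j i; destruct (HU j) as [_ [_ Heq]]; destruct (Heq i) as [dU [H1 H2]]; exists dU; split; [exact H1|].
    intros t Ht c Hc; specialize (H2 t Ht c Hc); pose proof (grid_ge t0 g i Hg).
    rewrite (Hins j 0%nat) in H2 by lia.
    rewrite H2; apply FD_rhs_ext; try assumption; try lra.
    + intros q Hq; apply Hins; lia.
    + intros p Hp; rewrite Hins by lia; reflexivity.
Qed.

(** * A priori bounds for the FD sequence *)

Lemma Bsum_mono X Y : 0 <= X <= Y -> Bsum X <= Bsum Y.
Proof.
  intros HX; apply Series_le; [|apply ex_series_B]; intros p; specialize (HB0 p).
  assert (0 <= X ^ p) by (apply pow_le; lra).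
  assert (X ^ p <= Y ^ p) by (apply pow_incr; exact HX).
  split; [nra|apply Rmult_le_compat_l; assumption].
Qed.

Lemma derivable_dot (x dx : R -> vec) t :
  (forall c, (c < m)%nat -> derivable_pt_lim (fun s => x s c) t (dx t c)) ->
  derivable_pt_lim (fun s => dot m (x s) (x s)) t (2 * dot m (x t) (dx t)).
Proof.
  intros H; replace (2 * dot m (x t) (dx t)) with (sumn m (fun c => dx t c * x t c + x t c * dx t c)).
  - apply (derivable_pt_lim_sumn m (fun c s => x s c * x s c)); intros c Hc.
    apply (derivable_pt_lim_mult (fun s => x s c) (fun s => x s c)); apply H, Hc.
  - unfold dot; rewrite <- sumn_scal; apply sumn_ext; intros; ring.
Qed.

(** The barrier is applied to the squared norm, which is differentiable also where the vector
    vanishes. *)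
Lemma energy_barrier (x dx : R -> vec) a b M M2 :
  0 <= M < M2 ->
  (forall c t, (c < m)%nat -> a <= t <= b -> continuity_pt (fun s => x s c) t) ->
  (forall c t, (c < m)%nat -> a < t < b -> derivable_pt_lim (fun s => x s c) t (dx t c)) ->
  (forall t, a < t < b -> (forall s, a <= s <= t -> vnorm m (x s) <= M2) -> M < vnorm m (x t) ->
     dot m (x t) (dx t) <= 0) ->
  vnorm m (x a) <= M -> forall t, a <= t <= b -> vnorm m (x t) <= M.
Proof.
  intros HM Hc Hd Hs Ha t Ht; apply vnorm_le_iff; [lra|].
  apply (barrier (fun s => dot m (x s) (x s)) (fun s => 2 * dot m (x s) (dx s)) a b (M * M) (M2 * M2)); try assumption.
  - nra.
  - intros s Hs'; apply (continuity_pt_sumn m (fun c s => x s c * x s c)); intros c Hcm.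
    apply (continuity_pt_mult (fun s => x s c)); apply Hc; assumption.
  - intros s Hs'; apply derivable_dot; intros; apply Hd; assumption.
  - intros s Hs' Hh Hgt.
    assert (dot m (x s) (dx s) <= 0); [|lra].
    apply Hs; [exact Hs'| |].
    + intros s' Hs''; apply vnorm_le_iff; [lra|apply Hh, Hs''].
    + apply Rnot_le_lt; intros Hle; apply vnorm_le_iff in Hle; lra.
  - apply vnorm_le_iff; [lra|exact Ha].
Qed.

Context (kappa : R) (Hphib : forall t, t0 <= t -> vnorm m (phi t) <= kappa).
Context (Halpha : 0 < alpha).

Lemma kappa_ge_0 : 0 <= kappa.
Proof. eapply Rle_trans; [apply (vnorm_ge_0 m (phi t0))|apply Hphib; lra]. Qed.

Lemma FD_seq_continuity g U j c :
  FD_seq m N phi t0 u0 g U -> (c < m)%nat -> continuity (fun s => U j (Rmax t0 s) c).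
Proof. intros [H _] Hc; apply (cont_on_clamp t0 (fun s => U j s c)), H, Hc. Qed.

Lemma FD_seq_derivable g U j i t c :
  is_grid t0 g -> FD_seq m N phi t0 u0 g U -> (c < m)%nat -> g i < t < g (S i) ->
  derivable_pt_lim (fun s => U j (Rmax t0 s) c) t
    (matvec m (N t (U 0%nat (g i))) (U j t) c + FD_rhs m N phi g U j i t c).
Proof.
  intros Hg [_ [_ [_ H]]] Hc Ht; destruct (H j i) as [dU [H1 H2]].
  pose proof (grid_ge t0 g i Hg).
  replace (matvec m (N t (U 0%nat (g i))) (U j t) c + FD_rhs m N phi g U j i t c) with (dU t c).
  2: { rewrite <- (H2 t) by (try exact Hc; lra); ring. }
  set (e := Rmin (t - g i) (g (S i) - t)).
  assert (He : 0 < e) by (apply Rmin_pos; lra).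
  assert (Hin : forall y, Rabs (y - t) < e -> g i <= y <= g (S i)).
  { intros y Hy; pose proof (Rlt_le_trans _ _ _ Hy (Rmin_l _ _)) as Y1.
    pose proof (Rlt_le_trans _ _ _ Hy (Rmin_r _ _)) as Y2.
    apply Rabs_def2 in Y1; apply Rabs_def2 in Y2; lra. }
  apply (derivable_pt_lim_local (fun s => U j s c) _ t _ e He).
  - intros y Hy; specialize (Hin y Hy); rewrite Rmax_right by lra; reflexivity.
  - apply (deriv_within_interior (fun s => g i <= s <= g (S i)) _ t _ e He Hin), (H1 c Hc); lra.
Qed.

(* In [dU_j/dt] the node value [U_j (g i)] may be replaced by [U_j t], which makes
   the Jacobian [J] at [w = U_0 (g i)] appear, up to the two increments below. *)
Lemma jacobian_splitting t (w x xa z : vec) c :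
  (c < m)%nat ->
  matvec m (N t w) x c + matvec m (fun a b => sumn m (fun p => pderiv N p t w a b * xa p)) z c
  = matvec m (Jac m N t w) x c
    + (matvec m (fun a b => sumn m (fun p => pderiv N p t w a b * (xa p - x p))) z c
       + matvec m (fun a b => sumn m (fun p => pderiv N p t w a b * x p)) (fun b => z b - w b) c).
Proof.
  intros Hc.
  assert (HJx : matvec m (Jac m N t w) x c
    = matvec m (N t w) x c + matvec m (fun a b => sumn m (fun p => pderiv N p t w a b * x p)) w c).
  { unfold matvec at 1 2 3; unfold Jac.
    rewrite (sumn_ext m (fun b => sumn m (fun p => pderiv N p t w c b * x p) * w b)
               (fun b => sumn m (fun p => pderiv N p t w c b * w b * x p))).
    2: { intros b Hb; rewrite Rmult_comm, <- sumn_scal; apply sumn_ext; intros; ring. }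
    rewrite (sumn_exchange m m (fun b p => pderiv N p t w c b * w b * x p)), <- sumn_plus.
    apply sumn_ext; intros p Hp; rewrite Rmult_plus_distr_r; f_equal.
    unfold matvec; rewrite Rmult_comm, <- sumn_scal; apply sumn_ext; intros; ring. }
  rewrite HJx, !Rplus_assoc; f_equal; unfold matvec; rewrite <- !sumn_plus; apply sumn_ext; intros b Hb.
  rewrite (sumn_ext m (fun p => pderiv N p t w c b * (xa p - x p))
             (fun p => pderiv N p t w c b * xa p - pderiv N p t w c b * x p)) by (intros; ring).
  rewrite sumn_minus; ring.
Qed.

(** * The ansatz and its constants *)

Section FDBounds.

Context (rho delta r : R).
Let mm := INR m.
(** The provisional bound on order zero in the continuous induction; it also dominates every order
    relative to its weight. *)
Let K := 2 * rho.
(** One constant for values, derivatives and Adomian polynomials of [N]: their estimates use [Bsum]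
    at [K], [4 * K], [8 * K] and [4 * (8 * K)], and [Bsum] is monotone. *)
Let beta := Bsum (4 * (8 * K)).
Let D0 := mm * (beta * K) + kappa.
Let D1 := mm * (beta * 2) + mm * (mm * beta * K) + 1.
Let D := D0 + D1.
(** [A1 * delta] collects the terms with two factors of positive order. [A2] is the cost of the
    differences between [t] and the node, where 32 is 8 from the convolution times 4 from the shift
    of order. *)
Let A1 := (8 * mm * beta + mm * beta * K) * delta.
Let A2 := 32 * mm * D * beta * K * r.

Context (Hrho : 1 <= rho) (Hu0 : vnorm m u0 <= rho) (Hkap : mm * kappa <= alpha / 2 * rho).
Context (Hdelta : 0 < delta <= 1) (Hr : 0 < r).
(** [Ha1] and [Hb1] keep the remainder below [delta * wt q j]; [Ha2] and [Hb2] let it use at most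
    half of the dissipation. [Hc1] and [Hd1] let the errors from increments over one step use at
    most another half, for positive orders and for order zero. *)
Context (Ha1 : A1 <= / 2) (Ha2 : mm * A1 <= alpha / 4).
Context (Hb1 : A2 <= delta / 2) (Hb2 : mm * A2 <= alpha / 4 * delta).
Context (Hc1 : r * (mm * (mm * mm * beta * (D1 * K + 2 * D0))) <= alpha / 2).
Context (Hd1 : r * (mm * (mm * (D0 * beta * K))) <= alpha / 2).
Context (g : nat -> R) (U : nat -> R -> vec) (h : R).
Context (Hg : is_grid t0 g) (HU : FD_seq m N phi t0 u0 g U).
Context (Hh : 0 < h <= r) (Hstep : forall i, g (S i) - g i <= h).

Let q := h / r.

Lemma FD_mm_ge_0 : 0 <= mm.
Proof. apply pos_INR. Qed.

Lemma FD_beta_ge_0 : 0 <= beta.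
Proof. apply Bsum_ge_0; unfold K; lra. Qed.

Lemma FD_q_pos : 0 < q.
Proof. apply Rdiv_lt_0_compat; lra. Qed.

Lemma FD_q_le_1 : q <= 1.
Proof. unfold q; apply Rmult_le_reg_r with r; [lra|]; unfold Rdiv; rewrite Rmult_assoc, Rinv_l; lra. Qed.

Lemma FD_D0_ge_0 : 0 <= D0.
Proof.
  unfold D0; pose proof FD_mm_ge_0; pose proof FD_beta_ge_0; pose proof kappa_ge_0.
  assert (0 <= beta * K) by (unfold K; nra); nra.
Qed.

Lemma FD_D1_ge_1 : 1 <= D1.
Proof.
  unfold D1; pose proof FD_mm_ge_0; pose proof FD_beta_ge_0.
  assert (0 <= mm * beta) by nra; assert (0 <= mm * beta * K) by (unfold K; nra); nra.
Qed.

Lemma FD_N_bound t w a b :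
  t0 <= t -> (a < m)%nat -> (b < m)%nat -> (forall c, (c < m)%nat -> Rabs (w c) <= K) -> Rabs (N t w a b) <= beta.
Proof.
  intros Ht Ha Hb Hw; eapply Rle_trans; [apply (N_bound t w a b K); try assumption; unfold K; lra|].
  apply Bsum_mono; unfold K; lra.
Qed.

Lemma FD_pderiv_bound p t w a b :
  t0 <= t -> (a < m)%nat -> (b < m)%nat -> (p < m)%nat -> (forall c, (c < m)%nat -> Rabs (w c) <= K) ->
  Rabs (pderiv N p t w a b) <= beta.
Proof.
  intros Ht Ha Hb Hp Hw; rewrite pderiv_dN by assumption.
  eapply Rle_trans; [apply (dN_bound p t w a b K); try assumption; unfold K; lra|].
  apply Bsum_mono; unfold K; lra.
Qed.

Lemma FD_pderiv_sum_bound t w z a b Z :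
  t0 <= t -> (a < m)%nat -> (b < m)%nat -> (forall c, (c < m)%nat -> Rabs (w c) <= K) ->
  (forall c, (c < m)%nat -> Rabs (z c) <= Z) ->
  Rabs (sumn m (fun p => pderiv N p t w a b * z p)) <= mm * (beta * Z).
Proof.
  intros Ht Ha Hb Hw Hz; apply sumn_bound; intros p Hp; rewrite Rabs_mult.
  apply Rmult_le_compat; try apply Rabs_pos; [apply FD_pderiv_bound; assumption|apply Hz, Hp].
Qed.

Lemma FD_increment j i t L :
  (forall c s, (c < m)%nat -> g i < s < t ->
     Rabs (matvec m (N s (U 0%nat (g i))) (U j s) c + FD_rhs m N phi g U j i s c) <= L) ->
  0 <= L -> g i <= t <= g (S i) -> forall c, (c < m)%nat -> Rabs (U j t c - U j (g i) c) <= h * L.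
Proof.
  intros HL HL0 Ht c Hc; pose proof (grid_ge t0 g i Hg) as Hgi.
  pose proof (increment_bound (fun s => U j (Rmax t0 s) c)
    (fun s => matvec m (N s (U 0%nat (g i))) (U j s) c + FD_rhs m N phi g U j i s c) (g i) t L) as Hi.
  simpl in Hi; rewrite !Rmax_right in Hi by lra.
  eapply Rle_trans; [apply Hi|].
  - lra.
  - intros s Hs; apply FD_seq_derivable; try assumption; lra.
  - intros s Hs; apply (FD_seq_continuity g); assumption.
  - intros s Hs; apply HL; assumption.
  - specialize (Hstep i); nra.
Qed.

Lemma FD0_interval i :
  vnorm m (U 0%nat (g i)) <= rho ->
  forall t, g i <= t <= g (S i) ->
  vnorm m (U 0%nat t) <= rho /\ forall c, (c < m)%nat -> Rabs (U 0%nat t c - U 0%nat (g i) c) <= h * D0.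
Proof.
  intros Hw; set (w := U 0%nat (g i)) in *.
  pose proof FD_mm_ge_0 as Hmm; pose proof FD_beta_ge_0 as Hbeta; pose proof FD_D0_ge_0 as HD0.
  pose proof kappa_ge_0; pose proof (grid_ge t0 g i Hg) as Hgi.
  assert (HwK : forall c, (c < m)%nat -> Rabs (w c) <= K).
  { intros c Hc; eapply Rle_trans; [apply (Rabs_le_vnorm m w c Hc)|unfold K; lra]. }
  (* The increment needs only the provisional bound up to time [t]. It is used inside the continuous
     induction and again once the bound [rho] is established. *)
  assert (Hinc : forall t, g i <= t <= g (S i) -> (forall s, g i <= s <= t -> vnorm m (U 0%nat s) <= K) ->
            forall c, (c < m)%nat -> Rabs (U 0%nat t c - w c) <= h * D0).
  { intros t Ht Hs; apply FD_increment; try assumption.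
    intros c s Hc Hst; unfold D0; eapply Rle_trans; [apply Rabs_triang|]; apply Rplus_le_compat.
    - apply matvec_bound; [intros; apply FD_N_bound; try assumption; lra|].
      intros b Hb; eapply Rle_trans; [apply (Rabs_le_vnorm m _ b Hb)|apply Hs; lra].
    - simpl; eapply Rle_trans; [apply (Rabs_le_vnorm m _ c Hc)|apply Hphib; lra]. }
  assert (Hb : forall t, g i <= t <= g (S i) -> vnorm m (U 0%nat t) <= rho).
  { intros t Ht.
    pose proof (energy_barrier (fun s => U 0%nat (Rmax t0 s))
      (fun s c => matvec m (N s w) (U 0%nat s) c + FD_rhs m N phi g U 0 i s c) (g i) (g (S i)) rho K) as HE.
    simpl in HE; specialize (HE ltac:(unfold K; lra)).
    replace t with (Rmax t0 t) by (apply Rmax_right; lra); apply HE; [| | | |exact Ht].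
    - intros c s Hc _; apply (FD_seq_continuity g); assumption.
    - intros c s Hc Hs; apply (FD_seq_derivable g U 0 i s c); assumption.
    - intros s Hs Hhist Hgt; rewrite Rmax_right in * by lra.
      assert (Hhist' : forall s', g i <= s' <= s -> vnorm m (U 0%nat s') <= K).
      { intros s' Hs'; specialize (Hhist s' Hs'); rewrite Rmax_right in Hhist by lra; exact Hhist. }
      set (x := U 0%nat s) in *.
      assert (HxK : forall c, (c < m)%nat -> Rabs (x c) <= K).
      { intros c Hc; eapply Rle_trans; [apply (Rabs_le_vnorm m x c Hc)|apply Hhist'; lra]. }
      rewrite (dot_ext m x x _ (fun c => matvec m (N s x) x c
        + (matvec m (fun a b => N s w a b - N s x a b) x c + phi s c))) by
        (try reflexivity; intros c Hc; unfold matvec; rewrite <- Rplus_assoc, <- sumn_plus; f_equal;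
         apply sumn_ext; intros; ring).
      rewrite !dot_plus_r.
      pose proof (N_dissipative s x ltac:(lra)) as Hdis; rewrite <- vnorm_sqr in Hdis.
      assert (E1 : Rabs (dot m x (matvec m (fun a b => N s w a b - N s x a b) x))
                <= vnorm m x * (mm * (mm * (h * D0 * beta * K)))).
      { apply dot_bound; intros c Hc; apply matvec_bound; [|exact HxK]; intros b Hb.
        eapply Rle_trans; [apply (N_diff_bound s w x c b K (h * D0)); try assumption; try lra|].
        - unfold K; lra.
        - nra.
        - intros c' Hc'; rewrite Rabs_minus_sym; apply Hinc; try assumption; lra.
        - apply Rmult_le_compat_l; [nra|]; apply Bsum_mono; unfold K; lra. }
      assert (E2 : Rabs (dot m x (phi s)) <= vnorm m x * (mm * kappa)).
      { apply dot_bound; intros c Hc; eapply Rle_trans; [apply (Rabs_le_vnorm m _ c Hc)|apply Hphib; lra]. }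
      assert (E3 : mm * (mm * (h * D0 * beta * K)) <= alpha / 2).
      { eapply Rle_trans; [|exact Hd1].
        replace (mm * (mm * (h * D0 * beta * K))) with (h * (mm * (mm * (D0 * beta * K)))) by ring.
        apply Rmult_le_compat_r; [|lra]; repeat apply Rmult_le_pos; try assumption; unfold K; lra. }
      apply Rabs_le_between in E1; apply Rabs_le_between in E2.
      pose proof (vnorm_ge_0 m x).
      assert (vnorm m x * (mm * (mm * (h * D0 * beta * K))) <= vnorm m x * (alpha / 2)) by (apply Rmult_le_compat_l; assumption).
      assert (vnorm m x * (mm * kappa) <= vnorm m x * (alpha / 2 * rho)) by (apply Rmult_le_compat_l; assumption).
      assert (vnorm m x * (alpha / 2) <= vnorm m x * (alpha / 2 * rho)) by (apply Rmult_le_compat_l; [assumption|nra]).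
      assert (vnorm m x * (alpha * rho) <= vnorm m x * (alpha * vnorm m x)).
      { apply Rmult_le_compat_l; [assumption|]; apply Rmult_le_compat_l; lra. }
      lra.
    - rewrite Rmax_right by lra; exact Hw. }
  intros t Ht; split; [apply Hb, Ht|]; apply Hinc; [exact Ht|].
  intros s Hs; eapply Rle_trans; [apply Hb; lra|unfold K; lra].
Qed.

Definition FD_level (j : nat) : R := match j with O => rho | S _ => delta * wt q j end.

Definition FD_bounded (j : nat) : Prop :=
  forall i t, g i <= t <= g (S i) ->
    vnorm m (U j t) <= FD_level j /\
    forall c, (c < m)%nat -> Rabs (U j t c - U j (g i) c) <= h * D * wt q j.

Lemma FD_bounded_0 : FD_bounded 0.
Proof.
  assert (H : forall i, vnorm m (U 0%nat (g i)) <= rho).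
  { induction i as [|i IH].
    - eapply Rle_trans; [|exact Hu0]; apply Req_le; unfold vnorm; f_equal.
      apply dot_ext; intros c Hc; rewrite (proj1 Hg); apply (proj1 (proj2 HU)), Hc.
    - apply (FD0_interval i IH); split; [apply Rlt_le, Hg|lra]. }
  intros i t Ht; destruct (FD0_interval i (H i) t Ht) as [H1 H2]; split; [exact H1|].
  intros c Hc; rewrite wt_0, Rmult_1_r; eapply Rle_trans; [apply H2, Hc|].
  apply Rmult_le_compat_l; [lra|]; unfold D; pose proof FD_D1_ge_1; lra.
Qed.

Lemma FD_bounded_pos l i t c :
  FD_bounded l -> (1 <= l)%nat -> (c < m)%nat -> g i <= t <= g (S i) -> Rabs (U l t c) <= delta * wt q l.
Proof.
  intros H Hl Hc Ht; destruct (H i t Ht) as [Hv _]; destruct l; [lia|].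
  eapply Rle_trans; [apply (Rabs_le_vnorm m _ c Hc)|exact Hv].
Qed.

Lemma FD_bounded_K l i t c :
  FD_bounded l -> (c < m)%nat -> g i <= t <= g (S i) -> Rabs (U l t c) <= K * wt q l.
Proof.
  intros H Hc Ht; destruct (H i t Ht) as [Hv _].
  eapply Rle_trans; [apply (Rabs_le_vnorm m _ c Hc)|]; eapply Rle_trans; [exact Hv|].
  pose proof FD_q_pos; pose proof (wt_ge_0 q l ltac:(lra)).
  destruct l as [|l]; unfold FD_level, K; [rewrite wt_0; lra|nra].
Qed.

Lemma FD_node_in i : g i <= g i <= g (S i).
Proof. split; [lra|apply Rlt_le, Hg]. Qed.

(** The bracket is subtracted because it contains the unknown order itself and is not small relative
    to it; it is later absorbed into the Jacobian. *)
Lemma FD_remainder_bound j i t c :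
  (forall l, (l <= j)%nat -> FD_bounded l) -> (c < m)%nat -> g i <= t <= g (S i) ->
  Rabs (FD_rhs m N phi g U (S j) i t c
        - matvec m (fun a b => sumn m (fun p => pderiv N p t (U 0%nat (g i)) a b * U (S j) (g i) p)) (U 0%nat t) c)
    <= (A1 * delta + A2) * wt q (S j).
Proof.
  intros HP Hc Ht; pose proof (grid_ge t0 g i Hg) as Hgi; pose proof (FD_node_in i) as Hnode.
  pose proof FD_mm_ge_0 as Hmm; pose proof FD_beta_ge_0 as Hbeta; pose proof FD_D0_ge_0; pose proof FD_D1_ge_1.
  pose proof FD_q_pos as Hq; assert (Hq0 : 0 <= q) by lra.
  assert (HK1 : 1 <= K) by (unfold K; lra); assert (HtT : t0 <= t) by lra.
  assert (HD : 0 <= D) by (unfold D; lra).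
  assert (HhD : 0 <= h * D) by nra.
  set (J := S j) in *; unfold FD_rhs, J at 1.
  set (T1 := sumn (J - 1) _); set (T2 := sumn J _).
  set (T3 := matvec m (adomian (N t) J _) _ c).
  replace (_ - _) with (T1 + T2 + T3) by ring.
  (* The orders [S p] and [J - S p] are both at least 1, so matrix and vector each contribute a
     [delta]. *)
  assert (B1 : Rabs T1 <= mm * beta * (delta * delta) * (8 * wt q J)).
  { eapply Rle_trans; [apply sumn_Rabs|].
    apply Rle_trans with (sumn (J - 1) (fun p => mm * beta * (delta * delta) * (wt q (S p) * wt q (J - S p)))).
    - apply sumn_le; intros p Hp.
      replace (mm * beta * (delta * delta) * (wt q (S p) * wt q (J - S p)))
        with (mm * ((delta * wt q (J - S p) * beta) * (delta * wt q (S p)))) by ring.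
      apply matvec_bound.
      + intros b Hb; apply (adomian_bound_pos t _ (J - S p) c b q K delta); try assumption; try lra; try (unfold J in *; lia).
        * intros l c' Hl Hc'; apply (FD_bounded_K l i); try assumption; apply HP; unfold J in *; lia.
        * intros l c' Hl Hc'; apply (FD_bounded_pos l i); try assumption; [apply HP; unfold J in *; lia|lia].
      + intros b Hb; apply (FD_bounded_pos (S p) i); try assumption; [apply HP; unfold J in *; lia|lia].
    - rewrite sumn_scal; apply Rmult_le_compat_l; [repeat apply Rmult_le_pos; lra|].
      eapply Rle_trans; [|apply (conv_wt_le q J Hq0)].
      replace (J - 1)%nat with j by (unfold J; lia).
      apply (sumn_inner_le (fun k => wt q k * wt q (J - k))).
      intros k; apply Rmult_le_pos; apply wt_ge_0, Hq0. }
  (* The convolution here has total order [j], one below [J]. Since [h = q * r], the missing power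
     of [q] is taken from the increment, and [wt_S] raises the order. *)
  assert (B2 : Rabs T2 <= 32 * mm * D * beta * K * r * wt q J).
  { apply Rle_trans with (mm * (h * D) * beta * K * (8 * wt q j)).
    - eapply Rle_trans; [apply sumn_Rabs|].
      apply Rle_trans with (sumn J (fun p => mm * (h * D) * beta * K * (wt q p * wt q (j - p)))).
      + apply sumn_le; intros p Hp.
        replace (mm * (h * D) * beta * K * (wt q p * wt q (j - p)))
          with (mm * ((h * D * wt q (j - p) * beta) * (K * wt q p))) by ring.
        replace (J - 1 - p)%nat with (j - p)%nat by (unfold J; lia).
        apply matvec_bound.
        * intros b Hb; apply (adomian_diff_bound t _ _ (j - p) c b q K (h * D)); try assumption.
          -- intros l c' Hl Hc'; apply (FD_bounded_K l i); try assumption; apply HP; lia.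
          -- intros l c' Hl Hc'; apply (FD_bounded_K l i); try assumption; apply HP; lia.
          -- intros l c' Hl Hc'; apply (HP l ltac:(lia) i t Ht), Hc'.
        * intros b Hb; apply (FD_bounded_K p i); try assumption; apply HP; unfold J in *; lia.
      + rewrite sumn_scal; apply Rmult_le_compat_l; [repeat apply Rmult_le_pos; lra|].
        unfold J; rewrite <- (sum_f_R0_sumn (fun k => wt q k * wt q (j - k))); apply conv_wt_le, Hq0.
    - pose proof (wt_S q j Hq0) as HwS; fold J in HwS.
      replace (mm * (h * D) * beta * K * (8 * wt q j)) with (8 * mm * D * beta * K * r * (q * wt q j)).
      2: { replace h with (q * r) by (unfold q; field; lra); ring. }
      replace (32 * mm * D * beta * K * r * wt q J) with (8 * mm * D * beta * K * r * (4 * wt q J)) by ring.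
      apply Rmult_le_compat_l; [repeat apply Rmult_le_pos; lra|exact HwS]. }
  (* Its last argument is zero, so the quadratic estimate applies although the vector factor has
     order zero. *)
  assert (B3 : Rabs T3 <= mm * (delta * delta * wt q J * beta * K)).
  { apply matvec_bound.
    - intros b Hb; apply (adomian_bound_quadratic t _ J c b q K delta); try assumption; try lra; try (unfold J; lia).
      + intros l c' Hl Hc'; destruct (Nat.ltb_spec l J) as [Hlt|Hge].
        * apply (FD_bounded_K l i); try assumption; apply HP; unfold J in *; lia.
        * unfold zerov; rewrite Rabs_R0; apply Rmult_le_pos; [lra|apply wt_ge_0, Hq0].
      + intros l c' Hl Hc'; destruct (Nat.ltb_spec l J) as [Hlt|Hge].
        * apply (FD_bounded_pos l i); try assumption; [apply HP; unfold J in *; lia|lia].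
        * unfold zerov; rewrite Rabs_R0; apply Rmult_le_pos; [lra|apply wt_ge_0, Hq0].
      + intros c' Hc'; rewrite Nat.ltb_irrefl; reflexivity.
    - intros b Hb; pose proof (FD_bounded_K 0 i t b (HP 0%nat ltac:(lia)) Hb Ht) as H1; rewrite wt_0 in H1; lra. }
  eapply Rle_trans; [apply Rabs_triang|]; eapply Rle_trans; [apply Rplus_le_compat_r, Rabs_triang|].
  unfold A1, A2; lra.
Qed.

Lemma FD_A_bounds : A1 * delta + A2 <= delta /\ mm * (A1 * delta + A2) <= alpha / 2 * delta.
Proof. split; nra. Qed.

(** Every error is proportional to [M = delta * wt q J], so the same step restriction serves all
    orders. The provisional bound is [2 * M]. *)
Lemma FD_interval j i :
  (forall l, (l <= j)%nat -> FD_bounded l) -> vnorm m (U (S j) (g i)) <= delta * wt q (S j) ->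
  forall t, g i <= t <= g (S i) ->
  vnorm m (U (S j) t) <= delta * wt q (S j) /\
  forall c, (c < m)%nat -> Rabs (U (S j) t c - U (S j) (g i) c) <= h * (D1 * (delta * wt q (S j))).
Proof.
  intros HP Hstart; set (J := S j) in *; set (M := delta * wt q J) in *.
  pose proof (grid_ge t0 g i Hg) as Hgi; pose proof (FD_node_in i) as Hnode.
  pose proof FD_mm_ge_0 as Hmm; pose proof FD_beta_ge_0 as Hbeta; pose proof FD_D0_ge_0 as HD0; pose proof FD_D1_ge_1 as HD1.
  pose proof FD_q_pos as Hq; destruct FD_A_bounds as [HA1 HA2].
  assert (HK : 2 <= K) by (unfold K; lra).
  assert (Hwt : 0 < wt q J) by (apply wt_gt_0, Hq).
  assert (HM : 0 < M) by (unfold M; nra).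
  set (w := U 0%nat (g i)).
  assert (HU0 : forall s, g i <= s <= g (S i) -> vnorm m (U 0%nat s) <= rho) by (intros s Hs; apply (HP 0%nat ltac:(lia) i s Hs)).
  assert (HU0K : forall s c, (c < m)%nat -> g i <= s <= g (S i) -> Rabs (U 0%nat s c) <= K).
  { intros s c Hc Hs; eapply Rle_trans; [apply (Rabs_le_vnorm m _ c Hc)|]; specialize (HU0 s Hs); unfold K; lra. }
  assert (HwK : forall c, (c < m)%nat -> Rabs (w c) <= K) by (intros c Hc; apply HU0K; assumption).
  set (L := fun s c => matvec m (fun a b => sumn m (fun p => pderiv N p s w a b * U J (g i) p)) (U 0%nat s) c).
  assert (HF : forall s c, (c < m)%nat -> g i <= s <= g (S i) ->
            Rabs (FD_rhs m N phi g U J i s c - L s c) <= (A1 * delta + A2) * wt q J).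
  { intros s c Hc Hs; apply FD_remainder_bound; assumption. }
  assert (HnodeM : forall p, (p < m)%nat -> Rabs (U J (g i) p) <= M).
  { intros p Hp; eapply Rle_trans; [apply (Rabs_le_vnorm m _ p Hp)|exact Hstart]. }
  assert (Hinc : forall t, g i <= t <= g (S i) -> (forall s, g i <= s <= t -> vnorm m (U J s) <= 2 * M) ->
            forall c, (c < m)%nat -> Rabs (U J t c - U J (g i) c) <= h * (D1 * M)).
  { intros t Ht Hs; apply FD_increment; [|nra|exact Ht].
    intros c s Hc Hst.
    replace (matvec m (N s (U 0%nat (g i))) (U J s) c + FD_rhs m N phi g U J i s c)
      with (matvec m (N s w) (U J s) c + L s c + (FD_rhs m N phi g U J i s c - L s c)) by (unfold w; ring).
    eapply Rle_trans; [apply Rabs_triang|]; eapply Rle_trans; [apply Rplus_le_compat_r, Rabs_triang|].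
    assert (E1 : Rabs (matvec m (N s w) (U J s) c) <= mm * (beta * (2 * M))).
    { apply matvec_bound; [intros; apply FD_N_bound; try assumption; lra|].
      intros b Hb; eapply Rle_trans; [apply (Rabs_le_vnorm m _ b Hb)|apply Hs; lra]. }
    assert (E2 : Rabs (L s c) <= mm * (mm * (beta * M) * K)).
    { apply matvec_bound; [|intros; apply HU0K; try assumption; lra].
      intros b Hb; apply FD_pderiv_sum_bound; try assumption; lra. }
    specialize (HF s c Hc ltac:(lra)).
    assert (E3 : (A1 * delta + A2) * wt q J <= M) by (unfold M; apply Rmult_le_compat_r; lra).
    unfold D1; lra. }
  assert (Hb : forall t, g i <= t <= g (S i) -> vnorm m (U J t) <= M).
  { intros t Ht.
    pose proof (energy_barrier (fun s => U J (Rmax t0 s))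
      (fun s c => matvec m (N s w) (U J s) c + FD_rhs m N phi g U J i s c) (g i) (g (S i)) M (2 * M)) as HE.
    cbv beta in HE; specialize (HE ltac:(lra)).
    replace t with (Rmax t0 t) by (apply Rmax_right; lra); apply HE; [| | | |exact Ht].
    - intros c s Hc _; apply (FD_seq_continuity g); assumption.
    - intros c s Hc Hs; apply (FD_seq_derivable g U J i s c); assumption.
    - intros s Hs Hhist Hgt; rewrite Rmax_right in * by lra.
      assert (Hhist' : forall s', g i <= s' <= s -> vnorm m (U J s') <= 2 * M).
      { intros s' Hs'; specialize (Hhist s' Hs'); rewrite Rmax_right in Hhist by lra; exact Hhist. }
      specialize (Hinc s ltac:(lra) Hhist').
      assert (HxM : forall c, (c < m)%nat -> Rabs (U J s c) <= 2 * M).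
      { intros c Hc; eapply Rle_trans; [apply (Rabs_le_vnorm m _ c Hc)|apply Hhist'; lra]. }
      set (x := U J s) in *.
      set (E := fun c => (matvec m (fun a b => sumn m (fun p => pderiv N p s w a b * (U J (g i) p - x p))) (U 0%nat s) c
         + matvec m (fun a b => sumn m (fun p => pderiv N p s w a b * x p)) (fun b => U 0%nat s b - w b) c)
         + (FD_rhs m N phi g U J i s c - L s c)).
      rewrite (dot_ext m x x _ (fun c => matvec m (Jac m N s w) x c + E c)).
      2: reflexivity.
      2: { intros c Hc; pose proof (jacobian_splitting s w x (U J (g i)) (U 0%nat s) c Hc) as Hsp.
           unfold E, L; lra. }
      rewrite dot_plus_r.
      (* Hypothesis 3 is used at the node value [w], where the scheme evaluates both [N] and its
         derivatives. *)
      pose proof (HJ s ltac:(lra) w x) as Hdis; rewrite <- vnorm_sqr in Hdis.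
      assert (HE1 : Rabs (dot m x E) <= vnorm m x * (mm * (h * M * (mm * mm * beta * (D1 * K + 2 * D0))
                                                + (A1 * delta + A2) * wt q J))).
      { apply dot_bound; intros c Hc; unfold E.
        eapply Rle_trans; [apply Rabs_triang|]; apply Rplus_le_compat; [|apply HF; [exact Hc|lra]].
        eapply Rle_trans; [apply Rabs_triang|].
        replace (h * M * (mm * mm * beta * (D1 * K + 2 * D0)))
          with (mm * (mm * (beta * (h * (D1 * M))) * K) + mm * (mm * (beta * (2 * M)) * (h * D0))) by ring.
        apply Rplus_le_compat.
        - apply matvec_bound; [|intros; apply HU0K; try assumption; lra].
          intros b Hb; apply (FD_pderiv_sum_bound s w (fun p => U J (g i) p - x p)); try assumption; try lra.
          intros p Hp; rewrite Rabs_minus_sym; apply Hinc, Hp.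
        - apply matvec_bound; [intros b Hb; apply FD_pderiv_sum_bound; try assumption; lra|].
          intros b Hb; apply (FD0_interval i (HU0 (g i) Hnode) s); [lra|exact Hb]. }
      (* [Q1] charges the two increments and [Q2] the remainder, each to half of [alpha]; so the
         derivative is nonpositive once the norm exceeds [M]. *)
      assert (HE2 : mm * (h * M * (mm * mm * beta * (D1 * K + 2 * D0)) + (A1 * delta + A2) * wt q J) <= alpha * M).
      { assert (Q1 : h * (mm * (mm * mm * beta * (D1 * K + 2 * D0))) <= alpha / 2).
        { eapply Rle_trans; [|exact Hc1]; apply Rmult_le_compat_r; [|lra].
          repeat apply Rmult_le_pos; try assumption; nra. }
        assert (Q2 : mm * (A1 * delta + A2) * wt q J <= alpha / 2 * delta * wt q J) by (apply Rmult_le_compat_r; lra).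
        apply (Rmult_le_compat_r M) in Q1; [|lra]; unfold M in *; lra. }
      apply Rabs_le_between in HE1; pose proof (vnorm_ge_0 m x).
      apply (Rmult_le_compat_l (vnorm m x)) in HE2; [|assumption].
      assert (vnorm m x * (alpha * M) <= vnorm m x * (alpha * vnorm m x)).
      { apply Rmult_le_compat_l; [assumption|]; apply Rmult_le_compat_l; lra. }
      lra.
    - rewrite Rmax_right by lra; exact Hstart. }
  intros t Ht; split; [apply Hb, Ht|]; apply Hinc; [exact Ht|].
  intros s Hs; eapply Rle_trans; [apply Hb; lra|lra].
Qed.

(** Strong induction on the order, and within one order induction along the nodes: an order is
    bounded on the whole half-line before the next one is considered. *)
Lemma FD_all_bounded j : FD_bounded j.
Proof.
  induction j as [j IH] using (well_founded_induction lt_wf).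
  destruct j as [|j]; [apply FD_bounded_0|].
  assert (HP : forall l, (l <= j)%nat -> FD_bounded l) by (intros; apply IH; lia).
  pose proof FD_q_pos as Hq; pose proof (wt_gt_0 q (S j) Hq) as Hwt.
  assert (H : forall i, vnorm m (U (S j) (g i)) <= delta * wt q (S j)).
  { induction i as [|i IHi].
    - apply vnorm_le_iff; [nra|]; unfold dot; rewrite sumn_0; [nra|].
      intros c Hc; rewrite (proj1 Hg), (proj1 (proj2 (proj2 HU))) by exact Hc; ring.
    - apply (FD_interval j i HP IHi); split; [apply Rlt_le, Hg|lra]. }
  intros i t Ht; destruct (FD_interval j i HP (H i) t Ht) as [H1 H2]; split; [exact H1|].
  intros c Hc; eapply Rle_trans; [apply H2, Hc|].
  pose proof FD_D0_ge_0; pose proof FD_D1_ge_1.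
  replace (h * D * wt q (S j)) with (h * (D * wt q (S j))) by ring.
  apply Rmult_le_compat_l; [lra|]; unfold D.
  assert (D1 * (delta * wt q (S j)) <= D1 * wt q (S j)) by (apply Rmult_le_compat_l; nra); nra.
Qed.

(** * The limit of the FD series *)

(** The coefficient of tau^k in [N(t, V) U], where [V] and [U] are the series in tau with
    coefficients [v q] and [U p t]. *)
Definition FD_conv (v : nat -> vec) (t : R) (k : nat) (c : nat) : R :=
  sumn (S k) (fun p => matvec m (adomian (N t) (k - p) v) (U p t) c).

Lemma FD_conv_sum v t k c :
  FD_conv v t k c = sumn m (fun d => sum_f_R0 (fun p => U p t d * adomian (N t) (k - p) v c d) k).
Proof.
  unfold FD_conv, matvec; rewrite sumn_exchange; apply sumn_ext; intros d Hd.
  rewrite sum_f_R0_sumn; apply sumn_ext; intros; ring.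
Qed.

Lemma FD_rhs_conv j i t c :
  (c < m)%nat -> t0 <= t ->
  matvec m (N t (U 0%nat (g i))) (U (S j) t) c + FD_rhs m N phi g U (S j) i t c
  = FD_conv (fun q => U q (g i)) t (S j) c
    + (FD_conv (fun q => U q t) t j c - FD_conv (fun q => U q (g i)) t j c).
Proof.
  intros Hc Ht; set (nodes := fun q => U q (g i)); set (here := fun q => U q t).
  assert (E0 : matvec m (N t (U 0%nat (g i))) (U (S j) t) c
             = matvec m (adomian (N t) (S j - S j) nodes) (U (S j) t) c).
  { apply matvec_ext; [|reflexivity]; intros b Hb; rewrite Nat.sub_diag, adomian_0 by assumption; reflexivity. }
  assert (E1 : matvec m (adomian (N t) (S j - 0) nodes) (U 0%nat t) c
    = matvec m (adomian (N t) (S j) (fun q => if Nat.ltb q (S j) then U q (g i) else zerov)) (U 0%nat t) c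
      + matvec m (fun a b => sumn m (fun p => pderiv N p t (U 0%nat (g i)) a b * U (S j) (g i) p)) (U 0%nat t) c).
  { unfold matvec; rewrite <- sumn_plus; apply sumn_ext; intros b Hb; rewrite <- Rmult_plus_distr_r; f_equal.
    apply (adomian_linear_part t nodes); try assumption; try lia.
    - intros l c' Hl; destruct (Nat.ltb_spec l (S j)); [reflexivity|lia].
    - intros c'; rewrite Nat.ltb_irrefl; reflexivity. }
  assert (E2 : FD_conv here t j c - FD_conv nodes t j c
    = sumn (S j) (fun p => matvec m (fun a b => adomian (N t) (S j - 1 - p) here a b
                                              - adomian (N t) (S j - 1 - p) nodes a b) (U p t) c)).
  { unfold FD_conv; rewrite <- sumn_minus; apply sumn_ext; intros p Hp; unfold matvec.
    rewrite <- sumn_minus; apply sumn_ext; intros b Hb.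
    replace (S j - 1 - p)%nat with (j - p)%nat by lia; ring. }
  rewrite E2, E0; unfold FD_conv at 1.
  rewrite sumn_Sl, E1.
  rewrite (sumn_Sr j (fun k => matvec m (adomian (N t) (S j - S k) nodes) (U (S k) t) c)).
  unfold FD_rhs; fold nodes; fold here; replace (S j - 1)%nat with j by lia.
  cbv zeta; ring.
Qed.

(** Each order adds its node convolution and subtracts the preceding one. Only the last node
    convolution survives, and [FD_conv_bound] makes it tend to zero. *)
Lemma FD_partial_sum i t c n :
  (c < m)%nat -> t0 <= t ->
  sumn (S n) (fun k => matvec m (N t (U 0%nat (g i))) (U k t) c + FD_rhs m N phi g U k i t c)
  = phi t c + FD_conv (fun q => U q (g i)) t n c + sumn n (fun k => FD_conv (fun q => U q t) t k c).
Proof.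
  intros Hc Ht; induction n as [|n IH].
  - simpl; unfold FD_conv; simpl.
    rewrite (matvec_ext m (adomian (N t) 0 (fun q => U q (g i))) (N t (U 0%nat (g i))) (U 0%nat t) (U 0%nat t)).
    + ring.
    + intros b Hb; apply (adomian_0 t (fun q => U q (g i))); assumption.
    + reflexivity.
  - rewrite sumn_Sr, IH, FD_rhs_conv, (sumn_Sr n) by assumption; ring.
Qed.

Lemma FD_bound_everywhere j t c : (c < m)%nat -> t0 <= t -> Rabs (U j t c) <= K * wt q j.
Proof.
  intros Hc Ht; destruct (grid_locate t0 g t Hg Ht) as [i Hi].
  apply (FD_bounded_K j i); [apply FD_all_bounded|exact Hc|lra].
Qed.

Lemma FD_vnorm_bound j t : t0 <= t -> vnorm m (U j t) <= FD_level j.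
Proof.
  intros Ht; destruct (grid_locate t0 g t Hg Ht) as [i Hi].
  apply (FD_all_bounded j i t); lra.
Qed.

Lemma FD_conv_bound s t k c :
  (c < m)%nat -> t0 <= s -> t0 <= t ->
  Rabs (FD_conv (fun q => U q s) t k c) <= mm * (8 * (K * beta)) * wt q k.
Proof.
  intros Hc Hs Ht; pose proof FD_q_pos; pose proof FD_beta_ge_0.
  rewrite FD_conv_sum, Rmult_assoc; apply sumn_bound; intros d Hd.
  apply (conv_bound q (fun p => U p t d) (fun j => adomian (N t) j (fun q => U q s) c d)); try lra; try (unfold K; lra).
  - intros p Hp; apply FD_bound_everywhere; assumption.
  - intros p Hp; rewrite Rmult_comm.
    eapply Rle_trans; [apply (adomian_bound t _ p c d q K); try assumption; try lra; try (unfold K; lra)|].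
    + intros; apply FD_bound_everywhere; assumption.
    + apply Rmult_le_compat_l; [apply wt_ge_0; lra|]; apply Bsum_mono; unfold K; lra.
Qed.

Definition FD_limit (t : R) : vec := fun c => Series (fun j => U j t c).

Lemma FD_ex_series_wt : ex_series (wt q).
Proof. apply ex_series_wt; pose proof FD_q_pos; pose proof FD_q_le_1; lra. Qed.

Lemma is_series_sumn n (f : nat -> nat -> R) (s : nat -> R) :
  (forall d, (d < n)%nat -> is_series (f d) (s d)) -> is_series (fun k => sumn n (fun d => f d k)) (sumn n s).
Proof.
  induction n as [|n IH]; intros H; simpl.
  - apply (is_series_finite (fun _ => 0) 0); reflexivity.
  - apply (is_series_plus (fun k => sumn n (fun d => f d k)) (f n)); [apply IH; intros; apply H|apply H]; lia.
Qed.

Lemma is_series_FD_conv t c :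
  (c < m)%nat -> t0 <= t ->
  is_series (fun k => FD_conv (fun q => U q t) t k c) (matvec m (N t (FD_limit t)) (FD_limit t) c).
Proof.
  intros Hc Ht; pose proof FD_q_pos; pose proof FD_q_le_1; pose proof FD_beta_ge_0.
  replace (matvec m (N t (FD_limit t)) (FD_limit t) c)
    with (sumn m (fun d => FD_limit t d * N t (FD_limit t) c d)) by (apply sumn_ext; intros; ring).
  replace (fun k => FD_conv (fun q => U q t) t k c)
    with (fun k => sumn m (fun d => sum_f_R0 (fun p => U p t d * adomian (N t) (k - p) (fun q => U q t) c d) k))
    by (apply functional_extensionality; intros; rewrite FD_conv_sum; reflexivity).
  apply (is_series_sumn m (fun d k => sum_f_R0 (fun p => U p t d * adomian (N t) (k - p) (fun q => U q t) c d) k)).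
  intros d Hd.
  assert (HUb : forall l, Rabs (U l t d) <= K * wt q l) by (intros; apply FD_bound_everywhere; assumption).
  assert (HK1 : 1 <= K) by (unfold K; lra).
  apply (is_series_mult (fun p => U p t d) (fun j => adomian (N t) j (fun q => U q t) c d)).
  - apply Series_correct, (series_dominated _ (fun l => K * wt q l)); [exact HUb|apply ex_series_scal_R, FD_ex_series_wt].
  - apply (is_series_adomian t c d (fun q => U q t) q K); try assumption; try lra.
    intros; apply FD_bound_everywhere; assumption.
  - apply (ex_series_abs_dominated _ (fun l => K * wt q l)); [exact HUb|apply ex_series_scal_R, FD_ex_series_wt].
  - apply (ex_series_abs_dominated _ (fun l => Bsum (8 * K) * wt q l)); [|apply ex_series_scal_R, FD_ex_series_wt].
    intros n; rewrite Rmult_comm; apply adomian_bound; try assumption; try lra.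
    intros; apply FD_bound_everywhere; assumption.
Qed.

Lemma FD_limit_continuity c : (c < m)%nat -> continuity (fun t => FD_limit (Rmax t0 t) c).
Proof.
  intros Hc t; apply (continuity_pt_Series (fun j t => U j (Rmax t0 t) c) (fun j => K * wt q j) t 1 Rlt_0_1).
  - intros n; apply (FD_seq_continuity g U n c HU Hc).
  - intros n s _; apply FD_bound_everywhere; [exact Hc|apply Rmax_l].
  - apply ex_series_scal_R, FD_ex_series_wt.
Qed.

Lemma FD_limit_start c : (c < m)%nat -> FD_limit t0 c = u0 c.
Proof.
  intros Hc; apply is_series_unique; destruct HU as [_ [H0 [H1 _]]].
  rewrite <- (H0 c Hc); apply (is_series_finite (fun j => U j t0 c) 0).
  intros [|n] Hn; [lia|apply H1, Hc].
Qed.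

Definition FD_field (c : nat) (t : R) : R :=
  matvec m (N (Rmax t0 t) (FD_limit (Rmax t0 t))) (FD_limit (Rmax t0 t)) c + phi (Rmax t0 t) c.

Lemma FD_field_continuity c : (c < m)%nat -> continuity (FD_field c).
Proof.
  intros Hc t; apply (continuity_pt_plus
    (fun t => matvec m (N (Rmax t0 t) (FD_limit (Rmax t0 t))) (FD_limit (Rmax t0 t)) c)).
  - apply (continuity_pt_matvec (fun t => N (Rmax t0 t) (FD_limit (Rmax t0 t))) (fun t => FD_limit (Rmax t0 t))).
    + intros b Hb; apply (continuity_pt_N (fun t => FD_limit (Rmax t0 t))); try assumption.
      intros c' Hc'; apply FD_limit_continuity, Hc'.
    + intros b Hb; apply FD_limit_continuity, Hb.
  - apply (cont_on_clamp t0 (fun s => phi s c)), Hphic, Hc.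
Qed.

(* The partial sums of the right-hand sides telescope, see [FD_partial_sum]. *)
Lemma FD_limit_interval i c t :
  (c < m)%nat -> g i <= t <= g (S i) ->
  FD_limit t c - FD_limit (g i) c = prim t0 (FD_field c) t - prim t0 (FD_field c) (g i).
Proof.
  intros Hc Ht; pose proof (grid_ge t0 g i Hg) as Hgi.
  pose proof FD_q_pos; pose proof FD_beta_ge_0; pose proof FD_mm_ge_0.
  set (C := mm * (8 * (K * beta))).
  assert (HC : ex_series (fun k => C * wt q k)) by (apply ex_series_scal_R, FD_ex_series_wt).
  assert (HC0 : forall k, Rabs (C * wt q k) <= C * wt q k).
  { intros k; rewrite Rabs_right; [lra|]; apply Rle_ge, Rmult_le_pos; [|apply wt_ge_0; lra].
    unfold C; assert (0 <= K * beta) by (unfold K; nra); nra. }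
  pose proof (limit_of_antiderivatives
    (fun n s => sumn (S (S n)) (fun k => U k (Rmax t0 s) c))
    (fun n s => sumn (S (S n)) (fun k => matvec m (N s (U 0%nat (g i))) (U k s) c + FD_rhs m N phi g U k i s c))
    (fun s => FD_limit (Rmax t0 s) c) (FD_field c) (prim t0 (FD_field c)) (g i) (g (S i))) as HL.
  cbv beta in HL.
  rewrite <- (Rmax_right t0 t) at 1 by lra; rewrite <- (Rmax_right t0 (g i)) at 1 by lra.
  apply HL; try lra; clear HL.
  - intros n s Hs; apply (derivable_pt_lim_sumn (S (S n)) (fun k s => U k (Rmax t0 s) c)).
    intros k _; apply FD_seq_derivable; assumption.
  - intros n s _; apply (continuity_pt_sumn (S (S n)) (fun k s => U k (Rmax t0 s) c)).
    intros k _; apply (FD_seq_continuity g); assumption.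
  - intros s _; apply derivable_prim, FD_field_continuity, Hc.
  - intros eps Heps.
    destruct (series_tail_small _ (eps / 2) HC ltac:(lra)) as [n0 Hn0].
    exists n0; intros n Hn s Hs; specialize (Hn0 n Hn).
    rewrite FD_partial_sum by (try exact Hc; lra); unfold FD_field; rewrite Rmax_right by lra.
    rewrite <- (is_series_unique _ _ (is_series_FD_conv s c Hc ltac:(lra))), <- sum_f_R0_sumn.
    set (b := fun k => FD_conv (fun q => U q s) s k c).
    assert (Hb : forall k, Rabs (b k) <= C * wt q k) by (intros; apply FD_conv_bound; try exact Hc; lra).
    (* Both errors lie below the tail of the majorant after [n]: the missing orders by [T1], and the
       surviving node term by [T3] with [T2], since that tail contains the order [S n]. Hence the
       choice of [eps / 2]. *)
    pose proof (series_tail_dominated b _ n Hb HC) as T1.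
    pose proof (series_tail_dominated _ _ (S n) HC0 HC) as T2.
    pose proof (FD_conv_bound (g i) s (S n) c Hc Hgi ltac:(lra)) as T3; fold C in T3.
    pose proof (Rabs_pos (Series (fun k => C * wt q k) - sum_f_R0 (fun k => C * wt q k) (S n))) as T4.
    rewrite tech5 in T2, T4.
    apply Rabs_def2 in Hn0; apply Rabs_le_between in T1; apply Rabs_le_between in T3.
    apply Rabs_le; lra.
  - intros s Hs eps Heps.
    destruct (series_tail_small (fun j => U j (Rmax t0 s) c) eps) as [n0 Hn0]; [|exact Heps|].
    + apply (series_dominated _ (fun j => K * wt q j)); [|apply ex_series_scal_R, FD_ex_series_wt].
      intros; apply FD_bound_everywhere; [exact Hc|apply Rmax_l].
    + exists n0; intros n Hn; unfold Rdist; rewrite <- sum_f_R0_sumn, Rabs_minus_sym; apply Hn0; lia.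
Qed.

(** Partial sums may have kinks at the nodes. The increment identity adds up across nodes to an
    integral equation, whose right-hand side is differentiable everywhere. *)
Lemma FD_limit_solution : is_solution m N phi t0 u0 FD_limit.
Proof.
  assert (Hnode : forall i c, (c < m)%nat -> FD_limit (g i) c = u0 c + prim t0 (FD_field c) (g i)).
  { intros i c Hc; induction i as [|i IH].
    - rewrite (proj1 Hg), FD_limit_start, prim_start by exact Hc; ring.
    - pose proof (FD_limit_interval i c (g (S i)) Hc ltac:(split; [apply Rlt_le, Hg|lra])); lra. }
  assert (Hall : forall t c, (c < m)%nat -> t0 <= t -> FD_limit t c = u0 c + prim t0 (FD_field c) t).
  { intros t c Hc Ht; destruct (grid_locate t0 g t Hg Ht) as [i Hi].
    pose proof (FD_limit_interval i c t Hc ltac:(lra)); pose proof (Hnode i c Hc); lra. }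
  split; [intros c Hc; apply FD_limit_start, Hc|].
  exists (fun t c => FD_field c t); intros t Ht c Hc; split.
  - apply (deriv_within_ext _ (fun s => u0 c + prim t0 (FD_field c) s)); [exact Ht| |].
    + intros s Hs; symmetry; apply Hall; assumption.
    + apply derivable_deriv_within; rewrite <- (Rplus_0_l (FD_field c t)).
      apply (derivable_pt_lim_plus (fun _ => u0 c)); [apply derivable_pt_lim_const|].
      apply derivable_prim, FD_field_continuity, Hc.
  - unfold FD_field; rewrite Rmax_right by exact Ht; ring.
Qed.

(** All remaining orders are positive, so the constant is [delta] rather than [K]. *)
Lemma FD_tail_bound t c n :
  (c < m)%nat -> t0 <= t ->
  Rabs (FD_limit t c - FD_approx U n t c) <= delta * Series (fun k => wt q (S n + k)).
Proof.
  intros Hc Ht; unfold FD_limit, FD_approx.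
  assert (Hex : ex_series (fun j => U j t c)).
  { apply (series_dominated _ (fun j => K * wt q j)); [|apply ex_series_scal_R, FD_ex_series_wt].
    intros; apply FD_bound_everywhere; assumption. }
  rewrite (Series_incr_n (fun j => U j t c) (S n)) by (lia || exact Hex); simpl pred.
  replace (_ - _) with (Series (fun k => U (S n + k)%nat t c)) by ring.
  rewrite <- Series_scal_l; apply series_dominated.
  - intros k; destruct (grid_locate t0 g t Hg Ht) as [i Hi].
    apply (FD_bounded_pos _ i); [apply FD_all_bounded|lia|exact Hc|lra].
  - apply ex_series_scal_R, (ex_series_incr_n (wt q) (S n)), FD_ex_series_wt.
Qed.

Lemma FD_abs_convergent t : t0 <= t -> ex_series (fun j => vnorm m (U j t)).
Proof.
  intros Ht; apply (series_dominated _ (fun j => K * wt q j)); [|apply ex_series_scal_R, FD_ex_series_wt].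
  intros j; rewrite Rabs_right by (apply Rle_ge, vnorm_ge_0).
  eapply Rle_trans; [apply FD_vnorm_bound, Ht|].
  pose proof FD_q_pos; pose proof (wt_ge_0 q j ltac:(lra)).
  destruct j; unfold FD_level, K; [rewrite wt_0; lra|nra].
Qed.

End FDBounds.

(** * Uniqueness *)

(** By [N_monotone] the difference of two solutions cannot grow in norm, and it starts at zero; this
    is the energy barrier at level 0. *)
Lemma solution_unique u w :
  is_solution m N phi t0 u0 u -> is_solution m N phi t0 u0 w ->
  forall t, t0 <= t -> forall c, (c < m)%nat -> w t c = u t c.
Proof.
  intros [Hu0 [du Hdu]] [Hw0 [dw Hdw]] T HT c Hc.
  assert (Hcont : forall (v dv : R -> vec), (forall t, t0 <= t -> forall c, (c < m)%nat ->
      deriv_within (fun s => t0 <= s) (fun s => v s c) t (dv t c) /\ dv t c - matvec m (N t (v t)) (v t) c = phi t c) ->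
      forall c, (c < m)%nat -> continuity (fun s => v (Rmax t0 s) c) /\
        forall t, t0 < t -> derivable_pt_lim (fun s => v (Rmax t0 s) c) t (dv t c)).
  { intros v dv Hv d Hd; split.
    - apply (cont_on_clamp t0 (fun s => v s d)), deriv_within_cont_on.
      intros s Hs; exists (dv s d); apply Hv; assumption.
    - intros t Ht; assert (Hin : forall y, Rabs (y - t) < t - t0 -> t0 <= y)
        by (intros y Hy; apply Rabs_def2 in Hy; lra).
      apply (derivable_pt_lim_local (fun s => v s d) _ t _ (t - t0)); [lra| |].
      + intros y Hy; rewrite Rmax_right by (apply Hin, Hy); reflexivity.
      + apply (deriv_within_interior (fun s => t0 <= s) _ t _ (t - t0)); [lra|exact Hin|].
        apply Hv; [lra|exact Hd]. }
  assert (Hz : vnorm m (fun d => w (Rmax t0 T) d - u (Rmax t0 T) d) <= 0).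
  { apply (energy_barrier (fun s d => w (Rmax t0 s) d - u (Rmax t0 s) d) (fun s d => dw s d - du s d) t0 T 0 1); try lra.
    - intros d s Hd _; apply (continuity_pt_minus (fun s => w (Rmax t0 s) d) (fun s => u (Rmax t0 s) d));
        [apply (Hcont w dw Hdw d Hd)|apply (Hcont u du Hdu d Hd)].
    - intros d s Hd Hs; apply (derivable_pt_lim_minus (fun s => w (Rmax t0 s) d) (fun s => u (Rmax t0 s) d));
        [apply (Hcont w dw Hdw d Hd)|apply (Hcont u du Hdu d Hd)]; lra.
    - intros s Hs _ _; rewrite Rmax_right by lra.
      pose proof (N_monotone s (u s) (fun d => w s d - u s d) ltac:(lra)) as Hm.
      pose proof (dot_ge_0 m (fun d => w s d - u s d)) as Hp.
      eapply Rle_trans; [|eapply Rle_trans; [exact Hm|nra]].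
      apply Req_le, dot_ext; [reflexivity|]; intros d Hd.
      replace (fun c => u s c + (w s c - u s c)) with (w s) by (apply functional_extensionality; intros; ring).
      destruct (Hdw s ltac:(lra) d Hd) as [_ E1]; destruct (Hdu s ltac:(lra) d Hd) as [_ E2]; lra.
    - apply vnorm_le_iff; [lra|]; unfold dot; rewrite sumn_0; [lra|].
      intros d Hd; rewrite Rmax_left, Hw0, Hu0 by (lra || assumption); ring. }
  rewrite Rmax_right in Hz by exact HT.
  pose proof (Rabs_le_vnorm m (fun d => w T d - u T d) c Hc) as Hle; simpl in Hle.
  pose proof (Rabs_pos (w T c - u T c)).
  destruct (Req_dec (w T c - u T c) 0) as [E|E]; [lra|apply Rabs_pos_lt in E; lra].
Qed.

(** * Convergence on fine grids *)

Lemma exists_small C1 C2 C3 C4 e1 e2 e3 e4 :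
  0 <= C1 -> 0 <= C2 -> 0 <= C3 -> 0 <= C4 -> 0 < e1 -> 0 < e2 -> 0 < e3 -> 0 < e4 ->
  exists x, 0 < x <= 1 /\ C1 * x <= e1 /\ C2 * x <= e2 /\ C3 * x <= e3 /\ C4 * x <= e4.
Proof.
  intros HC1 HC2 HC3 HC4 He1 He2 He3 He4.
  set (e := Rmin (Rmin e1 e2) (Rmin e3 e4)); set (C := C1 + C2 + C3 + C4 + 1).
  assert (He : 0 < e /\ e <= e1 /\ e <= e2 /\ e <= e3 /\ e <= e4).
  { unfold e; repeat split; [repeat apply Rmin_pos; assumption|..];
      unfold Rmin; repeat destruct Rle_dec; lra. }
  set (x := Rmin 1 (e / C)).
  assert (Hx : 0 < x) by (apply Rmin_pos; [lra|apply Rdiv_lt_0_compat; unfold C; lra]).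
  assert (HCx : C * x <= e).
  { apply Rle_trans with (C * (e / C)); [apply Rmult_le_compat_l; [unfold C; lra|apply Rmin_r]|].
    right; field; unfold C; lra. }
  exists x; split; [split; [exact Hx|apply Rmin_l]|]; unfold C in HCx; repeat split; nra.
Qed.

(** [delta] and [r] are fixed before the grid. The limit is here attached to its own grid; that it
    does not depend on the grid follows only with uniqueness. *)
Lemma FD_convergence :
  exists delta r, 0 < delta /\ 0 < r /\
    forall g U h, is_grid t0 g -> FD_seq m N phi t0 u0 g U -> 0 < h <= r -> (forall i, g (S i) - g i <= h) ->
      is_solution m N phi t0 u0 (FD_limit U) /\
      (forall t c n, (c < m)%nat -> t0 <= t ->
         Rabs (FD_limit U t c - FD_approx U n t c) <= delta * Series (fun k => wt (h / r) (S n + k))) /\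
      (forall t, t0 <= t -> ex_series (fun j => vnorm m (U j t))).
Proof.
  pose proof kappa_ge_0 as Hk; pose proof (pos_INR m) as Hmm; pose proof (vnorm_ge_0 m u0) as Hv.
  (* The three summands provide [rho >= 1], the bound on the initial value, and
     [m kappa <= alpha / 2 * rho], by which dissipation outweighs [phi] at level [rho]. *)
  set (rho := 1 + vnorm m u0 + 2 * INR m * kappa / alpha).
  assert (Hq : 0 <= 2 * INR m * kappa / alpha) by (apply Rdiv_le_0_compat; [nra|exact Halpha]).
  assert (Hrho : 1 <= rho) by (unfold rho; lra).
  assert (Hkap : INR m * kappa <= alpha / 2 * rho).
  { unfold rho; replace (INR m * kappa) with (alpha / 2 * (2 * INR m * kappa / alpha)) by (field; lra).
    apply Rmult_le_compat_l; lra. }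
  set (K := 2 * rho); assert (HK : 2 <= K) by (unfold K; lra).
  set (beta := Bsum (4 * (8 * K))); assert (Hbeta : 0 <= beta) by (apply Bsum_ge_0; lra).
  set (mm := INR m) in *.
  set (D0 := mm * (beta * K) + kappa).
  assert (HD0 : 0 <= D0) by (unfold D0; assert (0 <= beta * K) by nra; nra).
  set (D1 := mm * (beta * 2) + mm * (mm * beta * K) + 1).
  assert (HD1 : 1 <= D1).
  { unfold D1; assert (0 <= mm * beta) by nra; assert (0 <= mm * beta * K) by nra; nra. }
  set (A := 8 * mm * beta + mm * beta * K).
  assert (HA : 0 <= A) by (unfold A; assert (0 <= mm * beta) by nra; nra).
  (* [delta] comes before [r]: its conditions involve only the quadratic terms, whereas those on [r]
     compare with [delta]. *)
  destruct (exists_small A (mm * A) 0 0 (/ 2) (alpha / 4) 1 1) as [delta [Hdelta [Hd1 [Hd2 _]]]]; try lra; [nra|].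
  set (E := 32 * mm * (D0 + D1) * beta * K).
  assert (HE : 0 <= E) by (unfold E; repeat apply Rmult_le_pos; lra).
  set (F := mm * (mm * mm * beta * (D1 * K + 2 * D0))).
  assert (HF : 0 <= F) by (unfold F; repeat apply Rmult_le_pos; try assumption; nra).
  set (G := mm * (mm * (D0 * beta * K))).
  assert (HG : 0 <= G) by (unfold G; repeat apply Rmult_le_pos; try assumption; lra).
  destruct (exists_small E (mm * E) F G (delta / 2) (alpha / 4 * delta) (alpha / 2) (alpha / 2))
    as [r [Hr [Hr1 [Hr2 [Hr3 Hr4]]]]]; try lra; try nra.
  exists delta, r; split; [lra|]; split; [lra|].
  intros g U h Hg HU Hh Hstep.
  assert (Hu : vnorm m u0 <= rho) by (unfold rho; lra).
  assert (Q2 : mm * (A * delta) <= alpha / 4) by lra.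
  assert (Q3 : mm * (E * r) <= alpha / 4 * delta) by lra.
  assert (Q4 : r * F <= alpha / 2) by lra.
  assert (Q5 : r * G <= alpha / 2) by lra.
  assert (Hr0 : 0 < r) by lra.
  split; [|split].
  - exact (FD_limit_solution rho delta r Hrho Hu Hkap Hdelta Hr0 Hd1 Q2 Hr1 Q3 Q4 Q5 g U h Hg HU Hh Hstep).
  - exact (FD_tail_bound rho delta r Hrho Hu Hkap Hdelta Hr0 Hd1 Q2 Hr1 Q3 Q4 Q5 g U h Hg HU Hh Hstep).
  - exact (FD_abs_convergent rho delta r Hrho Hu Hkap Hdelta Hr0 Hd1 Q2 Hr1 Q3 Q4 Q5 g U h Hg HU Hh Hstep).
Qed.

End CoefficientFunctional.

(** * Tails of the weights and the error estimates *)

Lemma grid_step_spec t0 g h : is_grid t0 g -> grid_step g h -> 0 < h /\ forall i, g (S i) - g i <= h.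
Proof.
  intros [_ [Hg _]] [Hub _]; assert (H : forall i, g (S i) - g i <= h) by (intros i; apply Hub; exists i; reflexivity).
  split; [|exact H]; specialize (H 0%nat); specialize (Hg 0%nat); lra.
Qed.

Lemma uniform_grid t0 r : 0 < r -> is_grid t0 (fun n => t0 + INR n * r).
Proof.
  intros Hr; split; [simpl; ring|]; split.
  - intros n; rewrite S_INR; lra.
  - intros M; destruct (INR_unbounded ((M - t0) / r)) as [n Hn]; exists n.
    apply (Rmult_gt_compat_r r) in Hn; [|exact Hr].
    unfold Rdiv in Hn; rewrite Rmult_assoc, Rinv_l in Hn; lra.
Qed.

Lemma Rpower_INR_2 n : (0 < n)%nat -> Rpower (INR n) (1 + 1) = INR n ^ 2.
Proof.
  intros Hn; replace (1 + 1) with (INR 2) by (simpl; ring); apply Rpower_pow, lt_0_INR, Hn.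
Qed.

(** Every denominator (p + k + 2)^2 of the tail is at least (p + 1)^2, which leaves a geometric
    series. *)
Lemma wt_tail_geometric q p :
  0 <= q < 1 -> Series (fun k => wt q (S p + k)) <= / INR (p + 1) ^ 2 * (q ^ (p + 1) / (1 - q)).
Proof.
  intros Hq; rewrite plus_INR; change (INR 1) with 1.
  unfold Rdiv; rewrite <- Rmult_assoc, <- (Series_geom q) by (rewrite Rabs_right; lra).
  rewrite <- Series_scal_l; apply Series_le.
  - intros k; split; [apply wt_ge_0; lra|]; unfold wt.
    replace (S p + k)%nat with (p + 1 + k)%nat by lia; rewrite pow_add, !plus_INR; change (INR 1) with 1.
    pose proof (pos_INR p); pose proof (pos_INR k).
    rewrite (Rmult_comm (q ^ (p + 1) * q ^ k)), Rmult_assoc.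
    apply Rmult_le_compat_r; [apply Rmult_le_pos; apply pow_le; lra|].
    apply Rinv_le_contravar; [apply pow_lt; lra|apply pow_incr; lra].
  - apply ex_series_scal_R, ex_series_geom; rewrite Rabs_right; lra.
Qed.

Theorem theorem2 (m : nat) (t0 : R) (N : R -> vec -> mat)
  (Ncoef : list nat -> R -> mat) (phi : R -> vec) (kappa alpha : R)
  (* 1. power-series structure of N *)
  (HNser : forall t, t0 <= t -> forall (u : vec) a b, (a < m)%nat -> (b < m)%nat ->
     infinite_sum
       (fun p => lsum (multi_indices m p) (fun i => mono i u * Ncoef i t a b))
       (N t u a b))
  (HNcont : forall p i, In i (multi_indices m p) -> forall a b, (a < m)%nat -> (b < m)%nat ->
     cont_on (fun s => t0 <= s) (fun s => Ncoef i s a b))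
  (HB : exists B : nat -> R,
     (forall p, 0 <= B p) /\
     (forall p, exists S : list nat -> R,
        (forall i, In i (multi_indices m p) ->
           forall t, t0 <= t -> opnorm m (Ncoef i t) <= S i) /\
        lsum (multi_indices m p) S <= B p) /\
     (forall x : R, exists l, infinite_sum (fun p => B p * x ^ p) l))
  (* 2. phi continuous and bounded by kappa *)
  (Hphic : forall c, (c < m)%nat -> cont_on (fun s => t0 <= s) (fun s => phi s c))
  (Hphib : forall t, t0 <= t -> vnorm m (phi t) <= kappa)
  (* 3. one-sided Lipschitz-type condition on J *)
  (Halpha : 0 < alpha)
  (HJ : forall t, t0 <= t -> forall u v : vec,
     dot m v (matvec m (Jac m N t u) v) <= - alpha * dot m v v) :
  forall u0 : vec,
  exists u : R -> vec,
    is_solution m N phi t0 u0 u /\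
    (forall w, is_solution m N phi t0 u0 w ->
       forall t, t0 <= t -> forall c, (c < m)%nat -> w t c = u t c) /\
    (* the FD-method is well defined on every grid *)
    (forall g, is_grid t0 g -> exists U, FD_seq m N phi t0 u0 g U) /\
    (* convergence of the FD-method to u *)
    (exists hbar, 0 < hbar /\
       forall g h, is_grid t0 g -> grid_step g h -> h <= hbar ->
       forall U, FD_seq m N phi t0 u0 g U ->
         (forall t, t0 <= t -> exists l,
            infinite_sum (fun j => vnorm m (U j t)) l) /\
         (forall eps, 0 < eps -> exists n0 : nat, forall n, (n0 <= n)%nat ->
            forall t, t0 <= t -> vnorm m (vsub (u t) (FD_approx U n t)) < eps)) /\
    (* a priori error estimates *)
    (exists C Rr eps, 0 < C /\ 0 < Rr /\ 0 < eps /\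
       forall g h, is_grid t0 g -> grid_step g h ->
       forall U, FD_seq m N phi t0 u0 g U ->
       forall p : nat,
         (h < Rr -> forall t, t0 <= t ->
            vnorm m (vsub (u t) (FD_approx U p t))
              <= C / Rpower (INR (p + 1)) (1 + eps)
                   * ((h / Rr) ^ (p + 1) / (1 - h / Rr))) /\
         (h = Rr -> forall S,
            infinite_sum (fun n => / Rpower (INR (n + p + 2)) (1 + eps)) S ->
            forall t, t0 <= t ->
              vnorm m (vsub (u t) (FD_approx U p t)) <= C * S)).
Proof.
  intros u0; destruct HB as [B [HB0 [HBS HBx]]].
  destruct (FD_convergence m t0 N Ncoef B HNser HNcont HB0 HBS HBx alpha HJ phi u0 Hphic kappa Hphib Halpha)
    as [delta [r [Hdelta [Hr Hconv]]]].
  assert (Hex := FD_seq_exists m t0 N Ncoef B HNser HNcont HB0 HBS HBx phi u0 Hphic).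
  (* The solution is constructed on the uniform grid of step [r]; uniqueness then identifies it with
     the FD limit on every grid of step at most [r]. *)
  destruct (Hex _ (uniform_grid t0 r Hr)) as [U0 HU0].
  set (u := FD_limit U0).
  assert (Hu : is_solution m N phi t0 u0 u).
  { apply (Hconv _ _ r (uniform_grid t0 r Hr) HU0); [lra|]; intros i; rewrite S_INR; lra. }
  assert (Huniq : forall w, is_solution m N phi t0 u0 w -> forall t, t0 <= t -> forall c, (c < m)%nat -> w t c = u t c).
  { intros w Hw; apply (solution_unique m t0 N Ncoef B HNser HBS HBx alpha HJ phi u0 Halpha); assumption. }
  pose proof (pos_INR m) as Hmm.
  assert (Herr : forall g h U n, is_grid t0 g -> grid_step g h -> h <= r -> FD_seq m N phi t0 u0 g U ->
    forall t, t0 <= t ->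
    vnorm m (vsub (u t) (FD_approx U n t)) <= INR m * (delta * Series (fun k => wt (h / r) (S n + k)))).
  { intros g h U n Hg Hh Hhr HU t Ht; destruct (grid_step_spec t0 g h Hg Hh) as [Hh0 Hst].
    destruct (Hconv g U h Hg HU ltac:(lra) Hst) as [Hsol [Htail _]].
    assert (Hb : forall c, (c < m)%nat ->
      Rabs (vsub (u t) (FD_approx U n t) c) <= delta * Series (fun k => wt (h / r) (S n + k))).
    { intros c Hc; unfold vsub; rewrite <- (Huniq _ Hsol t Ht c Hc); apply Htail; assumption. }
    (* For [m = 0] there is no component from which to infer that the bound is nonnegative, but both
       sides are zero. *)
    destruct m as [|m'].
    - unfold vnorm, dot; simpl; rewrite sqrt_0; lra.
    - apply vnorm_le_INR; [|exact Hb]; eapply Rle_trans; [apply Rabs_pos|apply (Hb 0%nat); lia]. }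
  exists u; split; [exact Hu|]; split; [exact Huniq|]; split; [exact Hex|]; split.
  (* The value [h = r] is admissible: the weights then are the inverse squares, still summable. *)
  - exists r; split; [exact Hr|]; intros g h Hg Hh Hhr U HU.
    destruct (grid_step_spec t0 g h Hg Hh) as [Hh0 Hst]; split.
    + intros t Ht; destruct (Hconv g U h Hg HU ltac:(lra) Hst) as [_ [_ Habs]].
      destruct (Habs t Ht) as [l Hl]; exists l; apply is_series_Reals, Hl.
    + intros eps Heps; set (q := h / r).
      assert (Hq : 0 <= q <= 1).
      { split; [apply Rdiv_le_0_compat; lra|].
        unfold q; apply Rmult_le_reg_r with r; [lra|]; unfold Rdiv; rewrite Rmult_assoc, Rinv_l; lra. }
      pose proof (ex_series_wt q Hq) as Hwt.
      destruct (series_tail_small (wt q) (eps / (INR m * delta + 1)) Hwt) as [n0 Hn0].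
      { apply Rdiv_lt_0_compat; [exact Heps|nra]. }
      exists n0; intros n Hn t Ht; specialize (Hn0 n Hn).
      eapply Rle_lt_trans; [apply (Herr g h U n); assumption|]; fold q.
      rewrite (Series_incr_n (wt q) (S n)) in Hn0 by (lia || exact Hwt); simpl pred in Hn0.
      set (T := Series (fun k => wt q (S n + k))) in *.
      replace (sum_f_R0 (wt q) n + T - sum_f_R0 (wt q) n) with T in Hn0 by ring.
      apply Rabs_def2 in Hn0; destruct Hn0 as [Hn0 _].
      apply (Rmult_lt_compat_r (INR m * delta + 1)) in Hn0; [|nra].
      unfold Rdiv in Hn0; rewrite Rmult_assoc, Rinv_l, Rmult_1_r in Hn0 by nra.
      assert (0 <= T).
      { destruct (series_dominated (fun k => wt q (S n + k)) (fun k => wt q (S n + k))) as [_ H0].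
        - intros k; rewrite Rabs_right; [lra|apply Rle_ge, wt_ge_0; lra].
        - apply (ex_series_incr_n (wt q) (S n)), Hwt.
        - eapply Rle_trans; [apply Rabs_pos|exact H0]. }
      lra.
  (* The exponent [1 + 1] is that of the weights; [INR m] converts component bounds into the norm,
     and the added 1 keeps the constant positive when [m = 0]. *)
  - exists (INR m * delta + 1), r, 1; split; [nra|]; split; [exact Hr|]; split; [lra|].
    intros g h Hg Hh U HU p; destruct (grid_step_spec t0 g h Hg Hh) as [Hh0 Hst]; split.
    + intros Hhr t Ht; eapply Rle_trans; [apply (Herr g h U p Hg Hh ltac:(lra) HU t Ht)|].
      set (q := h / r).
      assert (Hq : 0 <= q < 1).
      { split; [apply Rdiv_le_0_compat; lra|].
        unfold q; apply Rmult_lt_reg_r with r; [lra|]; unfold Rdiv; rewrite Rmult_assoc, Rinv_l; lra. }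
      pose proof (wt_tail_geometric q p Hq) as HT.
      rewrite Rpower_INR_2 by lia; unfold Rdiv at 1; rewrite Rmult_assoc.
      set (X := / INR (p + 1) ^ 2 * (q ^ (p + 1) / (1 - q))) in *.
      assert (0 <= X).
      { apply Rmult_le_pos; [apply Rlt_le, Rinv_0_lt_compat, pow_lt, lt_0_INR; lia|].
        apply Rdiv_le_0_compat; [apply pow_le; lra|lra]. }
      apply (Rmult_le_compat_l (INR m * delta)) in HT; [lra|nra].
    + intros Hhr S HS t Ht; eapply Rle_trans; [apply (Herr g h U p Hg Hh ltac:(lra) HU t Ht)|].
      (* At [q = 1] the weight of order [p + 1 + k] is 1/(p + k + 2)^2, which matches the shift
         [n + p + 2] in the statement. *)
      assert (Heq : (fun k => wt (h / r) (Datatypes.S p + k)) = (fun n => / Rpower (INR (n + p + 2)) (1 + 1))).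
      { apply functional_extensionality; intros k; rewrite Rpower_INR_2 by lia.
        unfold wt; replace (h / r) with 1 by (rewrite Hhr; field; lra); rewrite pow1, Rmult_1_l.
        rewrite <- S_INR; do 3 f_equal; lia. }
      rewrite Heq; apply is_series_Reals in HS; rewrite (is_series_unique _ _ HS).
      assert (0 <= S).
      { rewrite <- (is_series_unique _ _ HS), <- Heq.
        replace (h / r) with 1 by (rewrite Hhr; field; lra).
        destruct (series_dominated (fun k => wt 1 (Datatypes.S p + k)) (fun k => wt 1 (Datatypes.S p + k))) as [_ H0].
        - intros k; rewrite Rabs_right; [lra|apply Rle_ge, wt_ge_0; lra].
        - apply (ex_series_incr_n (wt 1) (Datatypes.S p)), ex_series_wt; lra.
        - eapply Rle_trans; [apply Rabs_pos|exact H0]. }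
      lra.
Qed.
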